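(* Let $M$ be a Riemannian manifold, let $n\ge1$, and let $\mathbb{S}^n$ be the Euclidean unit sphere of dimension $n$. (i) Any surjective and submersive harmonic morphism $\phi:M\to\mathbb{S}^n$ is infinitesimally rigid. (ii) Let $n$ be odd and let $M$ be compact. Then any surjective and submersive harmonic morphism $\phi:M\to\mathbb{S}^n$ is locally rigid.
   Context: Harmonic maps: a smooth map $\phi:(M,g)\to(N,h)$ is harmonic if its tension field $\tau_\phi=\operatorname{trace}\nabla d\phi=\sum_i\{\nabla^{\phi}_{e_i}(d\phi(e_i))-d\phi(\nabla^M_{e_i}e_i)\}$ vanishes, where $\{e_i\}$ is a local orthonormal frame on $M$, $\nabla^M$ is the Levi-Civita connection of $M$, and $\nabla^{\phi}$ is the pull-back to $\phi^{-1}TN$ of the Levi-Civita connection of $N$. Harmonic morphisms: maps which pull back (locally defined) harmonic functions on $N$ to harmonic functions on $M$; equivalently, maps that are both harmonic and horizontally (weakly) conformal. Here $\phi$ is horizontally (weakly) conformal if for every $x\in M$ either the restriction of $d\phi_x$ to $(\ker d\phi_x)^{\perp}$ is conformal and surjective onto $T_{\phi(x)}N$, or $d\phi_x=0$. Jacobi fields: for a harmonic map $\phi:M\to N$ and a smooth section $V\in\Gamma(\phi^{-1}TN)$, $$J^{\phi}V=-\sum_i\{\nabla^{\phi}_{e_i}\nabla^{\phi}_{e_i}V-\nabla^{\phi}_{\nabla^M_{e_i}e_i}V\}-\sum_iR^N(d\phi(e_i),V)d\phi(e_i),$$ where $\{e_i\}$ is a local orthonormal frame on $M$ and $R^N(X,Y)Z=-\nabla_X\nabla_YZ+\nabla_Y\nabla_XZ+\nabla_{[X,Y]}Z$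 (Milnor's convention). Put $J(\phi)=\ker J^{\phi}$, the space of Jacobi fields along $\phi$. For a harmonic map $\phi:M\to\mathbb{S}^n$ put $$K(\phi)=\{V\in J(\phi):\operatorname{trace}\langle d\phi,\nabla^{\phi}V\rangle=0\},\qquad \operatorname{trace}\langle d\phi,\nabla^{\phi}V\rangle=\sum_i\langle d\phi(e_i),\nabla^{\phi}_{e_i}V\rangle.$$ A section $V\in\Gamma(\phi^{-1}T\mathbb{S}^n)$ is a harmonic variation of $\phi$ if the map $\phi_t=\exp(tV):M\to\mathbb{S}^n$, $x\mapsto\exp_{\phi(x)}(tV(x))$, is harmonic for all $t\in\mathbb{R}$. A section $V\in\Gamma(\phi^{-1}T\mathbb{S}^n)$ is projectable if $\phi(x)=\phi(x')$ implies $V(x)=V(x')$. A harmonic map $\phi:M\to\mathbb{S}^n$ is: - infinitesimally rigid if for every projectable $V\in K(\phi)$ there exists $X\in so(n+1)$ such that $V=X\circ\phi$, where $so(n+1)$ (skew-symmetric $(n+1)\times(n+1)$ matrices) is identified with the space of Killing vector fields $y\mapsto Xy$ on $\mathbb{S}^n\subset\mathbb{R}^{n+1}$; - locally rigid if for every projectable harmonic variation $V$ of $\phi$ there exists a $1$-parameter subgroup $(g_t)\subset O(n+1)$ such that $\phi_t=\exp(tV)=g_t\circ\phi$ for all $t\in\mathbb{R}$. *)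

(* Defs.v *)
From HB Require Import structures.
From mathcomp Require Import all_boot all_order all_algebra.
From mathcomp Require Import all_classical all_reals all_analysis.

Set Implicit Arguments.
Unset Strict Implicit.
Unset Printing Implicit Defensive.
Import Order.TTheory GRing.Theory Num.Theory.
Import numFieldNormedType.Exports.
Local Open Scope classical_set_scope.
Local Open Scope ring_scope.

(* The library's norm on matrices is the sup norm; it only serves to define the
   topology and the derivatives.  Lengths and angles come from [dotp]. *)
Definition dotp {R : realType} {k : nat} (u v : 'cV[R]_k) : R := (u^T *m v) 0 0.

(* C^oo on an open set U: every iterated directional derivative is Frechet
   differentiable at every point of U.  Values of f outside U are irrelevant. *)
Definition smooth_on {R : realType} {V W : normedModType R}
    (U : set V) (f : V -> W) : Prop :=
  forall (vs : seq V) (x : V), U x ->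
    differentiable (foldr (fun v h => 'D_v h) f vs) x.

Record riemannianManifold (R : realType) (m : nat) := RiemannianManifold {
  rm_pt :> topologicalType;
  rm_hausdorff : hausdorff_space rm_pt;
  rm_second_countable : @second_countable rm_pt;
  rm_chart : Type;
  rm_dom : rm_chart -> set rm_pt;
  rm_cod : rm_chart -> set 'cV[R]_m;
  rm_coord : rm_chart -> rm_pt -> 'cV[R]_m;
  rm_param : rm_chart -> 'cV[R]_m -> rm_pt;
  rm_dom_open : forall i, open (rm_dom i);
  rm_cod_open : forall i, open (rm_cod i);
  rm_cover : forall x, exists i, rm_dom i x;
  rm_coord_cod : forall i x, rm_dom i x -> rm_cod i (rm_coord i x);
  rm_param_dom : forall i u, rm_cod i u -> rm_dom i (rm_param i u);
  rm_coordK : forall i x, rm_dom i x -> rm_param i (rm_coord i x) = x;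
  rm_paramK : forall i u, rm_cod i u -> rm_coord i (rm_param i u) = u;
  rm_coord_continuous : forall i, {within rm_dom i, continuous (rm_coord i)};
  rm_param_continuous : forall i, {within rm_cod i, continuous (rm_param i)};
  rm_transition_smooth : forall i j,
    smooth_on (rm_cod i `&` rm_param i @^-1` rm_dom j)
              (rm_coord j \o rm_param i);
  (* Gram matrix of the metric in the coordinate frame of a chart *)
  rm_gram : rm_chart -> 'cV[R]_m -> 'M[R]_m;
  rm_gram_smooth : forall i, smooth_on (rm_cod i) (rm_gram i);
  rm_gram_sym : forall i u, rm_cod i u -> (rm_gram i u)^T = rm_gram i u;
  rm_gram_pos : forall i u, rm_cod i u ->
    forall X : 'cV[R]_m, X != 0 -> 0 < dotp X (rm_gram i u *m X);
  rm_gram_transition : forall i j u, rm_cod i u -> rm_dom j (rm_param i u) ->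
    forall X Y : 'cV[R]_m,
      dotp X (rm_gram i u *m Y) =
      dotp ('D_X (rm_coord j \o rm_param i) u)
           (rm_gram j (rm_coord j (rm_param i u)) *m
              'D_Y (rm_coord j \o rm_param i) u)
}.

Definition metric {R : realType} {m : nat} (M : riemannianManifold R m)
    (i : rm_chart M) (u X Y : 'cV[R]_m) : R := dotp X (rm_gram i u *m Y).

Definition christoffel {R : realType} {m : nat} (G : 'cV[R]_m -> 'M[R]_m)
    (u : 'cV[R]_m) (k i j : 'I_m) : R :=
  2^-1 * \sum_(l < m) invmx (G u) k l *
    ('D_(delta_mx i 0) G u j l + 'D_(delta_mx j 0) G u i l
     - 'D_(delta_mx l 0) G u i j).

(* Levi-Civita connection of M, on vector fields written in the chart i *)
Definition levi_civita {R : realType} {m : nat} (M : riemannianManifold R m)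
    (i : rm_chart M) (X Y : 'cV[R]_m -> 'cV[R]_m) (u : 'cV[R]_m) : 'cV[R]_m :=
  'D_(X u) Y u + \col_k \sum_(a < m) \sum_(b < m)
                   christoffel (rm_gram i) u k a b * X u a 0 * Y u b 0.

(* e is a local orthonormal frame on U, a neighbourhood of x read in the
   chart i *)
Definition orthonormal_frame_at {R : realType} {m : nat}
    (M : riemannianManifold R m) (x : M) (i : rm_chart M) (U : set 'cV[R]_m)
    (e : 'I_m -> 'cV[R]_m -> 'cV[R]_m) : Prop :=
  [/\ rm_dom i x,
      open U /\ U `<=` rm_cod i,
      U (rm_coord i x),
      forall a, smooth_on U (e a)
    & forall u, U u -> forall a b, metric i u (e a u) (e b u) = (a == b)%:R].

Definition sphere {R : realType} {n : nat} : set 'cV[R]_n.+1 :=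
  [set y | dotp y y = 1].

Definition sphere_tangent {R : realType} {n : nat} (p : 'cV[R]_n.+1) :
    set 'cV[R]_n.+1 :=
  [set w | dotp p w = 0].

Definition tangent_proj {R : realType} {n : nat} (p w : 'cV[R]_n.+1) :
    'cV[R]_n.+1 :=
  w - dotp p w *: p.

(* The Levi-Civita connection of the sphere is the tangential part of the flat
   derivative of R^(n+1); this is its pull-back along f : E -> sphere, where V
   is a section along f and X a vector field on the normed space E.  For
   f = id and X, V tangent to the sphere it is the connection itself. *)
Definition pullback_conn {R : realType} {n : nat} {E : normedModType R}
    (f : E -> 'cV[R]_n.+1) (X : E -> E) (V : E -> 'cV[R]_n.+1) :
    E -> 'cV[R]_n.+1 :=
  fun u => tangent_proj (f u) ('D_(X u) V u).

Definition lie_bracket {R : realType} {n : nat}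
    (X Y : 'cV[R]_n.+1 -> 'cV[R]_n.+1) : 'cV[R]_n.+1 -> 'cV[R]_n.+1 :=
  fun y => 'D_(X y) Y y - 'D_(Y y) X y.

(* R(u,v)w at p in Milnor's sign convention.  The tangent vectors u, v, w are
   extended to the fields y |-> tangent_proj y _, tangent along the sphere;
   R being a tensor, the choice of extension is immaterial. *)
Definition sphere_curvature {R : realType} {n : nat} (p u v w : 'cV[R]_n.+1) :
    'cV[R]_n.+1 :=
  let X y := tangent_proj y u in
  let Y y := tangent_proj y v in
  let Z y := tangent_proj y w in
  let nabla := pullback_conn id in
  - nabla X (nabla Y Z) p + nabla Y (nabla X Z) p + nabla (lie_bracket X Y) Z p.

Definition sphere_geodesic {R : realType} {n : nat}
    (gamma : R^o -> 'cV[R]_n.+1) : Prop :=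
  [/\ smooth_on setT gamma,
      forall t, sphere (gamma t)
    & forall t, pullback_conn gamma (fun=> 1) (derive1 gamma) t = 0].

Definition sphere_exp {R : realType} {n : nat} (p v : 'cV[R]_n.+1) :
    'cV[R]_n.+1 :=
  get [set q | exists gamma : R^o -> 'cV[R]_n.+1,
    [/\ sphere_geodesic gamma, gamma 0 = p, derive1 gamma 0 = v
      & gamma 1 = q]].

Definition smooth_map {R : realType} {m k : nat} (M : riemannianManifold R m)
    (f : M -> 'cV[R]_k) : Prop :=
  forall i : rm_chart M, smooth_on (rm_cod i) (f \o rm_param i).

Definition smooth_to_sphere {R : realType} {m n : nat}
    (M : riemannianManifold R m) (phi : M -> 'cV[R]_n.+1) : Prop :=
  smooth_map phi /\ forall x, sphere (phi x).

(* V is a smooth section of phi^-1 T(sphere) *)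
Definition section_along {R : realType} {m n : nat}
    (M : riemannianManifold R m) (phi V : M -> 'cV[R]_n.+1) : Prop :=
  smooth_map V /\ forall x, sphere_tangent (phi x) (V x).

(* differential of phi at x; X is a tangent vector at x read in the chart i *)
Definition differential {R : realType} {m k : nat} (M : riemannianManifold R m)
    (phi : M -> 'cV[R]_k) (i : rm_chart M) (x : M) (X : 'cV[R]_m) : 'cV[R]_k :=
  'D_X (phi \o rm_param i) (rm_coord i x).

(* tau_phi(x) = w.  The sum below does not depend on the chart or on the local
   orthonormal frame, and such frames exist around every point, so "some frame"
   and "every frame" give the same relation; likewise for the Jacobi operator
   and for the trace further down. *)
Definition tension_is {R : realType} {m n : nat} (M : riemannianManifold R m)
    (phi : M -> 'cV[R]_n.+1) (x : M) (w : 'cV[R]_n.+1) : Prop :=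
  exists i U e, orthonormal_frame_at x i U e /\
    let f := phi \o rm_param i in
    let df X u := 'D_(X u) f u in
    w = \sum_(a < m) (pullback_conn f (e a) (df (e a)) (rm_coord i x)
                      - df (levi_civita i (e a) (e a)) (rm_coord i x)).

Definition harmonic_map {R : realType} {m n : nat} (M : riemannianManifold R m)
    (phi : M -> 'cV[R]_n.+1) : Prop :=
  smooth_to_sphere phi /\ forall x, tension_is phi x 0.

Definition horizontal {R : realType} {m n : nat} (M : riemannianManifold R m)
    (phi : M -> 'cV[R]_n.+1) (i : rm_chart M) (x : M) : set 'cV[R]_m :=
  [set X | forall Z, differential phi i x Z = 0 ->
                     metric i (rm_coord i x) X Z = 0].

Definition horizontally_weakly_conformal {R : realType} {m n : nat}
    (M : riemannianManifold R m) (phi : M -> 'cV[R]_n.+1) : Prop :=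
  forall (i : rm_chart M) (x : M), rm_dom i x ->
    ((exists2 lambda : R, 0 < lambda &
        forall X Y, horizontal phi i x X -> horizontal phi i x Y ->
          dotp (differential phi i x X) (differential phi i x Y) =
          lambda ^+ 2 * metric i (rm_coord i x) X Y) /\
     (forall w, sphere_tangent (phi x) w ->
        exists2 X, horizontal phi i x X & differential phi i x X = w))
    \/ (forall X, differential phi i x X = 0).

Definition harmonic_morphism {R : realType} {m n : nat}
    (M : riemannianManifold R m) (phi : M -> 'cV[R]_n.+1) : Prop :=
  harmonic_map phi /\ horizontally_weakly_conformal phi.

Definition onto_sphere {R : realType} {m n : nat}
    (M : riemannianManifold R m) (phi : M -> 'cV[R]_n.+1) : Prop :=
  forall y, sphere y -> exists x, phi x = y.

Definition submersive {R : realType} {m n : nat}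
    (M : riemannianManifold R m) (phi : M -> 'cV[R]_n.+1) : Prop :=
  forall (i : rm_chart M) (x : M), rm_dom i x ->
    forall w, sphere_tangent (phi x) w -> exists X, differential phi i x X = w.

(* (J^phi V)(x) = w *)
Definition jacobi_operator_is {R : realType} {m n : nat}
    (M : riemannianManifold R m) (phi V : M -> 'cV[R]_n.+1) (x : M)
    (w : 'cV[R]_n.+1) : Prop :=
  exists i U e, orthonormal_frame_at x i U e /\
    let f := phi \o rm_param i in
    let W := V \o rm_param i in
    let nabla := pullback_conn f in
    let df X u := 'D_(X u) f u in
    let u := rm_coord i x in
    w = - (\sum_(a < m) (nabla (e a) (nabla (e a) W) u
                         - nabla (levi_civita i (e a) (e a)) W u))
        - \sum_(a < m) sphere_curvature (f u) (df (e a) u) (W u) (df (e a) u).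

Definition jacobi_field {R : realType} {m n : nat} (M : riemannianManifold R m)
    (phi V : M -> 'cV[R]_n.+1) : Prop :=
  section_along phi V /\ forall x, jacobi_operator_is phi V x 0.

(* (trace <d phi, nabla^phi V>)(x) = r *)
Definition trace_is {R : realType} {m n : nat} (M : riemannianManifold R m)
    (phi V : M -> 'cV[R]_n.+1) (x : M) (r : R) : Prop :=
  exists i U e, orthonormal_frame_at x i U e /\
    let f := phi \o rm_param i in
    let u := rm_coord i x in
    r = \sum_(a < m) dotp ('D_(e a u) f u)
                          (pullback_conn f (e a) (V \o rm_param i) u).

Definition K_space {R : realType} {m n : nat} (M : riemannianManifold R m)
    (phi : M -> 'cV[R]_n.+1) : set (M -> 'cV[R]_n.+1) :=
  [set V | jacobi_field phi V /\ forall x, trace_is phi V x 0].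

Definition projectable {R : realType} {m n : nat} (M : riemannianManifold R m)
    (phi V : M -> 'cV[R]_n.+1) : Prop :=
  forall x x', phi x = phi x' -> V x = V x'.

Definition variation {R : realType} {m n : nat} (M : riemannianManifold R m)
    (phi V : M -> 'cV[R]_n.+1) (t : R) : M -> 'cV[R]_n.+1 :=
  fun x => sphere_exp (phi x) (t *: V x).

Definition harmonic_variation {R : realType} {m n : nat}
    (M : riemannianManifold R m) (phi V : M -> 'cV[R]_n.+1) : Prop :=
  section_along phi V /\ forall t, harmonic_map (variation phi V t).

Definition infinitesimally_rigid {R : realType} {m n : nat}
    (M : riemannianManifold R m) (phi : M -> 'cV[R]_n.+1) : Prop :=
  forall V, K_space phi V -> projectable phi V ->
    exists X : 'M[R]_n.+1, X^T = - X /\ forall x, V x = X *m phi x.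

Definition one_parameter_subgroup_O {R : realType} {n : nat}
    (g : R -> 'M[R]_n.+1) : Prop :=
  [/\ forall t, (g t)^T *m g t = 1%:M,
      forall s t, g (s + t) = g s *m g t
    & continuous g].

Definition locally_rigid {R : realType} {m n : nat}
    (M : riemannianManifold R m) (phi : M -> 'cV[R]_n.+1) : Prop :=
  forall V, harmonic_variation phi V -> projectable phi V ->
    exists2 g : R -> 'M[R]_n.+1, one_parameter_subgroup_O g &
      forall t x, variation phi V t x = g t *m phi x.

(* Main.v *)
From HB Require Import structures.
Require Import Defs.
From mathcomp Require Import all_boot all_order all_algebra.
From mathcomp Require Import all_classical all_reals all_analysis.
From mathcomp Require Import ring lra.

(* A projectable section is V = X o phi for a tangent field X of the sphere; X
   is smooth because phi is a submersion.  Extend the components X_k to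
   functions on R^(n+1) minus the origin, homogeneous of degree d.  As phi is a
   harmonic morphism, the Laplacian of M applied to g o phi is a positive
   multiple of Lap g - d (n + d - 1) g.

   (i) With d = 1, the Jacobi equation says that the tangential part of Lap X
   vanishes, and the trace condition says that div X = 0.  Since y . X = 0, the
   normal part of Lap X is -2 div X.  So X is harmonic of degree 1, hence linear
   by a Liouville argument, and skew-symmetric because it is tangent.

   (ii) Write X = r xi with |xi| = 1.  The map exp(tX) = cos(t r) y + sin(t r) xi
   satisfies the harmonic map equation for all t; comparing the values at
   t r = pi/4, pi/2, pi, 3 pi/2 gives Lap r = 0, Lap xi = - n xi, div xi = 0 and
   grad r parallel to xi.  With b = div X this yields grad r^2 = 2 b X and
   X . grad b = 0, so that at a maximum of b^2 r^2 on the sphere b^3 r^2 = 0.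
   Therefore r is constant, X is linear as in (i), and exp(tX) is a rotation. *)

Set Implicit Arguments.
Unset Strict Implicit.
Unset Printing Implicit Defensive.
Import Order.TTheory GRing.Theory Num.Theory.
Import numFieldNormedType.Exports.
Local Open Scope classical_set_scope.
Local Open Scope ring_scope.

(** * Differential calculus *)

(** The smoothness of [X] does not pass through an inverse function theorem. At a point, the
    horizontal lift gives an affine map into a chart whose composite with [phi], corrected radially,
    has the identity as derivative. Local surjectivity of that composite yields differentiability of
    the induced function and a formula for its derivatives; the formula again defines a function
    that factors through [phi], so the argument iterates. The degree d is dictated by the equation.
    For d = 1 the term d (n + d - 1) = n cancels against the curvature term of the Jacobi operator,
    and 1 is the degree of the linear fields that are sought. For d = 0 the term vanishes, and the
    harmonic map equation speaks of the tangential part of Lap alone. The obstacle in (ii) is that r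
    and xi are smooth only where X does not vanish. The function b^2 r^2 is smooth everywhere, is
    zero wherever X is, and elsewhere on the sphere its derivative along X is 2 b^3 r^2; hence its
    maximum can be examined without following the zero set of X. *)

(* The library's derivative, locked: conversion would otherwise unfold the limits
   when it compares iterated derivatives. *)
HB.lock Definition dirder (R : realType) (V W : normedModType R) (v : V)
  (f : V -> W) : V -> W := 'D_v f.

Reserved Notation "''L_' v f" (at level 10, v, f at next level,
  format "''L_' v  f").
Notation "''L_' v f" := (dirder v f).

Lemma dirderE (R : realType) (V W : normedModType R) :
  @dirder R V W = fun v f => 'D_v f.
Proof. by rewrite dirder.unlock. Qed.

Section Differentiability.
Context {R : realType} {V W : normedModType R}.
Implicit Types (f g : V -> W) (x v : V) (U : set V).

(** Little-o is turned into inequalities because second differences, and later the functions induced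
    on the sphere, are estimated with explicit constants. *)
Lemma differentiable_epsP f x : differentiable f x <->
  exists2 L : {linear V -> W}, continuous L &
    forall e, 0 < e -> \forall h \near 0, `|f (h + x) - f x - L h| <= e * `|h|.
Proof.
split=> [df|[L Lc Le]].
  exists ('d f x) => [|e e0]; first exact: diff_continuous.
  have := diff_locallyx df => E.
  have /= : ((fun h => f (h + x) - f x - 'd f x h) : V -> W) =o_ 0 id.
    apply/eqoP => e1 e10.
    have /eqoP : (fun h => f (h + x) - (f x + 'd f x h)) =o_ 0 id.
      by apply: eqoE; apply/funext => h; rewrite E addrAC subrr add0r.
    by move=> /(_ _ e10); apply: filterS => h; rewrite opprD addrA.
  by move=> /eqoP/(_ _ e0).
have E : f \o shift x = cst (f x) + L +o_ 0 id.
  apply/eqaddoP => e e0; apply: filterS (Le e e0) => h /=.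
  by rewrite !fctE/= opprD addrA.
apply/diff_locallyP; rewrite (diff_unique Lc E); split => //.
Qed.

Lemma differentiable_near_eq f g x :
  (\forall y \near x, f y = g y) -> differentiable f x -> differentiable g x.
Proof.
move=> fg /differentiable_epsP[L Lc Le]; apply/differentiable_epsP.
exists L => // e e0.
have fg0 : \forall h \near 0, f (h + x) = g (h + x).
  by move: fg; rewrite (near_shift 0 x); apply: filterS => h /=; rewrite subr0.
have fgx := nbhs_singleton fg.
apply: filterS2 fg0 (Le e e0) => h <-; by rewrite fgx.
Qed.

Lemma differentiable_eq_on U f g x : open U -> U x ->
  (forall y, U y -> f y = g y) -> differentiable f x -> differentiable g x.
Proof.
move=> oU Ux fg; apply: differentiable_near_eq.
by near=> y; apply: fg; near: y; exact: open_nbhs_nbhs.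
Unshelve. all: by end_near. Qed.

Lemma derive_eq_on U f g x v : open U -> U x ->
  (forall y, U y -> f y = g y) -> 'L_v f x = 'L_v g x.
Proof.
move=> oU Ux fg; rewrite dirderE; apply: near_eq_derive.
by near=> y; apply: fg; near: y; exact: open_nbhs_nbhs.
Unshelve. all: by end_near. Qed.

Lemma derive_diff f x v : differentiable f x -> 'L_v f x = 'd f x v.
Proof. by move=> df; rewrite dirderE deriveE. Qed.

Lemma derive_epsP f x (L : {linear V -> W}) : continuous L ->
  (forall e, 0 < e -> \forall h \near 0, `|f (h + x) - f x - L h| <= e * `|h|) ->
  differentiable f x /\ forall v, 'L_v f x = L v.
Proof.
move=> Lc Le.
have df : differentiable f x by apply/differentiable_epsP; exists L.
split=> // v.
have EL : f \o shift x = cst (f x) + L +o_ 0 id.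
  apply/eqaddoP => e' e'0; apply: filterS (Le e' e'0) => z /=.
  by rewrite !fctE/= opprD addrA.
by rewrite derive_diff // (diff_unique Lc EL).
Qed.

Lemma derive_eps f x e : differentiable f x -> 0 < e ->
  \forall h \near 0, `|f (h + x) - f x - 'L_h f x| <= e * `|h|.
Proof.
move=> df e0; have [L Lc Le] := (differentiable_epsP f x).1 df.
have [_ LE] := derive_epsP Lc Le.
by apply: filterS (Le _ e0) => h; rewrite LE.
Qed.

Lemma derive_linear f x a v w : differentiable f x ->
  'L_(a *: v + w) f x = a *: 'L_v f x + 'L_w f x.
Proof. by move=> df; rewrite !derive_diff // linearP. Qed.

Lemma derive_sumr f x (I : Type) (r : seq I) (P : pred I) (v : I -> V) :
  differentiable f x ->
  'L_(\sum_(i <- r | P i) v i) f x = \sum_(i <- r | P i) 'L_(v i) f x.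
Proof.
move=> df; rewrite derive_diff // linear_sum.
by apply: eq_bigr => i _; rewrite derive_diff.
Qed.

Lemma derive_scaler f x a v : differentiable f x ->
  'L_(a *: v) f x = a *: 'L_v f x.
Proof. by move=> df; rewrite !derive_diff // linearZ. Qed.

End Differentiability.

Lemma derive_comp (R : realType) (U V W : normedModType R) (f : U -> V)
    (g : V -> W) x v : differentiable f x -> differentiable g (f x) ->
  'L_v (g \o f) x = 'L_('L_v f x) g (f x).
Proof.
move=> df dg; rewrite !derive_diff//; last exact: differentiable_comp.
by rewrite diff_comp.
Qed.

Section Matrices.
Context {R : realType} {V : normedModType R}.

Lemma differentiable_mxP p q (M : V -> 'M[R]_(p, q)) x :
  differentiable M x <-> forall i j, differentiable (fun y => M y i j) x.
Proof.
split=> [dM i j|dM].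
  exact: (@differentiable_comp _ _ _ _ M (fun N => N i j) _ dM
            (differentiable_coord _ _ _)).
have -> : M = \sum_(i < p) \sum_(j < q)
    (fun y => M y i j *: (delta_mx i j : 'M[R]_(p, q))).
  apply/funext => y; rewrite fct_sumE [LHS]matrix_sum_delta.
  by apply: eq_bigr => i _; rewrite fct_sumE.
apply: differentiable_sum => i; apply: differentiable_sum => j.
exact: differentiableZl.
Qed.

Lemma derive_mxE p q (M : V -> 'M[R]_(p, q)) x v i j : differentiable M x ->
  'L_v M x i j = 'L_v (fun y => M y i j) x.
Proof. by move=> dM; rewrite !dirderE derive_mx ?mxE//; exact: diff_derivable. Qed.

End Matrices.

Section PointwiseRules.
Context {R : realType} {V : normedModType R}.
Implicit Types (f g : V -> R) (x v : V).

Lemma deriveDf (W : normedModType R) (f g : V -> W) x v :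
  differentiable f x -> differentiable g x ->
  'L_v (fun y => f y + g y) x = 'L_v f x + 'L_v g x.
Proof. by rewrite dirderE => /diff_derivable df /diff_derivable dg; exact: deriveD. Qed.

Lemma deriveNf (W : normedModType R) (f : V -> W) x v : differentiable f x ->
  'L_v (fun y => - f y) x = - 'L_v f x.
Proof. by rewrite dirderE => /diff_derivable df; exact: deriveN. Qed.

Lemma deriveBf (W : normedModType R) (f g : V -> W) x v :
  differentiable f x -> differentiable g x ->
  'L_v (fun y => f y - g y) x = 'L_v f x - 'L_v g x.
Proof. by rewrite dirderE => /diff_derivable df /diff_derivable dg; exact: deriveB. Qed.

Lemma deriveMf f g x v : differentiable f x -> differentiable g x ->
  'L_v (fun y => f y * g y) x = 'L_v f x * g x + f x * 'L_v g x.
Proof.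
rewrite dirderE => /diff_derivable df /diff_derivable dg.
rewrite addrC [_ * g x]mulrC.
exact: deriveM.
Qed.

Lemma deriveZf f a x v : differentiable f x ->
  'L_v (fun y => a * f y) x = a * 'L_v f x.
Proof. by rewrite dirderE => /diff_derivable df; exact: deriveZ. Qed.

Lemma derive_sumf (W : normedModType R) p (h : 'I_p -> V -> W) x v :
  (forall i, differentiable (h i) x) ->
  'L_v (fun y => \sum_(i < p) h i y) x = \sum_(i < p) 'L_v (h i) x.
Proof.
rewrite dirderE => dh; rewrite -derive_sum => [|i]; last exact: diff_derivable.
by congr ('D_v _ x); apply/funext => y; rewrite fct_sumE.
Qed.

Lemma derive_real_comp f (g : R -> R) x v :
  differentiable f x -> derivable g (f x) 1 ->
  'L_v (fun y => g (f y)) x = 'D_1 g (f x) * 'L_v f x.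
Proof.
move=> df /derivable1_diffP dg.
rewrite (derive_comp v df dg) -['L_v f x in LHS]mulr1.
by rewrite (derive_scaler _ _ dg) mulrC; congr (_ * _); rewrite dirderE.
Qed.

End PointwiseRules.

(** * Smooth functions through finite orders of differentiability *)

Section Smooth.
Context {R : realType} {V W : normedModType R}.

(** The lists of directions in [smooth_on] are replaced by an order [k]. The product and chain rules
    express a derivative through functions of order [k], so closure properties follow by induction
    on [k]. *)
Fixpoint Ck (k : nat) (U : set V) (f : V -> W) : Prop :=
  (forall x, U x -> differentiable f x) /\
  (if k is k'.+1 then forall v, Ck k' U ('L_v f) else True).

Lemma Ck_diff k U f x : Ck k U f -> U x -> differentiable f x.
Proof. by case: k => [|k] []; auto. Qed.

Lemma CkW k U f : Ck k.+1 U f -> Ck k U f.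
Proof.
by elim: k f => [|k IH] f [df /= Df]; split => // v; apply: IH.
Qed.

Lemma derive_cstf (a : W) (x v : V) : 'L_v (fun=> a) x = 0.
Proof. by rewrite dirderE; exact: derive_cst. Qed.

Lemma derive_idf (x v : V) : 'L_v id x = v.
Proof. by rewrite dirderE; exact: derive_id. Qed.

Lemma smooth_onP (U : set V) (f : V -> W) :
  smooth_on U f <-> forall k, Ck k U f.
Proof.
split=> [sf k|Cf].
  elim: k f sf => [|k IH] f sf; first by split=> // x; exact: (sf [::]).
  split=> [x|v]; first exact: (sf [::]).
  apply: IH => vs x Ux.
  (* [foldr] applies the last direction first, so a list of directions for ['L_v f] becomes one for
     [f] by appending [v]. *)
  by have := sf (rcons vs v) x Ux; rewrite foldr_rcons dirderE.
move=> vs x Ux; elim/last_ind: vs f Cf => [|vs v IH] f Cf.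
  exact: Ck_diff (Cf 0%N) Ux.
rewrite foldr_rcons; apply: IH => k.
have E : 'L_v f = 'D_v f by rewrite dirderE.
by have [_ /(_ v)] := Cf k.+1; rewrite E.
Qed.

Lemma smooth_on_diff (U : set V) (f : V -> W) x :
  smooth_on U f -> U x -> differentiable f x.
Proof. by move=> sf; exact: (sf [::]). Qed.

Lemma smooth_on_derive (U : set V) (f : V -> W) v :
  smooth_on U f -> smooth_on U ('L_v f).
Proof. by move=> /smooth_onP sf; apply/smooth_onP => k; case: (sf k.+1) => _; apply. Qed.

Lemma smooth_onW (U U' : set V) (f : V -> W) :
  U' `<=` U -> smooth_on U f -> smooth_on U' f.
Proof. by move=> UU sf vs x /UU; exact: sf. Qed.

Lemma Ck_eq k (U : set V) f g : open U -> (forall x, U x -> f x = g x) ->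
  Ck k U f -> Ck k U g.
Proof.
move=> oU; elim: k f g => [|k IH] f g fg [df Df].
  by split=> // x Ux; apply: differentiable_eq_on fg (df x Ux).
split=> [x Ux|v]; first by apply: differentiable_eq_on fg (df x Ux).
by apply: IH (Df v) => x Ux; exact: derive_eq_on fg.
Qed.

Lemma smooth_on_eq (U : set V) (f g : V -> W) : open U -> (forall x, U x -> f x = g x) ->
  smooth_on U f -> smooth_on U g.
Proof.
move=> oU fg /smooth_onP sf; apply/smooth_onP => k; exact: Ck_eq fg (sf k).
Qed.

Lemma Ck_add k (U : set V) f g : open U -> Ck k U f -> Ck k U g ->
  Ck k U (fun x => f x + g x).
Proof.
move=> oU; elim: k f g => [|k IH] f g [df Df] [dg Dg].
  by split=> // x Ux; apply: differentiableD; [exact: df|exact: dg].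
split=> [x Ux|v].
  by apply: differentiableD; [exact: df|exact: dg].
apply: Ck_eq (IH _ _ (Df v) (Dg v)) => // x Ux.
by rewrite deriveDf //; [exact: df|exact: dg].
Qed.

Lemma smooth_on_add (U : set V) (f g : V -> W) : open U -> smooth_on U f ->
  smooth_on U g -> smooth_on U (fun x => f x + g x).
Proof.
move=> oU /smooth_onP sf /smooth_onP sg; apply/smooth_onP => k.
exact: Ck_add.
Qed.

Lemma smooth_on_cst (a : W) (U : set V) : smooth_on U (fun=> a).
Proof.
apply/smooth_onP => k; elim: k a => [|k IH] a.
  by split=> // x _; exact: differentiable_cst.
split=> [x _|v]; first exact: differentiable_cst.
suff -> : 'L_v (fun=> a) = (fun=> 0 : W) by exact: IH.
by apply/funext => x; exact: derive_cstf.
Qed.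

End Smooth.

Section SmoothScalar.
Context {R : realType} {V : normedModType R}.
Implicit Types (f g : V -> R) (U : set V).

Lemma Ck_mul k U f g : open U -> Ck k U f -> Ck k U g ->
  Ck k U (fun x => f x * g x).
Proof.
move=> oU; elim: k f g => [|k IH] f g Cf Cg.
  split=> // x Ux.
  by apply: differentiableM; [exact: (Ck_diff Cf)|exact: (Ck_diff Cg)].
have dfg x : U x -> differentiable (fun x => f x * g x) x.
  move=> Ux.
  by apply: differentiableM; [exact: (Ck_diff Cf)|exact: (Ck_diff Cg)].
split=> [//|v].
apply: (@Ck_eq _ _ _ k U
  (fun x => 'L_v f x * g x + f x * 'L_v g x)) => // [x Ux|].
  by rewrite deriveMf //; [exact: (Ck_diff Cf)|exact: (Ck_diff Cg)].
apply: Ck_add => //; apply: IH; [exact: Cf.2|exact: CkW|exact: CkW|exact: Cg.2].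
Qed.

Lemma smooth_on_mul U f g : open U -> smooth_on U f -> smooth_on U g ->
  smooth_on U (fun x => f x * g x).
Proof.
move=> oU /smooth_onP sf /smooth_onP sg; apply/smooth_onP => k.
exact: Ck_mul.
Qed.

Lemma smooth_on_opp U f : open U -> smooth_on U f ->
  smooth_on U (fun x => - f x).
Proof.
move=> oU sf.
have := smooth_on_mul oU (@smooth_on_cst _ V _ (-1 : R) U) sf.
by under eq_fun do rewrite mulN1r.
Qed.

Lemma smooth_on_sub U f g : open U -> smooth_on U f -> smooth_on U g ->
  smooth_on U (fun x => f x - g x).
Proof. by move=> oU sf sg; apply: smooth_on_add => //; exact: smooth_on_opp. Qed.

Lemma smooth_on_sqr U f : open U -> smooth_on U f ->
  smooth_on U (fun x => f x ^+ 2).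
Proof.
move=> oU sf; have := smooth_on_mul oU sf sf.
by under eq_fun do rewrite -expr2.
Qed.

Lemma Ck_sum k U p (h : 'I_p -> V -> R) : open U -> (forall i, Ck k U (h i)) ->
  Ck k U (fun x => \sum_(i < p) h i x).
Proof.
move=> oU; elim: p h => [|p IH] h Ch.
  under eq_fun do rewrite big_ord0.
  by move: (@smooth_on_cst _ V _ (0 : R) U) => /smooth_onP; exact.
under eq_fun do rewrite big_ord_recl.
by apply: Ck_add => //; exact: IH.
Qed.

Lemma smooth_on_sum U p (h : 'I_p -> V -> R) : open U ->
  (forall i, smooth_on U (h i)) -> smooth_on U (fun x => \sum_(i < p) h i x).
Proof.
move=> oU sh; apply/smooth_onP => k; apply: Ck_sum => // i.
by move: (sh i) => /smooth_onP.
Qed.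

Lemma derive_sin_comp f x v : differentiable f x ->
  'L_v (fun y => sin (f y)) x = cos (f x) * 'L_v f x.
Proof.
by move=> df; rewrite (derive_real_comp _ df) ?derive_val//; exact: ex_derive.
Qed.

Lemma derive_cos_comp f x v : differentiable f x ->
  'L_v (fun y => cos (f y)) x = - sin (f x) * 'L_v f x.
Proof.
by move=> df; rewrite (derive_real_comp _ df) ?derive_val//; exact: ex_derive.
Qed.

Lemma differentiable_sin_comp f x :
  differentiable f x -> differentiable (fun y => sin (f y)) x.
Proof.
move=> df; apply: (@differentiable_comp _ _ _ _ f sin) => //.
by apply/derivable1_diffP; exact: ex_derive.
Qed.

Lemma differentiable_cos_comp f x :
  differentiable f x -> differentiable (fun y => cos (f y)) x.
Proof.
move=> df; apply: (@differentiable_comp _ _ _ _ f cos) => //.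
by apply/derivable1_diffP; exact: ex_derive.
Qed.

(** The derivative of each function involves the other, so the two inductions run together. *)
Lemma smooth_on_sin_cos U f : open U -> smooth_on U f ->
  smooth_on U (fun x => sin (f x)) /\ smooth_on U (fun x => cos (f x)).
Proof.
move=> oU sf.
suff H k : Ck k U (fun x => sin (f x)) /\ Ck k U (fun x => cos (f x)).
  by split; apply/smooth_onP => k; case: (H k).
have ds x : U x -> differentiable (fun y => sin (f y)) x.
  by move=> Ux; exact/differentiable_sin_comp/(smooth_on_diff sf).
have dc x : U x -> differentiable (fun y => cos (f y)) x.
  by move=> Ux; exact/differentiable_cos_comp/(smooth_on_diff sf).
elim: k => [|k [Cs Cc]]; first by split.
have CDf v : Ck k U ('L_v f).
  by have /smooth_onP := smooth_on_derive v sf; exact.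
split; split=> // v.
  apply: (@Ck_eq _ _ _ k U (fun x => cos (f x) * 'L_v f x)) => // [x Ux|].
    by rewrite derive_sin_comp //; exact: smooth_on_diff Ux.
  exact: Ck_mul.
apply: (@Ck_eq _ _ _ k U (fun x => - 1 * (sin (f x) * 'L_v f x))) => // [x Ux|].
  rewrite derive_cos_comp //; last exact: smooth_on_diff Ux.
  by rewrite mulN1r mulNr.
apply: Ck_mul => //; last exact: Ck_mul.
by have /smooth_onP := @smooth_on_cst _ V _ (- 1 : R) U; exact.
Qed.

Lemma differentiable_sqrt_comp f x : differentiable f x -> 0 < f x ->
  differentiable (fun y => Num.sqrt (f y)) x.
Proof.
move=> df f0; apply: (@differentiable_comp _ _ _ _ f Num.sqrt) => //.
by apply/derivable1_diffP; apply: ex_derive; exact: is_derive1_sqrt.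
Qed.

Lemma derive_sqrt_comp f x v : differentiable f x -> 0 < f x ->
  'L_v (fun y => Num.sqrt (f y)) x = (2 * Num.sqrt (f x))^-1 * 'L_v f x.
Proof.
move=> df f0; have sd := is_derive1_sqrt f0.
by rewrite (derive_real_comp _ df) ?derive_val//; exact: ex_derive.
Qed.

Lemma differentiable_rsqrt f x : differentiable f x -> 0 < f x ->
  differentiable (fun y => (Num.sqrt (f y))^-1) x.
Proof.
move=> df f0; apply: differentiableV; first exact: differentiable_sqrt_comp.
by rewrite gt_eqF // sqrtr_gt0.
Qed.

Lemma derive_rsqrt f x v : differentiable f x -> 0 < f x ->
  'L_v (fun y => (Num.sqrt (f y))^-1) x =
  - 2^-1 * (Num.sqrt (f x))^-1 ^+ 3 * 'L_v f x.
Proof.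
move=> df f0; have s0 : Num.sqrt (f x) != 0 by rewrite gt_eqF // sqrtr_gt0.
have -> : 'L_v (fun y => (Num.sqrt (f y))^-1) x =
    - (Num.sqrt (f x)) ^- 2 *: 'L_v (fun y => Num.sqrt (f y)) x.
  by rewrite dirderE; apply: deriveV => //; exact/diff_derivable/differentiable_sqrt_comp.
rewrite derive_sqrt_comp // /GRing.scale/=; field; exact: s0.
Qed.

(** The inverse square root comes before the square root because its derivative is -1/2 times its
    own cube times a derivative of [f]: the induction closes on a single function. The square root
    is then [f] times it. *)
Lemma smooth_on_rsqrt U f : open U -> smooth_on U f ->
  (forall x, U x -> 0 < f x) -> smooth_on U (fun x => (Num.sqrt (f x))^-1).
Proof.
move=> oU sf f0; apply/smooth_onP => k.
have dr x : U x -> differentiable (fun y => (Num.sqrt (f y))^-1) x.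
  by move=> Ux; apply: differentiable_rsqrt (f0 x Ux); exact: smooth_on_diff Ux.
elim: k => [|k IH]; first by split.
split=> // v.
have CDf : Ck k U ('L_v f).
  by have /smooth_onP := smooth_on_derive v sf; exact.
pose r x := (Num.sqrt (f x))^-1.
apply: (@Ck_eq _ _ _ k U (fun x => - 2^-1 * (r x * (r x * r x)) * 'L_v f x)).
- by [].
- move=> x Ux; rewrite derive_rsqrt ?f0 //; exact: smooth_on_diff Ux.
- do ?[apply: Ck_mul => //].
  by have /smooth_onP := @smooth_on_cst _ V _ (- 2^-1 : R) U; exact.
Qed.

Lemma smooth_on_sqrt U f : open U -> smooth_on U f ->
  (forall x, U x -> 0 < f x) -> smooth_on U (fun x => Num.sqrt (f x)).
Proof.
move=> oU sf f0.
apply: smooth_on_eq (smooth_on_mul oU sf (smooth_on_rsqrt oU sf f0)) => //.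
move=> x /f0 fx0; have s0 : Num.sqrt (f x) != 0 by rewrite gt_eqF // sqrtr_gt0.
by rewrite -{1}(sqr_sqrtr (ltW fx0)) expr2 mulfK.
Qed.

End SmoothScalar.

Section Coordinates.
Context {R : realType} {V : normedModType R}.

Lemma smooth_on_coord (U : set V) p q (M : V -> 'M[R]_(p, q)) i j :
  open U -> smooth_on U M -> smooth_on U (fun x => M x i j).
Proof.
move=> oU /smooth_onP sM; apply/smooth_onP => k.
elim: k M {sM}(sM k) => [|k IH] M CM.
  by split=> // x Ux; move/differentiable_mxP: (Ck_diff CM Ux); apply.
split=> [x Ux|v]; first by move/differentiable_mxP: (Ck_diff CM Ux); apply.
apply: Ck_eq (IH _ (CM.2 v)) => // x Ux.
by rewrite derive_mxE //; exact: Ck_diff CM Ux.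
Qed.

End Coordinates.

HB.lock Definition pd (R : realType) (p : nat) (k : 'I_p) (f : 'cV[R]_p -> R) :
  'cV[R]_p -> R := 'L_(delta_mx k 0) f.

HB.lock Definition lap (R : realType) (p : nat) (f : 'cV[R]_p -> R)
  (y : 'cV[R]_p) : R := \sum_(k < p) pd k (pd k f) y.

Lemma pdE (R : realType) (p : nat) (k : 'I_p) (f : 'cV[R]_p -> R) :
  pd k f = 'L_(delta_mx k 0) f.
Proof. by rewrite pd.unlock. Qed.

Lemma lapE (R : realType) (p : nat) (f : 'cV[R]_p -> R) y :
  lap f y = \sum_(k < p) pd k (pd k f) y.
Proof. by rewrite lap.unlock. Qed.

Section Partial.
Context {R : realType} {p : nat}.
Implicit Types (f g : 'cV[R]_p -> R) (y v : 'cV[R]_p) (U : set 'cV[R]_p).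

Lemma colvec_sum_delta v : v = \sum_(k < p) v k 0 *: delta_mx k 0.
Proof.
apply/colP => i; rewrite summxE (bigD1 i) //= !mxE !eqxx mulr1 big1 ?addr0 //.
by move=> k ki; rewrite !mxE eqxx andbT eq_sym (negbTE ki) mulr0.
Qed.

Lemma derive_pd (f : 'cV[R]_p -> R) y v : differentiable f y ->
  'L_v f y = \sum_(k < p) v k 0 * pd k f y.
Proof.
move=> df; rewrite [v in LHS]colvec_sum_delta derive_sumr //.
by apply: eq_bigr => k _; rewrite derive_scaler // pdE.
Qed.

Lemma derive_comp_pd (V : normedModType R) (f : V -> 'cV[R]_p) g (x v : V) :
  differentiable f x -> differentiable g (f x) ->
  'L_v (fun z => g (f z)) x = \sum_(k < p) 'L_v (fun z => f z k 0) x * pd k g (f x).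
Proof.
move=> df dg; rewrite (derive_comp v df dg) derive_pd //.
by apply: eq_bigr => k _; rewrite derive_mxE.
Qed.

Lemma Ck_comp (V : normedModType R) k (U : set V) (U' : set 'cV[R]_p)
    (f : V -> 'cV[R]_p) g : open U -> (forall x, U x -> U' (f x)) ->
  (forall i, Ck k U (fun x => f x i 0)) -> Ck k U' g -> Ck k U (fun x => g (f x)).
Proof.
move=> oU fU; elim: k g => [|k IH] g Cf Cg.
  split=> // x Ux; apply: differentiable_comp.
    by apply/differentiable_mxP => i j; rewrite ord1; exact: Ck_diff (Cf i) Ux.
  by apply: Ck_diff Cg _; exact: fU.
have df x : U x -> differentiable f x.
  by move=> Ux; apply/differentiable_mxP => i j; rewrite ord1; exact: Ck_diff (Cf i) Ux.
have dg x : U x -> differentiable g (f x).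
  by move=> Ux; apply: Ck_diff Cg _; exact: fU.
split=> [x Ux|v]; first by apply: differentiable_comp; [exact: df|exact: dg].
apply: (@Ck_eq _ _ _ k U
  (fun x => \sum_(j < p) 'L_v (fun z => f z j 0) x * pd j g (f x))) => //.
  by move=> x Ux; rewrite derive_comp_pd //; [exact: df|exact: dg].
apply: Ck_sum => // j; apply: Ck_mul => //; first exact: (Cf j).2.
by apply: IH; [move=> i; exact: CkW|rewrite pdE; exact: Cg.2].
Qed.

Lemma smooth_on_comp (V : normedModType R) (U : set V) (U' : set 'cV[R]_p)
    (f : V -> 'cV[R]_p) g : open U -> (forall x, U x -> U' (f x)) ->
  (forall i, smooth_on U (fun x => f x i 0)) -> smooth_on U' g ->
  smooth_on U (fun x => g (f x)).
Proof.
move=> oU fU sf /smooth_onP sg; apply/smooth_onP => k.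
apply: Ck_comp fU _ (sg k) => // i.
by move: (sf i) => /smooth_onP.
Qed.

Lemma smooth_on_pd U f k : smooth_on U f -> smooth_on U (pd k f).
Proof. by rewrite pdE; exact: smooth_on_derive. Qed.

Lemma derive_coord y v i : 'L_v (fun y : 'cV[R]_p => y i 0) y = v i 0.
Proof. by rewrite -derive_mxE ?derive_idf. Qed.

Lemma smooth_on_id_coord U i : open U -> smooth_on U (fun y : 'cV[R]_p => y i 0).
Proof.
move=> oU; apply/smooth_onP => -[|k].
  by split=> // x _; exact: differentiable_coord.
split=> [x _|v]; first exact: differentiable_coord.
suff -> : 'L_v (fun y : 'cV[R]_p => y i 0) = fun=> v i 0.
  by have /smooth_onP := @smooth_on_cst _ 'cV[R]_p _ (v i 0) U; exact.
by apply/funext => y; rewrite derive_coord.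
Qed.

Lemma pd_coord k i y : pd k (fun y : 'cV[R]_p => y i 0) y = (i == k)%:R.
Proof. by rewrite pdE derive_coord !mxE eqxx andbT. Qed.

End Partial.

(** * Symmetry of second derivatives *)

Section Schwarz.
Context {R : realType} {V : normedModType R}.
Implicit Types (f : V -> R) (x v w : V).

Lemma differentiable_line x v (t : R) : differentiable (fun s : R => x + s *: v) t.
Proof.
apply: differentiableD; first exact: differentiable_cst.
exact: differentiableZl.
Qed.

Lemma derive_line x v (t : R) : 'L_(1 : R) (fun s : R => x + s *: v) t = v.
Proof.
rewrite deriveDf; [|exact: differentiable_cst|exact: differentiableZl].
rewrite derive_cstf add0r derive_diff; last exact: differentiableZl.
by rewrite diffZl //= diff_val scale1r.
Qed.

Lemma is_derive_line f x v (t : R) : differentiable f (x + t *: v) ->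
  is_derive t 1 (fun s : R => f (x + s *: v)) ('L_v f (x + t *: v)).
Proof.
move=> df; have dl := differentiable_line x v t.
apply: DeriveDef; first exact/derivable1_diffP/(differentiable_comp dl df).
by have := derive_comp (1 : R) dl df; rewrite derive_line => <-; rewrite dirderE.
Qed.

Lemma MVT_line f x v : (forall t : R, 0 <= t <= 1 -> differentiable f (x + t *: v)) ->
  exists2 t : R, 0 < t < 1 & f (x + v) - f x = 'L_v f (x + t *: v).
Proof.
move=> df.
have [||c cI] := @MVT R (fun s => f (x + s *: v)) (fun t => 'L_v f (x + t *: v))
    0 1 ltr01.
- move=> t; rewrite in_itv /= => /andP[t0 t1]; apply: is_derive_line.
  by apply: df; rewrite !ltW.
- apply: derivable_within_continuous => t; rewrite in_itv /= => tI.
  by apply: ex_derive; apply: is_derive_line; exact: df.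
rewrite scale1r scale0r addr0 subr0 mulr1 => ->; exists c => //.
Qed.

Lemma nbhs_line x v w (P : set V) : (\forall y \near x, P y) ->
  exists2 d : R, 0 < d & forall s t : R, `|s| <= d -> `|t| <= d ->
    P (x + s *: v + t *: w).
Proof.
move=> /nbhs_ballP[e /= e0 eP]; pose d := e / (2 * (`|v| + `|w| + 1)).
have K0 : 0 < `|v| + `|w| + 1 by rewrite ltr_wpDl// addr_ge0.
exists d => [|s t sd td]; first by rewrite divr_gt0 // mulr_gt0.
apply: eP; rewrite -ball_normE /= -addrA opprD addrA subrr add0r normrN.
apply: (le_lt_trans (ler_normD _ _)); rewrite !normrZ.
apply: (@le_lt_trans _ _ (d * (`|v| + `|w| + 1))).
  rewrite mulrDr [in leRHS]mulrDr -addrA lerD//; first exact: ler_wpM2r.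
  rewrite ler_wpDr ?ler_wpM2r// mulr1.
  by rewrite divr_ge0 ?mulr_ge0 ?ltW//.
rewrite /d invfM mulrA -mulrA mulVf ?gt_eqF// mulr1.
by rewrite gtr_pMr ?e0//; lra.
Qed.

(* By the mean value theorem in the direction [v]; as the second difference is
   symmetric in [v] and [w], this forces [D_w D_v f = D_v D_w f]. *)
Lemma second_difference f x v w :
  (\forall y \near x, differentiable f y) -> differentiable ('L_v f) x ->
  forall e : R, 0 < e -> exists2 d : R, 0 < d & forall s, 0 < s -> s <= d ->
    `|f (x + s *: v + s *: w) - f (x + s *: v) - f (x + s *: w) + f x
      - s ^+ 2 * 'L_w ('L_v f) x| <= e * s ^+ 2.
Proof.
move=> ndf dDf e e0.
(* Differentiability of ['L_v f] is used at the offsets (t s) v + s w and (t s) v, of norm at most s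
   (|v| + |w|) and s |v|. The constant adds these two bounds; the 1 keeps it positive. *)
have K0 : 0 < `|v| + `|w| + `|v| + 1.
  by rewrite ltr_wpDl// !addr_ge0.
have e1 : 0 < e / (`|v| + `|w| + `|v| + 1) by rewrite divr_gt0.
have Ee := derive_eps dDf e1.
have [d1 d10 D1] := nbhs_line v w ndf.
have Ee' : \forall y \near x, `|'L_v f y - 'L_v f x - 'L_(y - x) ('L_v f) x|
    <= e / (`|v| + `|w| + `|v| + 1) * `|y - x|.
  rewrite (near_shift 0 x); apply: filterS Ee => h /=.
  by rewrite subr0 addrK.
have [d2 d20 D2] := nbhs_line v w Ee'.
exists (Num.min d1 d2) => [|s s0 sd]; first by rewrite lt_min d10.
have /andP[sd1 sd2] : (s <= d1) && (s <= d2) by rewrite -le_min.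
have bnd (t : R) : 0 <= t <= 1 -> `|t * s| <= s.
  move=> /andP[t0 t1]; rewrite normrM !ger0_norm ?(ltW s0)//.
  by rewrite ler_piMl // ltW.
have s1 : `|s| <= s by rewrite ger0_norm // ltW.
pose g y := f (y + s *: w) - f y.
have dg (t : R) : 0 <= t <= 1 -> differentiable g (x + t *: (s *: v)).
  move=> t01; apply: differentiableB.
    apply: (@differentiable_comp _ _ _ _ (fun y => y + s *: w) f).
      by apply: differentiableD.
    by rewrite scalerA; apply: D1; [exact: le_trans (bnd t t01) _|exact: le_trans s1 _].
  have := D1 (t * s) 0; rewrite scalerA scale0r addr0; apply.
    exact: le_trans (bnd t t01) _.
  by rewrite normr0 ltW.
have [t /andP[t0 t1] gE] := MVT_line dg.
have t01 : 0 <= t <= 1 by rewrite !ltW.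
have -> : f (x + s *: v + s *: w) - f (x + s *: v) - f (x + s *: w) + f x =
    g (x + s *: v) - g x by rewrite /g; ring.
rewrite {}gE.
have tsd1 : `|t * s| <= d1 by exact: le_trans (bnd t t01) _.
have tsd2 : `|t * s| <= d2 by exact: le_trans (bnd t t01) _.
have -> : 'L_(s *: v) g (x + t *: (s *: v)) =
    s * ('L_v f (x + (t * s) *: v + s *: w) - 'L_v f (x + (t * s) *: v)).
  rewrite derive_scaler; last exact: dg.
  congr (_ * _); rewrite /g deriveBf scalerA.
  - congr (_ - _).
    rewrite (@derive_comp _ _ _ _ (fun y => y + s *: w) f).
    + by rewrite deriveDf ?derive_cstf ?addr0 ?derive_idf.
    + by apply: differentiableD.
    + by apply: D1 => //; exact: le_trans s1 _.
  - apply: (@differentiable_comp _ _ _ _ (fun y => y + s *: w) f).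
      by apply: differentiableD.
    by apply: D1 => //; exact: le_trans s1 _.
  - have := D1 (t * s) 0; rewrite scale0r addr0; apply => //.
    by rewrite normr0 ltW.
have A1 := D2 (t * s) s tsd2 (le_trans s1 sd2).
have A2 := D2 (t * s) 0 tsd2 (eq_ind _ (fun z => z <= d2) (ltW d20) _ (esym (normr0 _))).
move: A1 A2; rewrite scale0r addr0.
rewrite -(addrA x) (addrC x) addrK (addrC x) addrK => A1 A2.
rewrite !(derive_diff _ dDf) in A1 A2 *.
set L := 'd ('L_v f) x in A1 A2 *; set K := _ / _ in A1 A2.
set a := 'L_v f _ in A1 *; set b := 'L_v f _ in A2 *.
rewrite linearD /= !linearZ /= in A1; rewrite linearZ /= in A2.
have N1 : `|(t * s) *: v + s *: w| <= s * (`|v| + `|w|).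
  apply: (le_trans (ler_normD _ _)); rewrite !normrZ mulrDr lerD//.
    by rewrite -normrM ler_wpM2r // bnd.
  by rewrite ler_wpM2r.
have N2 : `|(t * s) *: v| <= s * `|v| by rewrite normrZ ler_wpM2r // bnd.
have K1 : 0 <= K by rewrite ltW.
have B1 := le_trans A1 (ler_wpM2l K1 N1).
have B2 := le_trans A2 (ler_wpM2l K1 N2).
have -> : s * (a - b) - s ^+ 2 * L w =
  s * ((a - 'L_v f x - ((t * s) *: L v + s *: L w)) - (b - 'L_v f x - (t * s) *: L v)).
  by rewrite /GRing.scale/=; ring.
rewrite normrM (ger0_norm (ltW s0)) expr2 mulrCA ler_wpM2l ?(ltW s0)//.
apply: (le_trans (ler_normB _ _)); apply: (le_trans (lerD B1 B2)).
rewrite -mulrDr -mulrDr mulrA (mulrC K) -mulrA mulrC ler_wpM2r ?(ltW s0)//.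
rewrite /K -mulrA ler_piMr ?(ltW e0)// ler_pdivrMl// mulr1.
by rewrite lerDl.
Qed.

(** Both mixed derivatives, multiplied by s^2, approximate the same second difference, each within
    s^2 e / 2. *)
Lemma derive_comm f x v w : (\forall y \near x, differentiable f y) ->
  differentiable ('L_v f) x -> differentiable ('L_w f) x ->
  'L_w ('L_v f) x = 'L_v ('L_w f) x.
Proof.
move=> ndf dv dw; apply/eqP; rewrite -subr_eq0 -normr_le0; apply/ler_addgt0Pr => e e0.
rewrite add0r.
have e2 : 0 < e / 2 by rewrite divr_gt0.
have [d1 d10 D1] := second_difference w ndf dv e2.
have [d2 d20 D2] := second_difference v ndf dw e2.
have s0 : 0 < Num.min d1 d2 by rewrite lt_min d10.
set s := Num.min d1 d2 in s0 *.
have := D1 s s0; rewrite ge_min lexx => /(_ isT) A1.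
have := D2 s s0; rewrite ge_min lexx orbT => /(_ isT) A2.
have ss0 : 0 < s ^+ 2 by rewrite exprn_gt0.
rewrite (addrAC x) in A2; rewrite -(ler_pM2l ss0).
rewrite -[s ^+ 2 in leLHS](ger0_norm (ltW ss0)) -normrM.
set B := f (x + s *: v + s *: w) in A1 A2.
set C := f (x + s *: v) in A1 A2; set D := f (x + s *: w) in A1 A2.
set X := s ^+ 2 in A1 A2 *.
move: A1 A2; set p := 'L_w _ _; set q := 'L_v _ _ => A1 A2.
have -> : X * (p - q) = (B - D - C + f x - X * q) - (B - C - D + f x - X * p).
  by ring.
apply: (le_trans (ler_normB _ _)); apply: (le_trans (lerD A2 A1)).
by rewrite -mulrDl -splitr mulrC.
Qed.

Lemma smooth_on_derive_comm (U : set V) f x v w : open U -> smooth_on U f ->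
  U x -> 'L_w ('L_v f) x = 'L_v ('L_w f) x.
Proof.
move=> oU sf Ux; apply: derive_comm.
- near=> y; apply: smooth_on_diff sf _; near: y; exact: open_nbhs_nbhs.
- exact: smooth_on_diff (smooth_on_derive v sf) Ux.
- exact: smooth_on_diff (smooth_on_derive w sf) Ux.
Unshelve. all: by end_near. Qed.

End Schwarz.

(** * The Euclidean inner product *)

Section DotProduct.
Context {R : realType} {p : nat}.
Implicit Types (u v w y : 'cV[R]_p).

Lemma dotpE u v : dotp u v = \sum_(k < p) u k 0 * v k 0.
Proof. by rewrite /dotp mxE; apply: eq_bigr => k _; rewrite mxE. Qed.

Lemma dotpC u v : dotp u v = dotp v u.
Proof. by rewrite !dotpE; apply: eq_bigr => k _; rewrite mulrC. Qed.

Lemma dotpDl u v w : dotp (u + v) w = dotp u w + dotp v w.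
Proof.
by rewrite !dotpE -big_split; apply: eq_bigr => k _; rewrite mxE mulrDl.
Qed.

Lemma dotpDr u v w : dotp w (u + v) = dotp w u + dotp w v.
Proof. by rewrite dotpC dotpDl ![dotp _ w]dotpC. Qed.

Lemma dotpZl a u v : dotp (a *: u) v = a * dotp u v.
Proof.
by rewrite !dotpE mulr_sumr; apply: eq_bigr => k _; rewrite mxE mulrA.
Qed.

Lemma dotpZr a u v : dotp u (a *: v) = a * dotp u v.
Proof. by rewrite dotpC dotpZl dotpC. Qed.

Lemma dotpNl u v : dotp (- u) v = - dotp u v.
Proof. by rewrite -scaleN1r dotpZl mulN1r. Qed.

Lemma dotpNr u v : dotp u (- v) = - dotp u v.
Proof. by rewrite dotpC dotpNl dotpC. Qed.

Lemma dotpBl u v w : dotp (u - v) w = dotp u w - dotp v w.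
Proof. by rewrite dotpDl dotpNl. Qed.

Lemma dotpBr u v w : dotp w (u - v) = dotp w u - dotp w v.
Proof. by rewrite dotpDr dotpNr. Qed.

Lemma dotp0l v : dotp 0 v = 0.
Proof. by rewrite -(scale0r 0) dotpZl mul0r. Qed.

Lemma dotp0r v : dotp v 0 = 0.
Proof. by rewrite dotpC dotp0l. Qed.

Lemma dotp_suml (I : Type) (r : seq I) (P : pred I) (u : I -> 'cV[R]_p) v :
  dotp (\sum_(i <- r | P i) u i) v = \sum_(i <- r | P i) dotp (u i) v.
Proof.
by apply: (big_morph (dotp^~ v)) => [x y|]; [exact: dotpDl|exact: dotp0l].
Qed.

Lemma dotp_sumr (I : Type) (r : seq I) (P : pred I) (u : I -> 'cV[R]_p) v :
  dotp v (\sum_(i <- r | P i) u i) = \sum_(i <- r | P i) dotp v (u i).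
Proof. by rewrite dotpC dotp_suml; apply: eq_bigr => i _; rewrite dotpC. Qed.

Lemma dotp_delta k v : dotp (delta_mx k 0) v = v k 0.
Proof.
rewrite dotpE (bigD1 k) //= !mxE !eqxx mul1r big1 ?addr0 // => i ik.
by rewrite !mxE (negbTE ik) mul0r.
Qed.

Lemma dotp_ge0 u : 0 <= dotp u u.
Proof. by rewrite dotpE sumr_ge0 // => k _; rewrite -expr2 sqr_ge0. Qed.

Lemma dotp_eq0 u : (dotp u u == 0) = (u == 0).
Proof.
apply/eqP/eqP => [|->]; last exact: dotp0l.
rewrite dotpE => /eqP; rewrite psumr_eq0 => [/allP u0|k _]; last first.
  by rewrite -expr2 sqr_ge0.
apply/colP => k; have := u0 k (mem_index_enum k).
by rewrite /= mulf_eq0 orbb mxE => /eqP.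
Qed.

Lemma dotp_gt0 u : (0 < dotp u u) = (u != 0).
Proof. by rewrite lt0r dotp_eq0 dotp_ge0 andbT. Qed.

Lemma dotp_inj u v : (forall w, dotp u w = dotp v w) -> u = v.
Proof.
by move=> uv; apply/colP => k; rewrite -!dotp_delta dotpC uv dotpC.
Qed.

End DotProduct.

Lemma dotp_mulmx {R : realType} {p q : nat} (A : 'M[R]_(p, q)) u v :
  dotp u (A *m v) = dotp (A^T *m u) v.
Proof. by rewrite /dotp trmx_mul trmxK mulmxA. Qed.

Definition enorm {R : realType} {p : nat} (y : 'cV[R]_p) : R :=
  Num.sqrt (dotp y y).

Definition punctured {R : realType} {p : nat} : set 'cV[R]_p := [set y | y != 0].

Section EuclideanNorm.
Context {R : realType} {p : nat}.
Implicit Types (u v w y : 'cV[R]_p).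

Lemma enorm_gt0 y : (0 < enorm y) = (y != 0).
Proof. by rewrite /enorm sqrtr_gt0 dotp_gt0. Qed.

Lemma sqr_enorm y : enorm y ^+ 2 = dotp y y.
Proof. by rewrite sqr_sqrtr // dotp_ge0. Qed.

Lemma enormZ a y : enorm (a *: y) = `|a| * enorm y.
Proof.
by rewrite /enorm dotpZl dotpZr mulrA -expr2 sqrtrM ?sqr_ge0 // sqrtr_sqr.
Qed.

Lemma dotp_normalize y : y != 0 ->
  dotp ((enorm y)^-1 *: y) ((enorm y)^-1 *: y) = 1.
Proof.
move=> y0; rewrite -sqr_enorm enormZ gtr0_norm ?invr_gt0 ?enorm_gt0 //.
by rewrite mulVf ?expr1n // gt_eqF ?enorm_gt0.
Qed.

Lemma enormK y : y != 0 -> enorm y *: ((enorm y)^-1 *: y) = y.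
Proof.
by move=> y0; rewrite scalerA divff ?scale1r // gt_eqF // enorm_gt0.
Qed.

Lemma coord_le_enorm y k : `|y k 0| <= enorm y.
Proof.
rewrite -sqrtr_sqr ler_wsqrtr // dotpE (bigD1 k) //= expr2 lerDl sumr_ge0 //.
by move=> i _; rewrite -expr2 sqr_ge0.
Qed.

Lemma norm_le_enorm y : `|y| <= enorm y.
Proof.
rewrite [leLHS]/Num.Def.normr /= mx_normrE bigmax_le ?sqrtr_ge0 // => -[i j] _ /=.
by rewrite ord1; exact: coord_le_enorm.
Qed.

Lemma coord_le_norm y k : `|y k 0| <= `|y|.
Proof.
rewrite [leRHS]/Num.Def.normr /= mx_normrE.
exact: (@le_bigmax _ _ _ 0 (fun ij : 'I_p * 'I_1 => `|y ij.1 ij.2|) (k, 0)).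
Qed.

Lemma dotp_le_norm y : dotp y y <= p%:R * `|y| ^+ 2.
Proof.
rewrite dotpE; apply: (@le_trans _ _ (\sum_(k < p) `|y| ^+ 2)).
  apply: ler_sum => k _; rewrite -expr2 -real_normK ?num_real //.
  by rewrite lerXn2r ?nnegrE // coord_le_norm.
by rewrite sumr_const card_ord mulr_natl.
Qed.

Lemma smooth_on_dotp (V : normedModType R) (U : set V) (f g : V -> 'cV[R]_p) :
  open U -> (forall k, smooth_on U (fun x => f x k 0)) ->
  (forall k, smooth_on U (fun x => g x k 0)) ->
  smooth_on U (fun x => dotp (f x) (g x)).
Proof.
move=> oU sf sg; have -> : (fun x => dotp (f x) (g x)) =
    (fun x => \sum_(k < p) f x k 0 * g x k 0).
  by apply/funext => x; exact: dotpE.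
by apply: smooth_on_sum => // k; exact: smooth_on_mul.
Qed.

Lemma differentiable_dotp (V : normedModType R) (f g : V -> 'cV[R]_p) x :
  differentiable f x -> differentiable g x ->
  differentiable (fun z => dotp (f z) (g z)) x.
Proof.
move=> /differentiable_mxP df /differentiable_mxP dg.
have -> : (fun z => dotp (f z) (g z)) =
    \sum_(k < p) (fun z => f z k 0 * g z k 0).
  by apply/funext => z; rewrite dotpE fct_sumE.
by apply: differentiable_sum => k; exact: differentiableM.
Qed.

Lemma derive_dotp (V : normedModType R) (f g : V -> 'cV[R]_p) (x v : V) :
  differentiable f x -> differentiable g x ->
  'L_v (fun z => dotp (f z) (g z)) x = dotp ('L_v f x) (g x) + dotp (f x) ('L_v g x).
Proof.
move=> df dg; have /differentiable_mxP df' := df; have /differentiable_mxP dg' := dg.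
have -> : (fun z => dotp (f z) (g z)) = (fun z => \sum_(k < p) f z k 0 * g z k 0).
  by apply/funext => z; rewrite dotpE.
rewrite derive_sumf => [|k]; last exact: differentiableM.
rewrite !dotpE -big_split; apply: eq_bigr => k _.
by rewrite deriveMf // !derive_mxE.
Qed.

Lemma open_punctured : open (@punctured R p).
Proof.
rewrite (_ : punctured = ~` [set 0]); last first.
  by apply/seteqP; split=> y /= /eqP.
exact/closed_openC/(@accessible_closed_set1 'cV[R]_p)/hausdorff_accessible/norm_hausdorff.
Qed.

Lemma smooth_on_punctured_coord k : smooth_on punctured (fun y : 'cV[R]_p => y k 0).
Proof. exact/smooth_on_id_coord/open_punctured. Qed.

Lemma smooth_on_sqnorm : smooth_on punctured (fun y : 'cV[R]_p => dotp y y).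
Proof.
by apply: smooth_on_dotp => [|k|k];
  [exact: open_punctured|exact: smooth_on_punctured_coord|exact: smooth_on_punctured_coord].
Qed.

Lemma smooth_on_enorm : smooth_on punctured (@enorm R p).
Proof.
apply: smooth_on_sqrt; [exact: open_punctured|exact: smooth_on_sqnorm|].
by move=> y y0; rewrite dotp_gt0.
Qed.

Lemma smooth_on_enormV : smooth_on punctured (fun y : 'cV[R]_p => (enorm y)^-1).
Proof.
apply: smooth_on_rsqrt; [exact: open_punctured|exact: smooth_on_sqnorm|].
by move=> y y0; rewrite dotp_gt0.
Qed.

Lemma continuous_dotp : continuous (fun y : 'cV[R]_p => dotp y y).
Proof.
move=> y; apply: (@differentiable_continuous _ 'cV[R]_p).
exact: differentiable_dotp.
Qed.

End EuclideanNorm.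

Lemma trmx_continuous (R : realType) p q : continuous (@trmx R p q).
Proof.
move=> M; apply: differentiable_continuous; apply/differentiable_mxP => i j.
by under eq_fun do rewrite mxE; exact: differentiable_coord.
Qed.

(** Transposition is continuous and preserves the sup norm, so Heine-Borel passes from rows to
    columns. *)
Lemma bounded_closed_compact_col (R : realType) p (A : set 'cV[R]_p) :
  bounded_set A -> closed A -> compact A.
Proof.
move=> [M [Mr MA]] clA.
have -> : A = trmx @` [set y : 'rV[R]_p | A y^T].
  apply/seteqP; split=> [y Ay|_ [y Ay <-] //].
  by exists y^T; rewrite /= ?trmxK.
apply: continuous_compact; first exact/continuous_subspaceT/trmx_continuous.
apply: bounded_closed_compact.
  exists M; split=> // N MN y /= /(MA N MN); apply: le_trans.
  rewrite [leLHS]/Num.Def.normr [leRHS]/Num.Def.normr /= !mx_normrE.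
  apply: bigmax_le => [|[i j] _ /=].
    by apply: bigmax_ge_id.
  have := @le_bigmax _ _ _ 0 (fun ij : 'I_p * 'I_1 => `|y^T ij.1 ij.2|) (j, i).
  by rewrite /= mxE.
apply: (@closed_comp _ _ (@trmx R 1 p) A) => // y _.
exact: trmx_continuous.
Qed.

Lemma sphere_compact (R : realType) n : compact (@sphere R n).
Proof.
apply: bounded_closed_compact_col.
  exists 1; split; first exact: num_real.
  move=> M M1 y /= y1; apply: (le_trans (norm_le_enorm y)).
  by rewrite /enorm y1 sqrtr1 ltW.
apply: (@closed_comp _ _ (fun y : 'cV[R]_n.+1 => dotp y y) [set 1]) => [y _|].
  exact: continuous_dotp.
exact: closed_eq.
Qed.

(** * The Laplacian and the maximum principle *)

Section SecondDerivativeTest.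
Context {R : realType} {V : normedModType R}.
Implicit Types (f : V -> R) (x v : V).

(** Right-hand difference quotients bound the derivative by 0 in every direction; [v] and [- v]
    together give equality. *)
Lemma derive_at_max f x v : differentiable f x ->
  (\forall y \near x, f y <= f x) -> 'L_v f x = 0.
Proof.
move=> df fmax; rewrite dirderE.
have H w : 'D_w f x <= 0.
  have cvf : cvg ((fun h : R => h^-1 *: (f (h *: w + x) - f x)) @ 0^').
    exact: diff_derivable.
  have [d d0 dmax] := nbhs_line w 0 fmax.
  rewrite /derive cvg_at_rightE //; apply: limr_le.
    apply/cvg_ex; exists (lim ((fun h : R => h^-1 *: (f (h *: w + x) - f x)) @ 0^')).
    apply: cvg_trans cvf; apply: cvg_app => A [e e0 Ae].
    by exists e => // z ze z0; apply: Ae => //; exact: lt0r_neq0.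
  near=> h; rewrite /= mulr_ge0_le0 ?invr_ge0 ?subr_le0 //.
  have := dmax h 0; rewrite scaler0 addr0 normr0 addrC; apply; last exact: ltW.
  by rewrite ger0_norm //; near: h; exact: nbhs_right_le.
apply/eqP; rewrite eq_le H /=.
have := H (- v); rewrite -scaleN1r.
by have := derive_scaler (-1) v df; rewrite dirderE => ->; rewrite scaleN1r oppr_le0.
Unshelve. all: by end_near. Qed.

(** Were the second derivative positive, ['L_v f], which is 0 at [x], would be positive just beyond
    [x] in the direction [v], and the mean value theorem would push [f] above its maximum. *)
Lemma derive2_at_max f x v : (\forall y \near x, differentiable f y) ->
  differentiable ('L_v f) x -> (\forall y \near x, f y <= f x) ->
  'L_v ('L_v f) x <= 0.
Proof.
move=> ndf dDf fmax; rewrite leNgt; apply/negP => D0.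
have Dx0 : 'L_v f x = 0 by apply: derive_at_max => //; exact: nbhs_singleton ndf.
have cvD : (fun h : R => h^-1 *: ('L_v f (h *: v + x) - 'L_v f x)) @ 0^' -->
    'L_v ('L_v f) x by rewrite (derive_diff _ dDf) -deriveE //; exact: diff_derivable.
have : \forall h \near 0^', 0 < h^-1 *: ('L_v f (h *: v + x) - 'L_v f x).
  exact: (cvgr_gt _ cvD).
rewrite Dx0 => -[e /= e0 eP].
have [d1 d10 fmax1] := nbhs_line v 0 fmax.
have [d2 d20 ndf1] := nbhs_line v 0 ndf.
pose s := Num.min (e / 2) (Num.min d1 d2).
have s0 : 0 < s by rewrite !lt_min d10 d20 divr_gt0.
have se : s < e.
  by rewrite gt_min; apply/orP; left; rewrite gtr_pMr //; lra.
have sd1 : s <= d1 by rewrite !ge_min lexx !orbT.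
have sd2 : s <= d2 by rewrite !ge_min lexx !orbT.
have [t t01|t /andP[t0 t1] E] := @MVT_line _ _ f x (s *: v).
  have /andP[t0 t1] := t01.
  have := ndf1 (t * s) 0; rewrite scaler0 addr0 scalerA normr0; apply; last exact: ltW.
  rewrite normrM (ger0_norm t0) (gtr0_norm s0).
  by apply: le_trans sd2; rewrite ler_piMl // ltW.
have ts0 : 0 < t * s by rewrite mulr_gt0.
have tse : t * s < e by apply: le_lt_trans se; rewrite ler_piMl ?ltW.
have := eP (t * s); rewrite /ball /= sub0r normrN gtr0_norm // => /(_ tse).
move=> /(_ (lt0r_neq0 ts0)); rewrite subr0 /GRing.scale /= pmulr_rgt0 ?invr_gt0 //.
move=> Dpos.
have : 0 < f (x + s *: v) - f x.
  rewrite E derive_scaler; last first.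
    have := ndf1 (t * s) 0; rewrite scaler0 addr0 scalerA normr0; apply.
      rewrite gtr0_norm //; apply: le_trans sd2.
      by rewrite ler_piMl ?ltW.
    exact: ltW.
  by rewrite scalerA addrC mulr_gt0.
apply/negP; rewrite -leNgt subr_le0.
have := fmax1 s 0; rewrite scaler0 addr0 normr0 gtr0_norm //.
by apply => //; exact: ltW.
Qed.

End SecondDerivativeTest.

Section Laplacian.
Context {R : realType} {p : nat}.
Implicit Types (f g : 'cV[R]_p -> R) (y : 'cV[R]_p) (U : set 'cV[R]_p).

Lemma pd_eq_on U f g k y : open U -> U y -> (forall z, U z -> f z = g z) ->
  pd k f y = pd k g y.
Proof. by rewrite !pdE; exact: derive_eq_on. Qed.

Lemma lap_eq_on U f g y : open U -> U y -> (forall z, U z -> f z = g z) ->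
  lap f y = lap g y.
Proof.
move=> oU Uy fg; rewrite !lapE; apply: eq_bigr => k _; apply: (pd_eq_on _ oU Uy) => z Uz.
exact: pd_eq_on fg.
Qed.

Lemma pdM U f g k y : smooth_on U f -> smooth_on U g -> U y ->
  pd k (fun z => f z * g z) y = pd k f y * g y + f y * pd k g y.
Proof.
by move=> sf sg Uy; rewrite !pdE deriveMf //; exact: smooth_on_diff Uy.
Qed.

Lemma pdD U f g k y : smooth_on U f -> smooth_on U g -> U y ->
  pd k (fun z => f z + g z) y = pd k f y + pd k g y.
Proof.
by move=> sf sg Uy; rewrite !pdE deriveDf //; exact: smooth_on_diff Uy.
Qed.

Lemma pdB U f g k y : smooth_on U f -> smooth_on U g -> U y ->
  pd k (fun z => f z - g z) y = pd k f y - pd k g y.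
Proof.
by move=> sf sg Uy; rewrite !pdE deriveBf //; exact: smooth_on_diff Uy.
Qed.

Lemma pdZ U f a k y : smooth_on U f -> U y ->
  pd k (fun z => a * f z) y = a * pd k f y.
Proof. by move=> sf Uy; rewrite !pdE deriveZf //; exact: smooth_on_diff Uy. Qed.

Lemma pd_sum q U (h : 'I_q -> 'cV[R]_p -> R) k y :
  (forall i, smooth_on U (h i)) -> U y ->
  pd k (fun z => \sum_(i < q) h i z) y = \sum_(i < q) pd k (h i) y.
Proof.
move=> sh Uy; rewrite pdE derive_sumf => [|i]; last exact: smooth_on_diff Uy.
by apply: eq_bigr => i _; rewrite pdE.
Qed.

Lemma pd_cst k (a : R) y : pd k (fun=> a) y = 0.
Proof. by rewrite pdE derive_cstf. Qed.

Lemma lapM U f g y : open U -> smooth_on U f -> smooth_on U g -> U y ->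
  lap (fun z => f z * g z) y =
  lap f y * g y + 2 * (\sum_(k < p) pd k f y * pd k g y) + f y * lap g y.
Proof.
move=> oU sf sg Uy; rewrite !lapE mulr_sumr mulr_suml mulr_sumr -!big_split /=.
apply: eq_bigr => k _.
rewrite (pd_eq_on _ oU Uy (fun z => @pdM U f g k z sf sg)).
have spf := smooth_on_pd k sf; have spg := smooth_on_pd k sg.
rewrite (@pdD U) ?(@pdM U) //; try exact: smooth_on_mul.
by ring.
Qed.

Lemma lapD U f g y : open U -> smooth_on U f -> smooth_on U g -> U y ->
  lap (fun z => f z + g z) y = lap f y + lap g y.
Proof.
move=> oU sf sg Uy; rewrite !lapE -!big_split /=; apply: eq_bigr => k _.
rewrite (pd_eq_on _ oU Uy (fun z => @pdD U f g k z sf sg)).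
by rewrite (@pdD U) //; exact: smooth_on_pd.
Qed.

Lemma lap_sum q U (h : 'I_q -> 'cV[R]_p -> R) y : open U ->
  (forall i, smooth_on U (h i)) -> U y ->
  lap (fun z => \sum_(i < q) h i z) y = \sum_(i < q) lap (h i) y.
Proof.
move=> oU sh Uy; rewrite lapE.
under [RHS]eq_bigr do rewrite lapE.
rewrite exchange_big; apply: eq_bigr => k _ /=.
rewrite (pd_eq_on _ oU Uy (fun z Uz => pd_sum k sh Uz)).
by rewrite (pd_sum k _ Uy) // => i; exact: smooth_on_pd.
Qed.

Lemma lapB U f g y : open U -> smooth_on U f -> smooth_on U g -> U y ->
  lap (fun z => f z - g z) y = lap f y - lap g y.
Proof.
move=> oU sf sg Uy; rewrite !lapE -sumrB; apply: eq_bigr => k _.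
rewrite (pd_eq_on _ oU Uy (fun z => @pdB U f g k z sf sg)).
by rewrite (@pdB U) //; exact: smooth_on_pd.
Qed.

Lemma lap_cst a y : lap (fun=> a) y = 0.
Proof.
rewrite !lapE big1 // => k _.
have -> : pd k (fun=> a) = (fun=> 0) by apply/funext => z; exact: pd_cst.
exact: pd_cst.
Qed.

Lemma lap_coord i y : lap (fun z : 'cV[R]_p => z i 0) y = 0.
Proof.
rewrite !lapE big1 // => k _.
have -> : pd k (fun z : 'cV[R]_p => z i 0) = (fun=> (i == k)%:R).
  by apply/funext => z; exact: pd_coord.
exact: pd_cst.
Qed.

Lemma lapZ U f a y : open U -> smooth_on U f -> U y ->
  lap (fun z => a * f z) y = a * lap f y.
Proof.
move=> oU sf Uy; rewrite (@lapM U) //; last exact: smooth_on_cst.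
by rewrite lap_cst big1 ?mulr0 ?mul0r ?add0r // => k _; rewrite pd_cst mul0r.
Qed.

Lemma lap_sqr U f y : open U -> smooth_on U f -> U y ->
  lap (fun z => f z ^+ 2) y = 2 * (f y * lap f y + \sum_(k < p) pd k f y ^+ 2).
Proof.
move=> oU sf Uy; under [X in lap X]eq_fun do rewrite expr2.
rewrite (@lapM U) //; under eq_bigr do rewrite -expr2.
by ring.
Qed.

Lemma lap_coordM U f i y : open U -> smooth_on U f -> U y ->
  lap (fun z => z i 0 * f z) y = y i 0 * lap f y + 2 * pd i f y.
Proof.
move=> oU sf Uy; rewrite (@lapM U) //; last exact: smooth_on_id_coord.
rewrite lap_coord mul0r add0r (bigD1 i) //= pd_coord eqxx mul1r big1.
  by rewrite addr0 addrC.
by move=> k ki; rewrite pd_coord eq_sym (negbTE ki) mul0r.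
Qed.

Lemma pd_comm U f k l y : open U -> smooth_on U f -> U y ->
  pd k (pd l f) y = pd l (pd k f) y.
Proof. by rewrite !pdE; exact: smooth_on_derive_comm. Qed.

Lemma lap_pd U f k y : open U -> smooth_on U f -> U y ->
  lap (pd k f) y = pd k (lap f) y.
Proof.
move=> oU sf Uy; rewrite lapE.
have -> : lap f = (fun y => \sum_(k < p) pd k (pd k f) y).
  by apply/funext => z; exact: lapE.
rewrite (@pd_sum _ U) // => [|i]; last first.
  by do 2 apply: smooth_on_pd.
apply: eq_bigr => i _; rewrite -(pd_comm _ _ oU (smooth_on_pd i sf) Uy).
by apply: (pd_eq_on _ oU Uy) => z Uz; exact: pd_comm Uz.
Qed.

Lemma lap_at_max U f y : open U -> smooth_on U f -> U y ->
  (forall z, U z -> f z <= f y) -> lap f y <= 0.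
Proof.
move=> oU sf Uy fmax; rewrite lapE; apply: sumr_le0 => k _; rewrite !pdE.
apply: derive2_at_max.
- by near=> z; apply: smooth_on_diff sf _; near: z; exact: open_nbhs_nbhs.
- by apply: smooth_on_diff Uy; exact: smooth_on_derive.
- by near=> z; apply: fmax; near: z; exact: open_nbhs_nbhs.
Unshelve. all: by end_near. Qed.

Lemma pd_at_max U f y k : open U -> smooth_on U f -> U y ->
  (forall z, U z -> f z <= f y) -> pd k f y = 0.
Proof.
move=> oU sf Uy fmax; rewrite pdE; apply: derive_at_max; first exact: smooth_on_diff Uy.
by near=> z; apply: fmax; near: z; exact: open_nbhs_nbhs.
Unshelve. all: by end_near. Qed.

End Laplacian.

(** * Homogeneous functions on punctured space *)

Section Homogeneous.
Context {R : realType}.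

Definition homogeneous0 {p} (f : 'cV[R]_p -> R) :=
  forall (c : R) y, 0 < c -> y != 0 -> f (c *: y) = f y.

(** The factor [a] stays free to serve several degrees: it is 1 in degree 0 and [c] in degree 1. *)
Lemma pd_homogeneous p (f : 'cV[R]_p -> R) (c a : R) k y :
  smooth_on punctured f -> 0 < c -> y != 0 ->
  (forall z, z != 0 -> f (c *: z) = a * f z) ->
  c * pd k f (c *: y) = a * pd k f y.
Proof.
move=> sf c0 y0 fc.
have cy0 : c *: y != 0 by rewrite scaler_eq0 negb_or y0 gt_eqF.
have dc : differentiable (fun z : 'cV[R]_p => c *: z) y by exact: differentiableZ.
have dfy : differentiable f (c *: y) by exact: (smooth_on_diff sf).
have := derive_comp (delta_mx k 0) dc dfy.
have -> : 'L_(delta_mx k 0) (fun z : 'cV[R]_p => c *: z) y = c *: delta_mx k 0.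
  have /= := @deriveZ _ _ _ id c y (delta_mx k 0) (@derivable_id _ _ _ _).
  by rewrite derive_id dirderE.
rewrite derive_scaler // !pdE /= => E.
rewrite -[LHS]E -deriveZf; last exact: (smooth_on_diff sf).
by apply: derive_eq_on (@open_punctured R p) y0 _ => z z0; rewrite /= fc.
Qed.

(** Compactness of the sphere yields a maximum over all of punctured space, which is open, so the
    derivative tests for interior maxima apply to it. *)
Lemma homogeneous0_max n (f : 'cV[R]_n.+1 -> R) : smooth_on punctured f ->
  homogeneous0 f ->
  exists2 y, y != 0 & forall z, z != 0 -> f z <= f y.
Proof.
move=> sf hf.
have sph0 (y : 'cV[R]_n.+1) : sphere y -> y != 0.
  by move=> y1; rewrite -dotp_gt0 y1.
have [|||y ys ymax] := @compact_EVT_max 'cV[R]_n.+1 R f sphere.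
- exists (delta_mx 0 0); rewrite /sphere /= dotp_delta !mxE //.
- exact: sphere_compact.
- apply: continuous_in_subspaceT => y; rewrite inE => /sph0 y0.
  exact/differentiable_continuous/(smooth_on_diff sf).
exists y; first by apply: sph0; rewrite inE in ys.
move=> z z0; rewrite -(hf (enorm z)^-1 z) ?invr_gt0 ?enorm_gt0 //.
by apply: ymax; rewrite inE; exact: dotp_normalize.
Qed.

(** Connectedness by hand: the segment from [y] to a basis vector e_j misses the origin as soon as
    [y] has a nonzero coordinate [i] different from [j]. Passing from one basis vector to another
    takes two indices, hence n > 0. *)
Lemma punctured_constant n (f : 'cV[R]_n.+1 -> R) : (0 < n)%N ->
  (forall y, y != 0 -> differentiable f y) ->
  (forall y k, y != 0 -> pd k f y = 0) ->
  forall y z, y != 0 -> z != 0 -> f y = f z.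
Proof.
move=> n0 df f0.
have seg (y : 'cV[R]_n.+1) j i : i != j -> y i 0 != 0 -> f y = f (delta_mx j 0).
  move=> ij yi.
  have s0 (t : R) : t != 1 -> y + t *: (delta_mx j 0 - y) != 0.
    move=> t1; apply/eqP => /colP /(_ i); rewrite !mxE eqxx (negbTE ij) /= => /eqP.
    rewrite sub0r mulrN -[X in X - _]mul1r -mulrBl mulf_eq0 (negbTE yi) orbF subr_eq0.
    by rewrite eq_sym (negbTE t1).
  have s1 : y + 1 *: (delta_mx j 0 - y) != 0.
    rewrite scale1r addrC subrK; apply/eqP => /colP /(_ j) /eqP.
    by rewrite !mxE !eqxx oner_eq0.
  have [t _|t /andP[_ t1]] := @MVT_line _ _ f y (delta_mx j 0 - y).
    by apply: df; have [->|/s0] := eqVneq t 1.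
  have yt0 := s0 t (negbT (lt_eqF t1)).
  rewrite [y + _]addrC subrK derive_pd; last exact: df.
  by rewrite big1 => [|k _]; [move/subr0_eq|rewrite f0 ?mulr0].
have other (i : 'I_n.+1) : exists j, i != j.
  (* The index is 0 when [i] is not 0, and 1 when [i] is 0; [inord] returns a genuine 1 because n >
     0. *)
  exists (inord (~~ (i != 0))); apply/eqP => /(congr1 val).
  rewrite /= inordK; last by case: (i != 0).
  by rewrite negbK; case: eqVneq => [-> //|/eqP ni i0]; apply: ni; exact: val_inj.
have e (i j : 'I_n.+1) : f (delta_mx i 0) = f (delta_mx j 0).
  have [->//|ij] := eqVneq i j.
  by apply: (seg _ _ i) => //; rewrite !mxE !eqxx oner_eq0.
suff H (y : 'cV[R]_n.+1) : y != 0 -> f y = f (delta_mx 0 0) by move=> y z /H -> /H ->.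
move=> y0; have [i yi] : exists i, y i 0 != 0.
  apply/existsP; rewrite -negb_forall; apply: contra y0 => /forallP y0.
  by apply/eqP/colP => i; rewrite mxE; apply/eqP.
by have [j ij] := other i; rewrite (seg y j i) //.
Qed.

End Homogeneous.

(** * Homogeneous harmonic functions on punctured space *)

Section Liouville.
Context {R : realType} {n : nat}.
Implicit Types (f h : 'cV[R]_n.+1 -> R) (y : 'cV[R]_n.+1).

Local Notation P := (@punctured R n.+1).

Lemma derive_radial0 f y : smooth_on P f -> homogeneous0 f -> y != 0 ->
  \sum_(k < n.+1) y k 0 * pd k f y = 0.
Proof.
move=> sf hf y0; have df : differentiable f y by exact: (smooth_on_diff sf).
rewrite -derive_pd //.
have := (is_derive_line (x := 0) (v := y) (t := 1)); rewrite add0r scale1r.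
move=> /(_ _ df)[_ <-].
have -> (g : R -> R) : 'D_(1 : R) g 1 = 'L_(1 : R) g 1 by rewrite dirderE.
rewrite (@derive_eq_on _ _ _ [set t : R | 0 < t] _ (fun=> f y)) ?derive_cstf //=.
by move=> t t0; rewrite add0r hf.
Qed.

Lemma derive_radial1 f y : smooth_on P f ->
  (forall (c : R) z, 0 < c -> z != 0 -> f (c *: z) = c * f z) -> y != 0 ->
  \sum_(k < n.+1) y k 0 * pd k f y = f y.
Proof.
move=> sf hf y0; have df : differentiable f y by exact: (smooth_on_diff sf).
rewrite -derive_pd //.
have := (is_derive_line (x := 0) (v := y) (t := 1)); rewrite add0r scale1r.
move=> /(_ _ df)[_ <-].
have -> (g : R -> R) : 'D_(1 : R) g 1 = 'L_(1 : R) g 1 by rewrite dirderE.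
rewrite (@derive_eq_on _ _ _ [set t : R | 0 < t] _ (fun t => t * f y)) //=.
  have /= -> := @deriveMf _ _ id (fun=> f y) 1 1 _ (differentiable_cst _ _) => //.
  by rewrite derive_idf derive_cstf mulr0 addr0 mul1r.
by move=> t t0; rewrite add0r hf.
Qed.

Lemma homogeneous0_pd f k (c : R) y : smooth_on P f -> homogeneous0 f ->
  0 < c -> y != 0 -> pd k f (c *: y) = c^-1 * pd k f y.
Proof.
move=> sf hf c0 y0; apply: (mulfI (lt0r_neq0 c0)).
rewrite mulrA divff ?gt_eqF // (pd_homogeneous _ sf c0 y0 (a := 1)) //.
by move=> z z0; rewrite mul1r hf.
Qed.

(* Infinitesimal rotations commute with the Laplacian, and the maximum
   principle needs no strong form: at a maximum of [k^2 + c f^2], where [k] is a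
   rotational derivative of [f], the gradient of [f] vanishes, so that
   [k^2 <= c max f^2] everywhere; let [c] tend to [0]. *)
Lemma harmonic0_rotation f : smooth_on P f -> homogeneous0 f ->
  (forall y, y != 0 -> lap f y = 0) ->
  forall i j y, y != 0 -> y i 0 * pd j f y = y j 0 * pd i f y.
Proof.
move=> sf hf lf i j y y0.
have oP := @open_punctured R n.+1.
pose k y := y i 0 * pd j f y - y j 0 * pd i f y.
have sc l l' : smooth_on P (fun z => z l 0 * pd l' f z).
  by apply: smooth_on_mul => //; [exact: smooth_on_id_coord|exact: smooth_on_pd].
have sk : smooth_on P k by exact: smooth_on_sub.
have lpd l z : z != 0 -> lap (pd l f) z = 0.
  move=> z0; rewrite (@lap_pd _ _ P) //.
  by rewrite (@pd_eq_on _ _ P _ (fun=> 0)) ?pd_cst.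
have lk z : z != 0 -> lap k z = 0.
  move=> z0; rewrite (@lapB _ _ P) // !(@lap_coordM _ _ P) //; try exact: smooth_on_pd.
  rewrite !lpd // (@pd_comm _ _ P f i j) //.
  by rewrite !mulr0 !add0r subrr.
have hk : homogeneous0 k.
  move=> c z c0 z0; rewrite /k !mxE !(homogeneous0_pd _ sf) //.
  have E a b : c * a * (c^-1 * b) = a * b.
    by rewrite mulrACA divff ?gt_eqF // mul1r.
  by rewrite !E.
have sf2 := smooth_on_sqr oP sf.
have hf2 : homogeneous0 (fun z => f z ^+ 2) by move=> c z c0 z0; rewrite hf.
have [y1 y10 f2max] := homogeneous0_max sf2 hf2.
have key c : 0 < c -> k y ^+ 2 <= c * f y1 ^+ 2.
  move=> c0; pose Q z := k z ^+ 2 + c * f z ^+ 2.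
  have sk2 := smooth_on_sqr oP sk.
  have scf2 : smooth_on P (fun z => c * f z ^+ 2).
    by apply: smooth_on_mul => //; exact: smooth_on_cst.
  have sQ : smooth_on P Q by exact: smooth_on_add.
  have hQ : homogeneous0 Q by move=> d z d0 z0; rewrite /Q hk // hf.
  have [q q0 Qmax] := homogeneous0_max sQ hQ.
  have := lap_at_max oP sQ q0 Qmax.
  rewrite (@lapD _ _ P) // (@lapZ _ _ P) // !(@lap_sqr _ _ P) // lk // lf //.
  rewrite !mulr0 !add0r => H.
  have s0 g : 0 <= \sum_(l < n.+1) pd l g q ^+ 2.
    by apply: sumr_ge0 => l _; exact: sqr_ge0.
  have : \sum_(l < n.+1) pd l f q ^+ 2 = 0.
    apply/eqP; rewrite eq_le s0 andbT -(pmulr_rle0 _ c0).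
    have := s0 k; set a := \sum_(l < _) pd l k q ^+ 2 in H *; set b := \sum_(l < _) _ in H *.
    by move=> a0; lra.
  move=> /eqP; rewrite psumr_eq0 => [/allP pf0|l _]; last exact: sqr_ge0.
  have pf l : pd l f q = 0.
    by have := pf0 l (mem_index_enum l); rewrite /= sqrf_eq0 => /eqP.
  have := Qmax y y0; rewrite /Q {2}/k !pf !mulr0 subrr expr0n add0r => H1.
  have := f2max q q0 => H2; have H3 : 0 <= c * f y ^+ 2.
    by rewrite mulr_ge0 ?sqr_ge0 ?ltW.
  apply: (@le_trans _ _ (c * f q ^+ 2)); last by rewrite ler_wpM2l // ltW.
  by apply: le_trans H1; rewrite lerDl.
have k0 : k y ^+ 2 <= 0.
  apply/ler_addgt0Pr => e e0; rewrite add0r.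
  have F0 : 0 < f y1 ^+ 2 + 1 by rewrite ltr_wpDl ?sqr_ge0.
  apply: le_trans (key (e / (f y1 ^+ 2 + 1)) _) _; first by rewrite divr_gt0.
  rewrite mulrAC ler_pdivrMr // ler_pM2l //.
  by rewrite lerDl.
apply/eqP; rewrite -subr_eq0 -sqrf_eq0 eq_le sqr_ge0 andbT; exact: k0.
Qed.

(** The rotational identities give |y|^2 d_i f = y_i (sum of y_k d_k f), and the sum is zero in
    degree 0. So the gradient vanishes. *)
Lemma harmonic0_constant f : (0 < n)%N -> smooth_on P f -> homogeneous0 f ->
  (forall y, y != 0 -> lap f y = 0) ->
  forall y z, y != 0 -> z != 0 -> f y = f z.
Proof.
move=> n0 sf hf lf; apply: punctured_constant => // [y y0|y i y0].
  exact: (smooth_on_diff sf).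
have rot := harmonic0_rotation sf hf lf.
have : \sum_(k < n.+1) y k 0 * (y k 0 * pd i f y) = 0.
  under eq_bigr => k _ do rewrite rot // mulrCA.
  by rewrite -mulr_sumr derive_radial0 // mulr0.
under eq_bigr do rewrite mulrA.
rewrite -mulr_suml -dotpE => /eqP; rewrite mulf_eq0 dotp_eq0 (negbTE y0).
by move=> /eqP.
Qed.

(** The partial derivatives are harmonic of degree 0, hence constant, and Euler's identity rebuilds
    [f] from them. *)
Lemma harmonic1_linear f : (0 < n)%N -> smooth_on P f ->
  (forall (c : R) y, 0 < c -> y != 0 -> f (c *: y) = c * f y) ->
  (forall y, y != 0 -> lap f y = 0) ->
  exists a : 'cV[R]_n.+1, forall y, y != 0 -> f y = dotp a y.
Proof.
move=> n0 sf hf lf; have oP := @open_punctured R n.+1.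
pose e0 : 'cV[R]_n.+1 := delta_mx 0 0.
have e00 : e0 != 0 by rewrite -dotp_gt0 dotp_delta !mxE ltr01.
exists (\col_k pd k f e0) => y y0; rewrite dotpE -(derive_radial1 sf hf y0).
apply: eq_bigr => k _; rewrite mxE mulrC; congr (_ * _).
apply: (harmonic0_constant n0) => // [|c z c0 z0|z z0].
- exact: smooth_on_pd.
- by apply: (mulfI (lt0r_neq0 c0)); rewrite (pd_homogeneous _ sf c0 z0 (hf c ^~ c0)).
- rewrite (@lap_pd _ _ P) //.
  by rewrite (@pd_eq_on _ _ P _ (fun=> 0)) ?pd_cst.
Qed.

End Liouville.

(** * Curvature of the sphere *)

Section ScaledFields.
Context {R : realType} {V : normedModType R} {p : nat}.
Implicit Types (g : V -> R) (F : V -> 'cV[R]_p) (x v : V).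

Lemma differentiable_scaled g F x : differentiable g x -> differentiable F x ->
  differentiable (fun z => g z *: F z) x.
Proof.
move=> dg /differentiable_mxP dF; apply/differentiable_mxP => i j.
by under eq_fun do rewrite mxE; exact: differentiableM.
Qed.

Lemma derive_scaled g F x v : differentiable g x -> differentiable F x ->
  'L_v (fun z => g z *: F z) x = 'L_v g x *: F x + g x *: 'L_v F x.
Proof.
move=> dg dF; have dgF := differentiable_scaled dg dF.
have /differentiable_mxP dF' := dF.
apply/colP => i; rewrite derive_mxE // !mxE derive_mxE //.
under eq_fun do rewrite mxE; by rewrite deriveMf.
Qed.

End ScaledFields.

Lemma pullback_connE (R : realType) n (E : normedModType R) (f : E -> 'cV[R]_n.+1)
  X V u : pullback_conn f X V u = tangent_proj (f u) ('L_(X u) V u).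
Proof. by rewrite dirderE. Qed.

Lemma lie_bracketE (R : realType) n (X Y : 'cV[R]_n.+1 -> 'cV[R]_n.+1) y :
  lie_bracket X Y y = 'L_(X y) Y y - 'L_(Y y) X y.
Proof. by rewrite !dirderE. Qed.

Section TangentProjection.
Context {R : realType} {n : nat}.
Implicit Types (p q u v w y : 'cV[R]_n.+1).

Lemma tangent_projD p u v :
  tangent_proj p (u + v) = tangent_proj p u + tangent_proj p v.
Proof. by rewrite /tangent_proj dotpDr scalerDl opprD addrACA. Qed.

Lemma tangent_projZ p a u : tangent_proj p (a *: u) = a *: tangent_proj p u.
Proof. by rewrite /tangent_proj dotpZr scalerBr scalerA. Qed.

Lemma tangent_projN p u : tangent_proj p (- u) = - tangent_proj p u.
Proof. by rewrite -scaleN1r tangent_projZ scaleN1r. Qed.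

Lemma tangent_proj0 p : tangent_proj p 0 = 0.
Proof. by rewrite /tangent_proj dotp0r scale0r subr0. Qed.

Lemma tangent_proj_sum p (I : Type) (r : seq I) (P : pred I) (u : I -> 'cV[R]_n.+1) :
  tangent_proj p (\sum_(i <- r | P i) u i) = \sum_(i <- r | P i) tangent_proj p (u i).
Proof.
by apply: (big_morph (tangent_proj p)) => [x y|];
  [exact: tangent_projD|exact: tangent_proj0].
Qed.

Lemma tangent_proj_id p u : dotp p u = 0 -> tangent_proj p u = u.
Proof. by move=> pu; rewrite /tangent_proj pu scale0r subr0. Qed.

Lemma tangent_proj_self p : sphere p -> tangent_proj p p = 0.
Proof. by move=> pp; rewrite /tangent_proj pp scale1r subrr. Qed.

Lemma dotp_tangent_proj p u : sphere p -> dotp p (tangent_proj p u) = 0.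
Proof. by move=> pp; rewrite /tangent_proj dotpBr dotpZr pp mulr1 subrr. Qed.

Lemma differentiable_tangent_proj u y : differentiable (tangent_proj^~ u) y.
Proof.
apply: differentiableB; first exact: differentiable_cst.
by apply: differentiable_scaled => //; exact: differentiable_dotp.
Qed.

Lemma derive_tangent_proj u y v :
  'L_v (tangent_proj^~ u) y = - (dotp v u *: y + dotp y u *: v).
Proof.
have d1 : differentiable (fun z : 'cV[R]_n.+1 => dotp z u) y by exact: differentiable_dotp.
rewrite deriveBf ?derive_cstf ?sub0r //; last exact: differentiable_scaled.
rewrite derive_scaled // derive_dotp // derive_cstf dotp0r addr0.
by rewrite derive_idf.
Qed.

Let nablaE v w y : pullback_conn id (tangent_proj^~ v) (tangent_proj^~ w) y =
  tangent_proj y (- (dotp (tangent_proj y v) w *: y + dotp y w *: tangent_proj y v)).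
Proof. by rewrite pullback_connE derive_tangent_proj. Qed.

Let nabla2E p u v w : sphere p -> dotp p u = 0 -> dotp p v = 0 -> dotp p w = 0 ->
  pullback_conn id (tangent_proj^~ u)
    (pullback_conn id (tangent_proj^~ v) (tangent_proj^~ w)) p = - (dotp u w *: v).
Proof.
move=> pp pu pv pw; pose Y := tangent_proj^~ v.
(* [S] is minus the flat derivative of the extension of [w] along that of [v]; the covariant
   derivative is the tangential part of [- S], written out so that it can be differentiated once
   more. *)
pose S y := dotp (Y y) w *: y + dotp y w *: Y y.
have -> : pullback_conn id (tangent_proj^~ v) (tangent_proj^~ w) =
    (fun y => - S y + dotp y (S y) *: y).
  apply/funext => y; rewrite nablaE tangent_projN /tangent_proj opprB addrC.
  by rewrite -/(Y y) -/(S y).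
rewrite pullback_connE (tangent_proj_id pu).
have dY : differentiable Y p by exact: differentiable_tangent_proj.
have d1 : differentiable (fun y => dotp (Y y) w) p by exact: differentiable_dotp.
have d2 : differentiable (fun y => dotp y w) p by exact: differentiable_dotp.
have d3 : differentiable (fun y => dotp (Y y) w *: y) p by exact: differentiable_scaled.
have d4 : differentiable (fun y => dotp y w *: Y y) p by exact: differentiable_scaled.
have dS : differentiable S p by exact: differentiableD.
have d5 : differentiable (fun y => dotp y (S y)) p by exact: differentiable_dotp.
have Yp : Y p = v by rewrite /Y tangent_proj_id.
have DY : 'L_u Y p = - (dotp u v *: p).
  by rewrite derive_tangent_proj pv scale0r addr0.
have DS : 'L_u S p = dotp v w *: u + dotp u w *: v.
  rewrite deriveDf // !derive_scaled // !derive_dotp // !derive_cstf !dotp0r !addr0.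
  rewrite DY Yp !derive_idf dotpNl dotpZl pw mulr0 oppr0 scale0r add0r.
  by rewrite scale0r addr0.
have Sp : S p = dotp v w *: p by rewrite /S Yp pw scale0r addr0.
rewrite deriveDf; [|exact: differentiableN|exact: differentiable_scaled].
rewrite deriveNf // derive_scaled // DS derive_idf Sp dotpZr pp mulr1.
rewrite tangent_projD tangent_projN !tangent_projD !tangent_projZ.
rewrite tangent_proj_self // scaler0 add0r !tangent_proj_id //.
by rewrite opprD addrAC addNr add0r.
Qed.

(** Constant curvature one, in Milnor's sign. For the extensions by [tangent_proj] the Lie bracket
    vanishes at [p], since both of its terms are multiples of [p] with the same coefficient; only
    the two second derivatives remain. *)
Lemma sphere_curvatureE p u v w :
  sphere p -> dotp p u = 0 -> dotp p v = 0 -> dotp p w = 0 ->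
  sphere_curvature p u v w = dotp u w *: v - dotp v w *: u.
Proof.
move=> pp pu pv pw; rewrite /sphere_curvature !nabla2E // opprK.
suff -> : pullback_conn id (lie_bracket (tangent_proj^~ u) (tangent_proj^~ v))
    (tangent_proj^~ w) p = 0 by rewrite addr0.
rewrite pullback_connE lie_bracketE !derive_tangent_proj.
rewrite (tangent_proj_id pu) (tangent_proj_id pv) pu pv !scale0r !addr0.
rewrite [dotp v u]dotpC subrr.
by rewrite dotp0l scale0r add0r pw scaler0 oppr0 tangent_proj0.
Qed.

End TangentProjection.

(** * The Laplacian in an orthonormal frame *)

Section MatrixFields.
Context {R : realType} {V : normedModType R}.

Lemma differentiable_mulmx p q r (B : V -> 'M[R]_(p, q)) (C : V -> 'M[R]_(q, r)) x :
  differentiable B x -> differentiable C x ->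
  differentiable (fun z => B z *m C z) x.
Proof.
move=> /differentiable_mxP dB /differentiable_mxP dC.
apply/differentiable_mxP => i j.
have -> : (fun z => (B z *m C z) i j) = \sum_(k < q) (fun z => B z i k * C z k j).
  by apply/funext => z; rewrite mxE fct_sumE.
by apply: differentiable_sum => k; exact: differentiableM.
Qed.

Lemma derive_mulmx p q r (B : V -> 'M[R]_(p, q)) (C : V -> 'M[R]_(q, r)) x v :
  differentiable B x -> differentiable C x ->
  'L_v (fun z => B z *m C z) x = 'L_v B x *m C x + B x *m 'L_v C x.
Proof.
move=> dB dC; have dBC := differentiable_mulmx dB dC.
have /differentiable_mxP dB' := dB; have /differentiable_mxP dC' := dC.
apply/matrixP => i j; rewrite derive_mxE // !mxE -big_split /=.
have -> : (fun z => (B z *m C z) i j) = (fun z => \sum_(k < q) B z i k * C z k j).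
  by apply/funext => z; rewrite mxE.
rewrite derive_sumf => [|k]; last exact: differentiableM.
by apply: eq_bigr => k _; rewrite deriveMf // !derive_mxE.
Qed.

End MatrixFields.

Lemma christoffelE (R : realType) m (G : 'cV[R]_m -> 'M[R]_m) u k i j :
  christoffel G u k i j = 2^-1 * \sum_(l < m) invmx (G u) k l *
    ('L_(delta_mx i 0) G u j l + 'L_(delta_mx j 0) G u i l
     - 'L_(delta_mx l 0) G u i j).
Proof. by rewrite dirderE. Qed.

Section Frames.
Context {R : realType} {m : nat}.
Implicit Types (G : 'cV[R]_m -> 'M[R]_m) (g : 'cV[R]_m -> R) (u X Y Z : 'cV[R]_m).

Definition gamma G u X Y : 'cV[R]_m :=
  \col_k \sum_(a < m) \sum_(b < m) christoffel G u k a b * X a 0 * Y b 0.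

(** The covariant Hessian, with [X] and [Y] constant in the chart: no derivative of a vector field
    occurs, so it is visibly bilinear. *)
Definition hess G g u X Y : R := 'L_X ('L_Y g) u - 'L_(gamma G u X Y) g u.

(** With the frame as columns of [E], orthonormality is E^T G E = 1. A one-sided inverse of a square
    matrix is two-sided, so G E E^T = 1. *)
Lemma frame_unit (G : 'M[R]_m) (e : 'I_m -> 'cV[R]_m) :
  (forall a b, dotp (e a) (G *m e b) = (a == b)%:R) ->
  G \in unitmx /\ forall p q, \sum_(a < m) e a p 0 * e a q 0 = invmx G p q.
Proof.
move=> eG; pose E : 'M[R]_m := \matrix_(p, a) e a p 0.
have colE a : col a E = e a by apply/colP => p; rewrite !mxE.
have EGE : E^T *m (G *m E) = 1%:M.
  apply/matrixP => a b; rewrite [RHS]mxE -eG dotpE !mxE.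
  apply: eq_bigr => p _; rewrite !mxE; congr (_ * _).
  by apply: eq_bigr => q _; rewrite !mxE.
have GEE : G *m (E *m E^T) = 1%:M by rewrite mulmxA; exact: mulmx1C.
have [Gu _] := mulmx1_unit GEE; split=> // p q.
have -> : invmx G = E *m E^T by rewrite -[LHS]mulmx1 -GEE mulKmx.
by rewrite mxE; apply: eq_bigr => a _; rewrite !mxE.
Qed.

Lemma gammaE G u X Y : gamma G u X Y =
  \sum_(p < m) \sum_(q < m) (X p 0 * Y q 0) *: \col_k christoffel G u k p q.
Proof.
apply/colP => k; rewrite mxE summxE; apply: eq_bigr => p _.
by rewrite summxE; apply: eq_bigr => q _; rewrite !mxE -mulrA mulrC.
Qed.

(** The right-hand side does not mention the frame; this is what makes frames interchangeable. It
    follows by bilinearity, because the sum of e_a e_a^T is the inverse Gram matrix. *)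
Lemma hess_trace G (U : set 'cV[R]_m) g u (e : 'I_m -> 'cV[R]_m) :
  open U -> smooth_on U g -> U u ->
  (forall a b, dotp (e a) (G u *m e b) = (a == b)%:R) ->
  \sum_(a < m) hess G g u (e a) (e a) =
  \sum_(p < m) \sum_(q < m) invmx (G u) p q *
     hess G g u (delta_mx p 0) (delta_mx q 0).
Proof.
move=> oU sg Uu eG; have [_ einv] := frame_unit eG.
have dgu : differentiable g u by exact: smooth_on_diff Uu.
have dDgu v : differentiable ('L_v g) u.
  exact: smooth_on_diff (smooth_on_derive _ sg) Uu.
pose H p q := 'L_(delta_mx p 0) ('L_(delta_mx q 0) g) u
   - 'L_(\col_k christoffel G u k p q) g u.
have hE X Y : hess G g u X Y = \sum_(p < m) \sum_(q < m) X p 0 * Y q 0 * H p q.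
  rewrite /hess gammaE (derive_sumr _ _ _ dgu).
  under eq_bigr => p _.
    rewrite (derive_sumr _ _ _ dgu).
    under eq_bigr => q _ do rewrite (derive_scaler _ _ dgu).
    over.
  rewrite /=.
  have -> : 'L_X ('L_Y g) u =
      'L_X (fun z => \sum_(q < m) Y q 0 * 'L_(delta_mx q 0) g z) u.
    apply: derive_eq_on oU Uu _ => z Uz; rewrite derive_pd.
      by apply: eq_bigr => q _; rewrite pdE.
    exact: smooth_on_diff Uz.
  rewrite derive_sumf => [|q]; last first.
    by apply: differentiableM => //; exact: differentiable_cst.
  under [X in X - _]eq_bigr => q _.
    rewrite (deriveZf _ _ (dDgu _)) (derive_pd _ (dDgu _)).
    rewrite mulr_sumr; over.
  rewrite exchange_big /= -sumrB; apply: eq_bigr => p _.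
  rewrite -sumrB; apply: eq_bigr => q _; rewrite pdE /H mulrBr mulrCA mulrA.
  by congr (_ - _).
under eq_bigr => a _ do rewrite hE.
rewrite exchange_big; apply: eq_bigr => p _.
rewrite exchange_big; apply: eq_bigr => q _.
rewrite -mulr_suml einv; congr (_ * _).
rewrite hE (bigD1 p) //= (bigD1 q) //= !mxE !eqxx !mul1r.
rewrite big1 => [|q' q'q]; last by rewrite !mxE (negbTE q'q) mulr0 mul0r.
rewrite big1 ?addr0 // => p' p'p; rewrite big1 // => q' _.
by rewrite !mxE (negbTE p'p) !mul0r.
Qed.

(** Koszul's formula for constant fields. It determines [gamma] without the inverse Gram matrix, the
    convenient form for a change of coordinates. *)
Lemma gamma_koszul G u X Y Z : G u \in unitmx -> differentiable G u ->
  2 * dotp Z (G u *m gamma G u X Y) =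
  dotp Y ('L_X G u *m Z) + dotp X ('L_Y G u *m Z) - dotp X ('L_Z G u *m Y).
Proof.
move=> Gu dG; pose D a b l := 'L_(delta_mx a 0) G u b l.
have TE (X' Y' Z' : 'cV[R]_m) : dotp Y' ('L_X' G u *m Z') =
    \sum_a \sum_b \sum_l X' a 0 * Y' b 0 * Z' l 0 * D a b l.
  rewrite [X' in LHS]colvec_sum_delta (derive_sumr _ _ _ dG) mulmx_suml dotp_sumr.
  apply: eq_bigr => a _; rewrite (derive_scaler _ _ dG) -scalemxAl dotpZr.
  rewrite dotpE mulr_sumr; apply: eq_bigr => b _; rewrite mxE !mulr_sumr.
  by apply: eq_bigr => l _; rewrite -/(D a b l) -!mulrA [D _ _ _ * _]mulrC.
pose K a b l := D a b l + D b a l - D l a b.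
pose c : 'cV[R]_m := \col_l \sum_a \sum_b K a b l * X a 0 * Y b 0.
have -> : gamma G u X Y = 2^-1 *: (invmx (G u) *m c).
  apply/colP => k; rewrite !mxE mulr_sumr.
  have cE l : 2^-1 * (invmx (G u) k l * c l 0) =
      \sum_a \sum_b 2^-1 * (invmx (G u) k l * K a b l) * X a 0 * Y b 0.
    rewrite mxE !mulr_sumr; apply: eq_bigr => a _; rewrite !mulr_sumr.
    by apply: eq_bigr => b _; rewrite !mulrA.
  under [RHS]eq_bigr do rewrite cE.
  rewrite [RHS]exchange_big; apply: eq_bigr => a _.
  rewrite [RHS]exchange_big; apply: eq_bigr => b _.
  by rewrite christoffelE mulr_sumr !mulr_suml.
rewrite -scalemxAr mulKVmx // dotpZr mulrA divff ?pnatr_eq0 // mul1r.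
rewrite !TE [X in _ + X - _]exchange_big [X in _ - X]exchange_big /=.
under [X in _ - X]eq_bigr do rewrite exchange_big.
rewrite -!big_split /= dotpE.
under [LHS]eq_bigr do rewrite mxE mulr_sumr.
rewrite [LHS]exchange_big -sumrB; apply: eq_bigr => a _ /=.
under [LHS]eq_bigr do rewrite mulr_sumr.
rewrite [LHS]exchange_big -big_split -sumrB; apply: eq_bigr => b _ /=.
rewrite -big_split -sumrB; apply: eq_bigr => l _ /=.
rewrite /K; move: (D a b l) (D b a l) (D l a b) => d1 d2 d3.
by ring.
Qed.

(* The Laplace-Beltrami operator on functions read in a chart with Gram matrix
   [G], computed in the frame [e]. *)
Definition frame_lap G (e : 'I_m -> 'cV[R]_m -> 'cV[R]_m) g u : R :=
  \sum_(a < m) ('L_(e a u) (fun z => 'L_(e a z) g z) u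
    - 'L_('L_(e a u) (e a) u + gamma G u (e a u) (e a u)) g u).

Lemma derive_along_field (U : set 'cV[R]_m) g (X Y : 'cV[R]_m -> 'cV[R]_m) u :
  open U -> smooth_on U g -> U u -> differentiable Y u ->
  'L_(X u) (fun z => 'L_(Y z) g z) u = 'L_(X u) ('L_(Y u) g) u + 'L_('L_(X u) Y u) g u.
Proof.
move=> oU sg Uu dY; have /differentiable_mxP dY' := dY.
have dgu : differentiable g u by exact: smooth_on_diff Uu.
have dDgu v : differentiable ('L_v g) u.
  exact: smooth_on_diff (smooth_on_derive _ sg) Uu.
have dpd k : differentiable (pd k g) u by rewrite pdE.
rewrite (@derive_eq_on _ _ _ _ _ (fun z => \sum_k Y z k 0 * pd k g z) _ _ oU Uu); last first.
  by move=> z Uz; rewrite derive_pd //; exact: smooth_on_diff Uz.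
rewrite derive_sumf => [|k]; last exact: differentiableM.
rewrite [X in _ = X + _](@derive_eq_on _ _ _ _ _ (fun z => \sum_k Y u k 0 * pd k g z) _ _ oU Uu); last first.
  by move=> z Uz; rewrite derive_pd //; exact: smooth_on_diff Uz.
rewrite derive_sumf => [|k]; last first.
  by apply: differentiableM => //; exact: differentiable_cst.
rewrite (derive_pd _ dgu) -big_split; apply: eq_bigr => k _ /=.
by rewrite deriveMf // (deriveZf _ _ (dpd k)) derive_mxE // addrC.
Qed.

(** The derivative of the frame enters once through the iterated derivative and once through the
    connection, and cancels. *)
Lemma frame_lap_trace (U : set 'cV[R]_m) G e g u :
  open U -> smooth_on U g -> U u -> (forall a, differentiable (e a) u) ->
  (forall a b, dotp (e a u) (G u *m e b u) = (a == b)%:R) ->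
  frame_lap G e g u = \sum_(a < m) hess G g u (e a u) (e a u).
Proof.
move=> oU sg Uu de eG; apply: eq_bigr => a _.
have dgu : differentiable g u by exact: smooth_on_diff Uu.
rewrite (derive_along_field (e a) oU sg Uu (de a)) -[X in 'L_(X + _) g u]scale1r.
by rewrite (derive_linear _ _ _ dgu) scale1r opprD addrA addrK.
Qed.

End Frames.

(* [k] is a change of coordinates carrying the Gram matrix [G'] to [G]. *)
Section ChangeOfCoordinates.
Context {R : realType} {m : nat}.
Context (N N' : set 'cV[R]_m) (k : 'cV[R]_m -> 'cV[R]_m)
  (G G' : 'cV[R]_m -> 'M[R]_m).
Context (oN : open N) (oN' : open N') (kN : forall u, N u -> N' (k u))
  (sk : smooth_on N k) (sG : smooth_on N G) (sG' : smooth_on N' G')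
  (Gsym : forall u, N' u -> (G' u)^T = G' u)
  (Gunit : forall u, N u -> G u \in unitmx)
  (Gunit' : forall u, N' u -> G' u \in unitmx)
  (kG : forall u, N u -> forall X Y,
     dotp X (G u *m Y) = dotp ('L_X k u) (G' (k u) *m 'L_Y k u)).

Let S u X Y := 'L_X ('L_Y k) u.

Let dk u : N u -> differentiable k u.
Proof. exact: smooth_on_diff. Qed.

Let dDk u X : N u -> differentiable ('L_X k) u.
Proof. exact/smooth_on_diff/smooth_on_derive. Qed.

Let dG u : N u -> differentiable G u.
Proof. exact: smooth_on_diff. Qed.

Let dG' u : N u -> differentiable G' (k u).
Proof. by move=> Nu; apply: (smooth_on_diff sG'); exact: kN. Qed.

Let S_sym u X Y : N u -> S u X Y = S u Y X.
Proof.
move=> Nu; apply/colP => i; rewrite /S.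
rewrite (derive_mxE X i 0 (dDk Y Nu)) (derive_mxE Y i 0 (dDk X Nu)).
have ski := smooth_on_coord i 0 oN sk.
have H Z W : 'L_Z (fun y => ('L_W k) y i 0) u = 'L_Z ('L_W (fun y => k y i 0)) u.
  by apply: (derive_eq_on _ oN Nu) => z Nz; rewrite derive_mxE //; exact: dk.
by rewrite !H; exact: smooth_on_derive_comm ski Nu.
Qed.

(** This is the identity [kG] differentiated along [X]: one term for each of the two images of the
    constant fields, one for [G']. *)
Let GT u X Y Z : N u -> dotp Y ('L_X G u *m Z) =
  dotp (S u X Y) (G' (k u) *m 'L_Z k u)
  + dotp ('L_Y k u) ('L_('L_X k u) G' (k u) *m 'L_Z k u)
  + dotp ('L_Y k u) (G' (k u) *m S u X Z).
Proof.
move=> Nu.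
have dGZ : differentiable (fun z => G z *m Z) u.
  by apply: differentiable_mulmx; [exact: dG|exact: differentiable_cst].
have dG'k : differentiable (fun z => G' (k z)) u.
  by apply: differentiable_comp; [exact: dk|exact: dG'].
have dGZ' : differentiable (fun z => G' (k z) *m 'L_Z k z) u.
  by apply: differentiable_mulmx => //; exact: dDk.
have -> : dotp Y ('L_X G u *m Z) = 'L_X (fun z => dotp Y (G z *m Z)) u.
  rewrite (derive_dotp _ (differentiable_cst _ _) dGZ).
  rewrite derive_cstf dotp0l add0r (derive_mulmx _ (dG Nu) (differentiable_cst _ _)).
  by rewrite derive_cstf mulmx0 addr0.
rewrite (@derive_eq_on _ _ _ _ _ (fun z => dotp ('L_Y k z) (G' (k z) *m 'L_Z k z)) _ _ oN Nu); last first.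
  by move=> z Nz; exact: kG.
rewrite derive_dotp //; last exact: dDk.
rewrite derive_mulmx //; last exact: dDk.
rewrite dotpDr addrA (derive_comp _ (dk Nu) (dG' Nu)).
by [].
Qed.

(** The transformation law of the Christoffel symbols. Koszul's formula on both sides shows that the
    discrepancy [W] is [G']-orthogonal to the image of the differential of [k]; the second
    derivatives of [k] combine by their symmetry. Invertibility of that differential and of [G']
    gives [W = 0]. *)
Lemma gamma_change u X Y : N u ->
  'L_(gamma G u X Y) k u = S u X Y + gamma G' (k u) ('L_X k u) ('L_Y k u).
Proof.
move=> Nu; apply/eqP; rewrite -subr_eq0; apply/eqP.
set W := _ - _.
have G'u : G' (k u) \in unitmx by apply: Gunit'; exact: kN.
pose J : 'M[R]_m := \matrix_(p, q) 'L_(delta_mx q 0) k u p 0.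
have JE Z : 'L_Z k u = J *m Z.
  rewrite [Z in LHS]colvec_sum_delta (derive_sumr _ _ _ (dk Nu)).
  apply/colP => p; rewrite summxE mxE; apply: eq_bigr => q _.
  by rewrite (derive_scaler _ _ (dk Nu)) !mxE mulrC.
(* The Jacobian is square and J^T G' J = G is invertible, hence so is each factor. *)
have Ju : J^T \in unitmx.
  have GJ : G u = J^T *m (G' (k u) *m J).
    apply/matrixP => p q.
    have E (A : 'M[R]_m) : A p q = dotp (delta_mx p 0) (A *m delta_mx q 0).
      by rewrite dotp_delta -colE mxE.
    rewrite !E (kG Nu) !JE -mulmxA [RHS]dotp_mulmx trmxK.
    by rewrite !mulmxA.
  by have := Gunit Nu; rewrite GJ unitmx_mul => /andP[].
have sym Z1 Z2 : dotp Z1 (G' (k u) *m Z2) = dotp Z2 (G' (k u) *m Z1).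
  by rewrite dotp_mulmx Gsym; [exact: dotpC|exact: kN].
have H Z : dotp ('L_Z k u) (G' (k u) *m W) = 0.
  have := gamma_koszul X Y Z (Gunit Nu) (dG Nu).
  rewrite kG // !GT //.
  have K := gamma_koszul ('L_X k u) ('L_Y k u) ('L_Z k u) G'u (dG' Nu).
  move=> H; rewrite /W mulmxBr mulmxDr dotpBr dotpDr.
  rewrite (S_sym Y X) // (S_sym Z X) // (S_sym Z Y) // in H.
  rewrite (sym (S u X Y)) (sym ('L_Y k u)) (sym ('L_X k u) (S u Y Z)) in H.
  rewrite (sym (S u X Z) ('L_Y k u)) in H.
  move: H K.
  set a1 := dotp _ (G' (k u) *m 'L_(gamma _ _ _ _) k u).
  set a2 := dotp _ (_ *m gamma _ _ _ _).
  set a3 := dotp _ (G' (k u) *m S u X Y).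
  move=> H K; lra.
have : G' (k u) *m W = 0.
  have : J^T *m (G' (k u) *m W) = 0.
    apply: dotp_inj => Z; rewrite dotp0l dotpC dotp_mulmx trmxK -JE; exact: H.
  by move=> /(congr1 (mulmx (invmx J^T))); rewrite mulKmx // mulmx0.
by move=> /(congr1 (mulmx (invmx (G' (k u))))); rewrite mulKmx // mulmx0.
Qed.

(** The second derivatives of [k] produced by the chain rule are exactly the inhomogeneous term in
    [gamma_change]. *)
Lemma hess_change g u X Y : smooth_on N' g -> N u ->
  hess G (g \o k) u X Y = hess G' g (k u) ('L_X k u) ('L_Y k u).
Proof.
move=> sg Nu.
have dg z : N z -> differentiable g (k z).
  by move=> Nz; apply: (smooth_on_diff sg); exact: kN.
have dpd i : differentiable (pd i g) (k u).
  by rewrite pdE; apply: (smooth_on_diff (smooth_on_derive _ sg)); exact: kN.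
have dpdk i : differentiable (fun z => pd i g (k z)) u.
  by apply: differentiable_comp => //; exact: dk.
have /differentiable_mxP dDY := dDk Y Nu.
rewrite /hess (derive_comp _ (dk Nu) (dg _ Nu)) gamma_change //.
rewrite -[X in 'L_(X + _) g (k u)]scale1r (derive_linear _ _ _ (dg _ Nu)) scale1r.
rewrite opprD addrA; congr (_ - _).
rewrite (@derive_eq_on _ _ _ _ _ (fun z => \sum_i 'L_Y k z i 0 * pd i g (k z)) _ _ oN Nu); last first.
  move=> z Nz; rewrite (derive_comp _ (dk Nz) (dg _ Nz)) derive_pd //; exact: dg.
rewrite derive_sumf => [|i]; last exact: differentiableM.
rewrite (derive_pd _ (dg _ Nu)) -sumrB.
rewrite (@derive_eq_on _ _ _ _ _ (fun z => \sum_i 'L_Y k u i 0 * pd i g z) _ _ oN' (kN Nu)); last first.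
  by move=> z Nz; rewrite derive_pd //; exact: smooth_on_diff Nz.
rewrite derive_sumf => [|i]; last first.
  by apply: differentiableM => //; exact: differentiable_cst.
apply: eq_bigr => i _; rewrite deriveMf // (deriveZf _ _ (dpd i)).
rewrite -derive_mxE; last exact: dDk.
rewrite addrAC subrr add0r; congr (_ * _).
by rewrite (derive_comp _ (dk Nu) (dpd i)).
Qed.

End ChangeOfCoordinates.

Lemma unitmx_inj (F : fieldType) m (A : 'M[F]_m) :
  (forall X : 'cV[F]_m, A *m X = 0 -> X = 0) -> A \in unitmx.
Proof.
move=> Ainj; rewrite -unitmx_tr -row_free_unit; apply: inj_row_free => v vA.
apply: (can_inj trmxK); rewrite trmx0; apply: Ainj.
by rewrite -[A]trmxK -trmx_mul vA trmx0.
Qed.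

Lemma smooth_on_derive_field {R : realType} {m : nat} (U : set 'cV[R]_m)
    (g : 'cV[R]_m -> R) (Y : 'cV[R]_m -> 'cV[R]_m) :
  open U -> smooth_on U g -> smooth_on U Y -> smooth_on U (fun z => 'L_(Y z) g z).
Proof.
move=> oU sg sY.
apply: (@smooth_on_eq _ _ _ U (fun z => \sum_k Y z k 0 * pd k g z)) => //.
  by move=> z Uz; rewrite derive_pd //; exact: smooth_on_diff Uz.
apply: smooth_on_sum => // k; apply: smooth_on_mul => //.
  exact: smooth_on_coord.
exact: smooth_on_pd.
Qed.

(** * Independence of the Laplacian from chart and frame *)

Section ManifoldLaplacian.
Context {R : realType} {m : nat} (M : riemannianManifold R m).
Implicit Types (x : M) (i j : rm_chart M).

Lemma gram_unit i u : rm_cod i u -> rm_gram i u \in unitmx.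
Proof.
move=> cu; apply: unitmx_inj => X GX; apply/eqP; apply/negP => /negP X0.
by have := rm_gram_pos cu X0; rewrite GX dotp0r ltxx.
Qed.

Lemma overlap_open i j : open (rm_cod i `&` rm_param i @^-1` rm_dom j).
Proof.
rewrite openE => u [cu du]; apply: filterI.
  by apply: open_nbhs_nbhs; split=> //; exact: rm_cod_open.
have := @rm_param_continuous _ _ M i.
rewrite continuous_open_subspace; last exact: rm_cod_open.
move=> /(_ u (mem_set cu)); apply; apply: open_nbhs_nbhs; split=> //.
exact: rm_dom_open.
Qed.

Lemma orthonormal_frame_gram x i U e : orthonormal_frame_at x i U e ->
  forall a b, dotp (e a (rm_coord i x)) (rm_gram i (rm_coord i x) *m e b (rm_coord i x))
    = (a == b)%:R.
Proof. by case=> _ _ Ux _; apply. Qed.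

(** The change of chart carries [e] to a basis orthonormal for the second Gram matrix; the trace
    over it equals the trace over [e'], as both are the contraction with the inverse Gram matrix. It
    is needed because the tension field is given through some frame, while other identities come
    with a frame of their own. *)
Lemma frame_lap_invariant (h : M -> R) x i U e j U' e' :
  (forall i, smooth_on (rm_cod i) (h \o rm_param i)) ->
  orthonormal_frame_at x i U e -> orthonormal_frame_at x j U' e' ->
  frame_lap (rm_gram i) e (h \o rm_param i) (rm_coord i x) =
  frame_lap (rm_gram j) e' (h \o rm_param j) (rm_coord j x).
Proof.
move=> sh fe fe'.
have [dix [oU Ucod] Ux se ee] := fe; have [djx [oU' Ucod'] Ux' se' ee'] := fe'.
set u := rm_coord i x; set u' := rm_coord j x.
have cu : rm_cod i u by exact: rm_coord_cod.
have cu' : rm_cod j u' by exact: rm_coord_cod.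
pose k := rm_coord j \o rm_param i.
pose N := rm_cod i `&` rm_param i @^-1` rm_dom j.
have oN : open N by exact: overlap_open.
have ku : k u = u' by rewrite /k /= rm_coordK.
have Nu : N u by split=> //=; rewrite rm_coordK.
have kN z : N z -> rm_cod j (k z) by case=> _; exact: rm_coord_cod.
have sk : smooth_on N k by exact: rm_transition_smooth.
have sGi : smooth_on N (rm_gram i).
  by apply: smooth_onW (@rm_gram_smooth _ _ M i) => z [].
have sGj := @rm_gram_smooth _ _ M j.
have kG z : N z -> forall X Y, dotp X (rm_gram i z *m Y) =
    dotp ('L_X k z) (rm_gram j (k z) *m 'L_Y k z).
  by move=> [cz dz] X Y; rewrite (rm_gram_transition cz dz) dirderE.
have oi := @rm_cod_open _ _ M i; have oj := @rm_cod_open _ _ M j.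
have Ge := orthonormal_frame_gram fe; have Ge' := orthonormal_frame_gram fe'.
rewrite (frame_lap_trace oi (sh i) cu) //; last first.
  by move=> a; exact: smooth_on_diff (se a) Ux.
rewrite (frame_lap_trace oj (sh j) cu') //; last first.
  by move=> a; exact: smooth_on_diff (se' a) Ux'.
rewrite (hess_trace oj (sh j) cu') //.
have Gk a b : dotp ('L_(e a u) k u) (rm_gram j u' *m 'L_(e b u) k u) = (a == b)%:R.
  by rewrite -ku -kG // Ge.
rewrite -(hess_trace oj (sh j) cu' Gk); apply: eq_bigr => a _.
rewrite -[X in hess (rm_gram j) _ X]ku.
rewrite -(hess_change oN oj kN sk sGi sGj _ _ _ kG) //.
- have E z : N z -> (h \o rm_param i) z = ((h \o rm_param j) \o k) z.
    by move=> [cz dz]; rewrite /k /= rm_coordK.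
  rewrite /hess; congr (_ - _); last exact: derive_eq_on E.
  by apply: (derive_eq_on _ oN Nu) => z Nz; exact: derive_eq_on E.
- exact: rm_gram_sym.
- by move=> z [cz _]; exact: gram_unit.
- exact: gram_unit.
Qed.

End ManifoldLaplacian.

(** * The tension field as a tangential Laplacian *)

Section Tension.
Context {R : realType} {m n : nat} (M : riemannianManifold R m).
Implicit Types (x : M) (i j : rm_chart M) (phi : M -> 'cV[R]_n.+1).

Definition lap_along i (e : 'I_m -> 'cV[R]_m -> 'cV[R]_m) phi x : 'cV[R]_n.+1 :=
  \col_k frame_lap (rm_gram i) e ((fun y => phi y k 0) \o rm_param i) (rm_coord i x).

Lemma smooth_map_coord phi k i : smooth_map phi ->
  smooth_on (rm_cod i) ((fun y => phi y k 0) \o rm_param i).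
Proof.
by move=> /(_ i) sphi; apply: (smooth_on_coord k 0 _ sphi); exact: rm_cod_open.
Qed.

Lemma lap_alongE phi x i U e : smooth_map phi -> orthonormal_frame_at x i U e ->
  lap_along i e phi x = \sum_(a < m)
    ('L_(e a (rm_coord i x)) (fun z => 'L_(e a z) (phi \o rm_param i) z) (rm_coord i x)
     - 'L_(levi_civita i (e a) (e a) (rm_coord i x)) (phi \o rm_param i) (rm_coord i x)).
Proof.
move=> sphi [dx [oU Ucod] Ux se _].
have cu : rm_cod i (rm_coord i x) by exact: rm_coord_cod.
have dphi z : rm_cod i z -> differentiable (phi \o rm_param i) z.
  by move=> cz; exact: smooth_on_diff (sphi i) cz.
apply/colP => k; rewrite mxE summxE; apply: eq_bigr => a _.
have sk := smooth_onW Ucod (smooth_map_coord k sphi (i := i)).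
rewrite !mxE; congr (_ - _); last first.
  by rewrite derive_mxE ?/levi_civita ?dirderE //; exact: dphi.
have Ez l z : U z -> 'L_(e a z) (phi \o rm_param i) z l 0 =
    'L_(e a z) ((fun y => phi y l 0) \o rm_param i) z.
  by move=> Uz; rewrite derive_mxE //; exact/dphi/Ucod.
rewrite derive_mxE.
  by apply: (derive_eq_on _ oU Ux) => z Uz; rewrite Ez.
apply/differentiable_mxP => l l'; rewrite ord1.
have sl := smooth_onW Ucod (smooth_map_coord l sphi (i := i)).
apply: (differentiable_eq_on oU Ux (fun z Uz => esym (Ez l z Uz))).
exact: smooth_on_diff (smooth_on_derive_field oU sl (se a)) Ux.
Qed.

Lemma derive_sphere_tangent phi i u X : smooth_to_sphere phi -> rm_cod i u ->
  dotp (phi (rm_param i u)) ('L_X (phi \o rm_param i) u) = 0.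
Proof.
move=> [sphi phis] cu.
have dphi : differentiable (phi \o rm_param i) u by exact: smooth_on_diff (sphi i) cu.
have : 'L_X (fun z => dotp ((phi \o rm_param i) z) ((phi \o rm_param i) z)) u = 0.
  have -> : (fun z => dotp ((phi \o rm_param i) z) ((phi \o rm_param i) z)) = fun=> 1.
    by apply/funext => z; exact: phis.
  exact: derive_cstf.
rewrite derive_dotp // dotpC -mulr2n => /eqP; rewrite mulrn_eq0 /= => /eqP.
by [].
Qed.

(** The pull-back connection projects the flat second derivatives, and the first-order term of the
    tension field is already tangent. So the tension field is the tangential part of the Euclidean
    Laplacian of [phi], in any frame. *)
Lemma tension_lap_along phi x i U e : smooth_to_sphere phi -> tension_is phi x 0 ->
  orthonormal_frame_at x i U e -> tangent_proj (phi x) (lap_along i e phi x) = 0.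
Proof.
move=> sphi [j [U' [e' [fe' T]]]] fe.
have -> : lap_along i e phi x = lap_along j e' phi x.
  apply/colP => k; rewrite !mxE; apply: frame_lap_invariant fe fe' => l.
  by apply: smooth_map_coord; case: sphi.
have [dx _ _ _ _] := fe'; have cu : rm_cod j (rm_coord j x) by exact: rm_coord_cod.
rewrite T (lap_alongE _ fe'); last by case: sphi.
rewrite tangent_proj_sum; apply: eq_bigr => a _.
rewrite tangent_projD tangent_projN.
have px : phi (rm_param j (rm_coord j x)) = phi x by rewrite rm_coordK.
congr (_ - _).
  by rewrite pullback_connE dirderE /= px.
rewrite tangent_proj_id; first by rewrite dirderE.
by rewrite -[X in dotp X _]px derive_sphere_tangent.
Qed.

End Tension.

(** * Harmonic morphisms onto the sphere *)

Section Composition.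
Context {R : realType} {m n : nat} (M : riemannianManifold R m).
Implicit Types (x : M) (i j : rm_chart M) (phi : M -> 'cV[R]_n.+1).

Lemma frame_expansion (G : 'M[R]_m) (e : 'I_m -> 'cV[R]_m) Z :
  (forall a b, dotp (e a) (G *m e b) = (a == b)%:R) ->
  Z = \sum_(a < m) dotp (e a) (G *m Z) *: e a.
Proof.
move=> eG; have [Gu einv] := frame_unit eG.
rewrite -{1}(mulKmx Gu Z); apply/colP => p; rewrite mxE summxE.
under eq_bigr do rewrite -einv mulr_suml.
rewrite exchange_big; apply: eq_bigr => a _ /=.
rewrite mxE dotpE mulr_suml; apply: eq_bigr => q _.
by rewrite [RHS]mulrC mulrA.
Qed.

Lemma orthonormal_frame_move x i U e u : orthonormal_frame_at x i U e -> U u ->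
  orthonormal_frame_at (rm_param i u) i U e.
Proof.
move=> [dx [oU Ucod] Ux se ee] Uu; have cu := Ucod _ Uu.
by split=> //; [exact: rm_param_dom|rewrite rm_paramK].
Qed.

(* The map [v |-> \sum_a <v, d phi (e_a)> e_a] is, up to the square of the
   dilation, the horizontal lift. *)
Lemma frame_dilation phi x i U e : (0 < n)%N -> smooth_to_sphere phi ->
  submersive phi -> horizontally_weakly_conformal phi ->
  orthonormal_frame_at x i U e ->
  exists2 l2 : R, 0 < l2 & forall v,
    \sum_(a < m) dotp ('L_(e a (rm_coord i x)) (phi \o rm_param i) (rm_coord i x)) v *:
       'L_(e a (rm_coord i x)) (phi \o rm_param i) (rm_coord i x) =
    l2 *: tangent_proj (phi x) v.
Proof.
move=> n0 sphi sub hwc fe; have Ge := orthonormal_frame_gram fe.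
have [dx [oU Ucod] Ux se _] := fe.
set u := rm_coord i x in Ge Ux *; set f := phi \o rm_param i.
have cu : rm_cod i u by exact: rm_coord_cod.
have px : f u = phi x by rewrite /f /= rm_coordK.
have spx : sphere (phi x) by exact: sphi.2.
have df : differentiable f u by exact: smooth_on_diff (sphi.1 i) cu.
have tan X : dotp (phi x) ('L_X f u) = 0.
  by rewrite -px; exact: derive_sphere_tangent.
have diffE X : differential phi i x X = 'L_X f u by rewrite /differential dirderE.
have lin v : 'L_(\sum_(a < m) dotp ('L_(e a u) f u) v *: e a u) f u =
    \sum_(a < m) dotp ('L_(e a u) f u) v *: 'L_(e a u) f u.
  rewrite (derive_sumr _ _ _ df); apply: eq_bigr => a _.
  by rewrite (derive_scaler _ _ df).
have [[[l l0 conf] lift]|zero] := hwc i x dx; last first.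
  (* A zero differential contradicts submersivity because the tangent space is not zero: otherwise
     p_j p_k would be 1 for j = k and 0 for j, k distinct, impossible with the two indices 0 and
     [ord_max]. *)
  have [j pj] : exists j : 'I_n.+1, tangent_proj (phi x) (delta_mx j 0) != 0.
    apply/existsP; rewrite -negb_forall; apply/negP => /forallP H.
    have p2 (j k : 'I_n.+1) : (j == k)%:R = phi x j 0 * phi x k 0.
      have /eqP/subr0_eq/colP/(_ k) := H j.
      by rewrite dotpC dotp_delta !mxE eqxx andbT eq_sym.
    have := p2 0 ord_max; have := p2 0 0; have := p2 ord_max ord_max.
    rewrite !eqxx (_ : (0 == ord_max :> 'I_n.+1) = false); last first.
      by apply/eqP => /(congr1 val) /= n00; move: n0; rewrite -n00.
    move=> /= /esym pn /esym p0 /esym pn0.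
    have : (phi x 0 0 * phi x ord_max 0) ^+ 2 = 1.
      by rewrite exprMn !expr2 p0 pn mulr1.
    by rewrite pn0 expr0n /= => /eqP; rewrite eq_sym oner_eq0.
  have [X dX] := sub i x dx _ (dotp_tangent_proj (delta_mx j 0) spx).
  by move: pj; rewrite -dX zero eqxx.
exists (l ^+ 2) => [|v]; first by rewrite exprn_gt0.
rewrite -lin; set X := \sum_(a < m) _.
(* [X] is the metric dual of the linear form Z -> <d phi (Z), v>. It is thus orthogonal to the
   kernel of d phi, and conformality applies to it. *)
have metX Z : metric i u X Z = dotp ('L_Z f u) v.
  rewrite /metric /X dotp_suml [in RHS](frame_expansion Z Ge).
  rewrite (derive_sumr _ _ _ df) dotp_suml; apply: eq_bigr => a _.
  by rewrite (derive_scaler _ _ df) !dotpZl mulrC.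
have hX : horizontal phi i x X.
  by move=> Z; rewrite diffE => Z0; rewrite metX Z0 dotp0l.
have key w : dotp (phi x) w = 0 ->
    dotp ('L_X f u) w = l ^+ 2 * dotp v w.
  move=> wt; have [Y hY] := lift w wt; rewrite diffE => <-.
  have := conf X Y hX hY; rewrite !diffE => ->.
  by rewrite metX [dotp v _]dotpC.
apply: dotp_inj => w.
have wE : w = dotp (phi x) w *: phi x + tangent_proj (phi x) w.
  by rewrite /tangent_proj addrC subrK.
have -> : dotp ('L_X f u) w = dotp ('L_X f u) (tangent_proj (phi x) w).
  by rewrite {1}wE dotpDr dotpZr [dotp _ (phi x)]dotpC tan mulr0 add0r.
rewrite key ?dotp_tangent_proj // dotpZl; congr (_ * _).
rewrite /tangent_proj dotpBr dotpBl dotpZr dotpZl [dotp v (phi x)]dotpC.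
by rewrite [dotp (phi x) w * _]mulrC.
Qed.

Lemma dilation_coord (eta : 'I_m -> 'cV[R]_n.+1) p (l2 : R) :
  (forall v, \sum_(a < m) dotp (eta a) v *: eta a = l2 *: tangent_proj p v) ->
  forall k l, \sum_(a < m) eta a k 0 * eta a l 0 = l2 * ((k == l)%:R - p k 0 * p l 0).
Proof.
move=> E k l; have /colP/(_ l) := E (delta_mx k 0).
rewrite summxE /tangent_proj !mxE dotpC dotp_delta eqxx andbT eq_sym => <-.
by apply: eq_bigr => a _; rewrite mxE dotpC dotp_delta.
Qed.

Lemma dilation_trace (p : 'cV[R]_n.+1) (l2 : R) : sphere p ->
  \sum_(k < n.+1) l2 * ((k == k)%:R - p k 0 * p k 0) = n%:R * l2.
Proof.
move=> pp; rewrite -mulr_sumr sumrB -dotpE pp.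
under eq_bigr do rewrite eqxx.
by rewrite sumr_const card_ord -natr1 addrK mulrC.
Qed.

(** Differentiate <phi, d phi (e_a)> = 0 once more along e_a; the first-order term of the Laplacian
    is tangent. *)
Lemma lap_along_normal phi x i U e : smooth_to_sphere phi ->
  orthonormal_frame_at x i U e ->
  dotp (phi x) (lap_along i e phi x) =
  - \sum_(a < m) dotp ('L_(e a (rm_coord i x)) (phi \o rm_param i) (rm_coord i x))
                     ('L_(e a (rm_coord i x)) (phi \o rm_param i) (rm_coord i x)).
Proof.
move=> sphi fe; rewrite (lap_alongE sphi.1 fe) dotp_sumr -sumrN.
have [dx [oU Ucod] Ux se _] := fe.
set u := rm_coord i x in Ux *; set f := phi \o rm_param i.
have cu : rm_cod i u by exact: rm_coord_cod.
have px : f u = phi x by rewrite /f /= rm_coordK.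
have df : differentiable f u by exact: smooth_on_diff (sphi.1 i) cu.
apply: eq_bigr => a _; rewrite dotpBr -px.
have tan z X : U z -> dotp (f z) ('L_X f z) = 0.
  by move=> /Ucod cz; exact: derive_sphere_tangent.
rewrite tan // subr0.
have dE : differentiable (fun z => 'L_(e a z) f z) u.
  apply/differentiable_mxP => k k'; rewrite ord1.
  have sk := smooth_onW Ucod (smooth_map_coord k sphi.1 (i := i)).
  apply: (differentiable_eq_on oU Ux _
    (smooth_on_diff (smooth_on_derive_field oU sk (se a)) Ux)).
  by move=> z Uz; rewrite derive_mxE //; exact: smooth_on_diff (sphi.1 i) (Ucod _ Uz).
have := derive_dotp (e a u) df dE.
rewrite (@derive_eq_on _ _ _ U _ (fun=> 0) u _ oU Ux) => [|z Uz]; last exact: tan.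
by rewrite derive_cstf addrC => /esym/eqP; rewrite addr_eq0 => /eqP.
Qed.

(** Only the normal part survives, and its coefficient is - |d phi|^2, where |d phi|^2 = n [l2]
    since the tangent space has dimension n. *)
Lemma harmonic_lap_along phi x i U e (l2 : R) : smooth_to_sphere phi ->
  tension_is phi x 0 -> orthonormal_frame_at x i U e ->
  (forall k l,
    \sum_(a < m) 'L_(e a (rm_coord i x)) (phi \o rm_param i) (rm_coord i x) k 0 *
       'L_(e a (rm_coord i x)) (phi \o rm_param i) (rm_coord i x) l 0 =
    l2 * ((k == l)%:R - phi x k 0 * phi x l 0)) ->
  lap_along i e phi x = - (n%:R * l2) *: phi x.
Proof.
move=> sphi T fe E; have /eqP := tension_lap_along sphi T fe.
rewrite subr_eq0 => /eqP ->; rewrite (lap_along_normal sphi fe); congr (- _ *: _).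
under eq_bigr do rewrite dotpE.
rewrite exchange_big -(dilation_trace l2 (sphi.2 x)); apply: eq_bigr => k _.
exact: E.
Qed.

(** The composition formula: the gradient of [g] paired with the Laplacian of [phi], plus the
    Hessian of [g] traced over the images of the frame. *)
Lemma frame_lap_comp phi x i U e (g : 'cV[R]_n.+1 -> R) (W : set 'cV[R]_n.+1) :
  smooth_to_sphere phi -> orthonormal_frame_at x i U e -> open W ->
  W (phi x) -> smooth_on W g ->
  frame_lap (rm_gram i) e (fun z => g (phi (rm_param i z))) (rm_coord i x) =
  \sum_(k < n.+1) lap_along i e phi x k 0 * pd k g (phi x) +
  \sum_(k < n.+1) \sum_(l < n.+1)
   (\sum_(a < m) 'L_(e a (rm_coord i x)) (phi \o rm_param i) (rm_coord i x) k 0 *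
       'L_(e a (rm_coord i x)) (phi \o rm_param i) (rm_coord i x) l 0) *
    pd l (pd k g) (phi x).
Proof.
move=> sphi fe oW Wx sg; have [dx [oU Ucod] Ux se _] := fe.
set u := rm_coord i x in Ux *; pose f := phi \o rm_param i.
have cu : rm_cod i u by exact: rm_coord_cod.
have px : f u = phi x by rewrite /f /= rm_coordK.
have df z : U z -> differentiable f z.
  by move=> Uz; exact: smooth_on_diff (sphi.1 i) (Ucod _ Uz).
have [N [oN Nu NU NW]] : exists N : set 'cV[R]_m, [/\ open N, N u,
    (forall z, N z -> U z) & forall z, N z -> W (f z)].
  have : nbhs u (U `&` f @^-1` W).
    apply: filterI; first exact: open_nbhs_nbhs.
    apply: (differentiable_continuous (df u Ux)); apply: open_nbhs_nbhs.
    by split=> //; rewrite px.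
  rewrite nbhsE => -[N [oN Nu] NUW]; exists N; split=> // z Nz.
    by have [] := NUW z Nz.
  by have [] := NUW z Nz.
have dg z : N z -> differentiable g (f z) by move=> /NW; exact: smooth_on_diff.
have dpd k : differentiable (pd k g) (f u).
  by apply: smooth_on_diff (smooth_on_pd k sg) _; exact: NW.
have dpdf k : differentiable (fun z => pd k g (f z)) u.
  by apply: differentiable_comp => //; exact: df.
pose fk k := (fun y => phi y k 0) \o rm_param i.
have sfk k : smooth_on U (fk k) by exact: smooth_onW (smooth_map_coord k sphi.1 (i := i)).
have dEk a k : differentiable (fun z => 'L_(e a z) (fk k) z) u.
  exact: smooth_on_diff (smooth_on_derive_field oU (sfk k) (se a)) Ux.
have fkE k v : 'L_v (fk k) u = 'L_v f u k 0 by rewrite derive_mxE //; exact: df.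
under eq_bigr do rewrite mxE mulr_suml.
rewrite exchange_big /=.
under [X in _ + X]eq_bigr do (under eq_bigr do rewrite mulr_suml; rewrite exchange_big).
rewrite [X in _ + X]exchange_big -big_split /=; apply: eq_bigr => a _.
set w := 'L_(e a u) (e a) u + _.
rewrite (@derive_eq_on _ _ _ N _
  (fun z => \sum_k 'L_(e a z) (fk k) z * pd k g (f z)) u _ oN Nu); last first.
  by move=> z Nz; rewrite (derive_comp_pd _ (df z (NU z Nz)) (dg z Nz)).
rewrite (derive_comp_pd _ (df u Ux) (dg u Nu)).
rewrite derive_sumf => [|k]; last exact: differentiableM.
rewrite -sumrB -big_split /=; apply: eq_bigr => k _.
rewrite deriveMf // (derive_comp_pd _ (df u Ux) (dpd k)) -px -/(fk k).
rewrite fkE mulrBl addrAC; congr (_ + _).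
rewrite mulr_sumr; apply: eq_bigr => l _; rewrite mulrA -/(fk l) fkE.
by [].
Qed.

End Composition.

(** Homogeneity of degree [d] in the infinitesimal form in which the Laplacian of a composite
    consumes it. *)
Definition euler {R : realType} {n : nat} (d : R) (g : 'cV[R]_n.+1 -> R) :=
  forall y : 'cV[R]_n.+1, y != 0 -> \sum_(k < n.+1) y k 0 * pd k g y = d * g y.

Lemma euler_hessian {R : realType} {n : nat} (d : R) (g : 'cV[R]_n.+1 -> R)
  (y : 'cV[R]_n.+1) : smooth_on punctured g -> euler d g -> y != 0 ->
  \sum_(k < n.+1) \sum_(l < n.+1) y k 0 * y l 0 * pd l (pd k g) y = d * (d - 1) * g y.
Proof.
move=> sg eg y0; have oP := @open_punctured R n.+1.
have sk k : smooth_on punctured (fun z : 'cV[R]_n.+1 => z k 0 * pd k g z).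
  by apply: smooth_on_mul => //; [exact: smooth_on_id_coord|exact: smooth_on_pd].
have E l : \sum_(k < n.+1) y k 0 * pd l (pd k g) y = (d - 1) * pd l g y.
  have := pd_eq_on l oP y0 eg; rewrite (@pd_sum _ _ _ punctured) //.
  rewrite (@pdZ _ _ punctured) //.
  have Ek k : pd l (fun z : 'cV[R]_n.+1 => z k 0 * pd k g z) y =
      (k == l)%:R * pd k g y + y k 0 * pd l (pd k g) y.
    rewrite (pdM l (smooth_on_id_coord k oP) (smooth_on_pd k sg) y0).
    by rewrite pd_coord.
  under [X in X = _ -> _]eq_bigr do rewrite Ek.
  rewrite big_split (bigD1 l) //= eqxx mul1r big1 => [|k kl]; last first.
    by rewrite (negbTE kl) mul0r.
  by rewrite addr0 mulrBl mul1r => <-; rewrite addrAC subrr add0r.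
rewrite exchange_big /=.
under eq_bigr => l _.
  under eq_bigr do rewrite [y _ 0 * y l 0]mulrC -mulrA.
  rewrite -mulr_sumr E mulrCA; over.
by rewrite -mulr_sumr eg // mulrA [_ * d]mulrC.
Qed.

Section HarmonicMorphism.
Context {R : realType} {m n : nat} (M : riemannianManifold R m).
Implicit Types (x : M) (i j : rm_chart M) (phi : M -> 'cV[R]_n.+1).

(** The factor next to [l2] is the Laplacian of the round sphere applied to the restriction of [g]:
    the Laplacian of [phi] contributes - n d, and removing the radial second derivative contributes
    - d (d - 1). *)
Lemma harmonic_morphism_lap phi x i U e (g : 'cV[R]_n.+1 -> R) (d l2 : R) :
  smooth_to_sphere phi -> tension_is phi x 0 -> orthonormal_frame_at x i U e ->
  (forall k l,
    \sum_(a < m) 'L_(e a (rm_coord i x)) (phi \o rm_param i) (rm_coord i x) k 0 *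
       'L_(e a (rm_coord i x)) (phi \o rm_param i) (rm_coord i x) l 0 =
    l2 * ((k == l)%:R - phi x k 0 * phi x l 0)) ->
  smooth_on punctured g -> euler d g ->
  frame_lap (rm_gram i) e (fun z => g (phi (rm_param i z))) (rm_coord i x) =
  l2 * (lap g (phi x) - d * (n%:R + d - 1) * g (phi x)).
Proof.
move=> sphi T fe E sg eg.
have p0 : phi x != 0 by rewrite -dotp_gt0 (sphi.2 x).
rewrite (frame_lap_comp sphi fe (@open_punctured R n.+1) p0 sg).
rewrite (harmonic_lap_along sphi T fe E).
under eq_bigr do rewrite mxE -mulrA.
rewrite -mulr_sumr eg //.
under [X in _ + X]eq_bigr do under eq_bigr do rewrite E -mulrA mulrBl.
have H : \sum_(k < n.+1) \sum_(l < n.+1)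
    l2 * ((k == l)%:R * pd l (pd k g) (phi x) -
          phi x k 0 * phi x l 0 * pd l (pd k g) (phi x)) =
    l2 * (lap g (phi x) - d * (d - 1) * g (phi x)).
  under eq_bigr do rewrite -mulr_sumr sumrB.
  rewrite -mulr_sumr sumrB (euler_hessian sg eg) // lapE; congr (_ * (_ - _)).
  apply: eq_bigr => k _; rewrite (bigD1 k) //= eqxx mul1r big1 ?addr0 // => l lk.
  by rewrite eq_sym (negbTE lk) mul0r.
rewrite [X in _ + X]H; move: (lap g (phi x)) (g (phi x)) => a b.
by ring.
Qed.

End HarmonicMorphism.

(** * Functions that factor through a submersion *)

Section LocalSurjectivity.
Context {R : realType} {p : nat}.
Implicit Types (y z v w : 'cV[R]_p).

Lemma sqnorm_le_dotp w : `|w| ^+ 2 <= dotp w w.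
Proof.
by rewrite -sqr_enorm lerXn2r ?nnegrE ?sqrtr_ge0 // norm_le_enorm.
Qed.

Lemma closed_ball_compact y (d : R) : compact [set z : 'cV[R]_p | `|z - y| <= d].
Proof.
apply: bounded_closed_compact_col.
  exists (d + `|y|); split; first exact: num_real.
  move=> N dN z /= zd; apply: le_trans (ltW dN).
  by rewrite -[z in `|z|](subrK y); apply: (le_trans (ler_normD _ _)); rewrite lerD2r.
apply: (@closed_comp _ _ (fun z : 'cV[R]_p => `|z - y|) [set r | r <= d]) => [z _|].
  apply: continuous_comp; last exact: norm_continuous.
  by apply: continuousB => //; exact: cst_continuous.
exact: closed_le.
Qed.

(* Minimise the distance to [y] over a ball: an interior minimum is a solution,
   since the derivative of [g] is close to the identity. *)
Lemma locally_onto (W : set 'cV[R]_p) (g : 'cV[R]_p -> 'cV[R]_p) y0 :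
  open W -> W y0 -> (forall k, smooth_on W (fun z => g z k 0)) ->
  (forall v, 'L_v g y0 = v) ->
  \forall d \near 0^'+, exists2 e : R, 0 < e & forall y, `|y - g y0| <= e ->
    exists z, [/\ `|z - y0| <= d, g z = y & `|z - y0| <= 2 * `|y - g y0|].
Proof.
move=> oW Wy0 sg g1.
have dg z : W z -> differentiable g z.
  by move=> Wz; apply/differentiable_mxP => k k'; rewrite ord1; exact: smooth_on_diff (sg k) Wz.
have inj : \forall z \near y0, `|z - y0| <= 2 * `|g z - g y0|.
  have half : 0 < 2^-1 :> R by rewrite invr_gt0.
  have := derive_eps (dg _ Wy0) half; rewrite (near_shift y0 0).
  apply: filterS => z /=; rewrite sub0r subrK g1 => H.
  have : `|z - y0| <= `|g z - g y0| + 2^-1 * `|z - y0|.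
    apply: le_trans (lerD (lexx _) H).
    rewrite -[`|g z - g y0 - _|]normrN opprB.
    by apply: le_trans (ler_normD _ _); rewrite [X in _ <= `|X|]addrC subrK.
  by move: `|z - y0| `|g z - g y0| => a b; lra.
have pos : \forall z \near y0, forall w, w != 0 -> 0 < dotp w ('L_w g z).
  (* The p^2 entries of the Jacobian minus the identity, each below [eta], change the quadratic form
     by at most p^2 [eta] |w|^2 < |w|^2 <= <w, w>. Hence the derivative stays positive definite near
     [y0]. *)
  pose eta : R := (p%:R ^+ 2 + 1)^-1.
  have eta0 : 0 < eta by rewrite invr_gt0 ltr_wpDl // sqr_ge0.
  have cont k l : \forall z \near y0,
      `|pd l (fun z => g z k 0) z - pd l (fun z => g z k 0) y0| < eta.
    have dpd := smooth_on_diff (smooth_on_pd l (sg k)) Wy0.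
    have /cvgrPdist_lt/(_ _ eta0) := differentiable_continuous dpd.
    by apply: filterS => z; rewrite distrC.
  have contA : \forall z \near y0, forall k l,
      `|pd l (fun z => g z k 0) z - pd l (fun z => g z k 0) y0| < eta.
    have /(_ (nbhs_filter y0)) := filter_forall _ (fun kl : 'I_p * 'I_p => cont kl.1 kl.2).
    by apply: filterS => z Hz k l; exact: (Hz (k, l)).
  have WN : \forall z \near y0, W z by exact: open_nbhs_nbhs.
  apply: filterS2 contA WN => z cz Wz w w0.
  have pd0 k l : pd l (fun z => g z k 0) y0 = (k == l)%:R.
    by rewrite pdE -(derive_mxE _ _ _ (dg _ Wy0)) g1 mxE eqxx andbT.
  have -> : dotp w ('L_w g z) = dotp w w + \sum_(k < p) \sum_(l < p)
     w k 0 * w l 0 * (pd l (fun z => g z k 0) z - pd l (fun z => g z k 0) y0).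
    rewrite !dotpE -big_split; apply: eq_bigr => k _ /=.
    rewrite (derive_mxE _ _ _ (dg _ Wz)) derive_pd; last exact: smooth_on_diff (sg k) Wz.
    have -> : w k 0 * w k 0 = \sum_(l < p) w k 0 * w l 0 * pd l (fun z => g z k 0) y0.
      rewrite (bigD1 k) //= pd0 eqxx mulr1 big1 ?addr0 // => l lk.
      by rewrite pd0 eq_sym (negbTE lk) mulr0.
    rewrite -big_split mulr_sumr; apply: eq_bigr => l _ /=.
    by rewrite -mulrDr addrC subrK mulrA.
  set Sm := \sum_(k < p) _.
  have w2 : 0 < `|w| ^+ 2 by rewrite exprn_gt0 // normr_gt0.
  have SmB : `|Sm| <= p%:R ^+ 2 * eta * `|w| ^+ 2.
    apply: (le_trans (ler_norm_sum _ _ _)).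
    apply: (@le_trans _ _ (\sum_(k < p) \sum_(l < p) eta * `|w| ^+ 2)).
      apply: ler_sum => k _; apply: (le_trans (ler_norm_sum _ _ _)).
      apply: ler_sum => l _; rewrite !normrM mulrC.
      rewrite expr2; apply: ler_pM; [exact: normr_ge0|by rewrite mulr_ge0|exact: ltW|].
      by apply: ler_pM => //; exact: coord_le_norm.
    under eq_bigr do rewrite sumr_const card_ord.
    rewrite sumr_const card_ord -mulrnA -[X in X <= _]mulr_natl natrM -expr2.
    by rewrite mulrA lexx.
  have pe : p%:R ^+ 2 * eta < 1.
    rewrite /eta ltr_pdivrMr ?ltr_wpDl ?sqr_ge0 // mul1r ltrDl //.
  have : `|Sm| < dotp w w.
    apply: le_lt_trans SmB _; apply: lt_le_trans (sqnorm_le_dotp w).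
    by rewrite gtr_pMl.
  rewrite ltr_norml => /andP[]; lra.
have WN : \forall z \near y0, W z by exact: open_nbhs_nbhs.
have : \forall z \near y0, [/\ W z, `|z - y0| <= 2 * `|g z - g y0|
    & forall w, w != 0 -> 0 < dotp w ('L_w g z)].
  by apply: filterS3 WN inj pos.
move=> /nbhs_ballP[r /= r0 rP].
near=> d.
have d0 : 0 < d by [].
have rD z : `|z - y0| <= d -> [/\ W z, `|z - y0| <= 2 * `|g z - g y0|
    & forall w, w != 0 -> 0 < dotp w ('L_w g z)].
  move=> zd; apply: rP; rewrite -ball_normE /= distrC.
  by apply: le_lt_trans zd _; near: d; exact: nbhs_right_lt.
pose P1 : R := p%:R + 1.
have P10 : 0 < P1 by rewrite ltr_wpDl.
(* On the boundary |z - y0| = d one has |g z - g y0| >= d / 2, so |g z - y| >= d / 2 - e >= d / 4 =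
   (p + 1) e. At [y0] the squared distance is at most p e^2, the factor p coming from the sup norm.
   As p < (p + 1)^2, the minimum is interior. *)
pose e := d / (4 * P1).
have e0 : 0 < e by rewrite divr_gt0 // mulr_gt0.
exists e => // y ye.
pose N z := dotp (g z - y) (g z - y).
pose K := [set z : 'cV[R]_p | `|z - y0| <= d].
have dN z : W z -> differentiable N z.
  by move=> Wz; apply: differentiable_dotp;
    apply: differentiableB; try exact: dg; exact: differentiable_cst.
have Ky0 : K y0 by rewrite /K /= subrr normr0 ltW.
have [||z] := @compact_EVT_min 'cV[R]_p R N K _ (@closed_ball_compact y0 d).
- by exists y0.
- apply: continuous_in_subspaceT => z; rewrite inE => Kz.
  by apply: differentiable_continuous; apply: dN; case: (rD z Kz).
rewrite inE => Kz zmin; have [Wz zinj zpos] := rD z Kz.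
exists z.
have zy0 : N z <= N y0 by apply: zmin; rewrite inE.
have zint : `|z - y0| < d.
  rewrite lt_neqAle Kz andbT; apply/eqP => zd.
  have : (P1 * e) ^+ 2 <= p%:R * e ^+ 2.
    apply: (@le_trans _ _ (N z)).
      have Pe0 : 0 <= P1 * e by rewrite mulr_ge0 // ltW.
      apply: le_trans (sqnorm_le_dotp _); rewrite lerXn2r ?nnegrE //.
      have Pe : P1 * e = d / 4.
        by rewrite /e; field; rewrite gt_eqF.
      have eP : e <= d / 4.
        by rewrite -Pe ler_peMl ?(ltW e0) // /P1 lerDr.
      have : `|g z - g y0| <= `|g z - y| + e.
        apply: le_trans (lerD (lexx _) ye).
        by rewrite -(subrKA y (g z)); exact: ler_normD.
      rewrite Pe; move: zinj; rewrite zd.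
      by move: `|g z - g y0| `|g z - y| => a b; lra.
    apply: le_trans zy0 _; apply: (le_trans (dotp_le_norm _)).
    by rewrite ler_wpM2l // lerXn2r ?nnegrE ?(ltW e0) // distrC.
  rewrite [leLHS]exprMn (ler_pM2r (exprn_gt0 2 e0)) /P1.
  have : 0 <= p%:R :> R by [].
  by move: (p%:R : R) => q q0; nra.
(* With w = g z - y, the derivative of the squared distance in the direction w itself is 2 <w, D_w
   g>. It vanishes at an interior minimum, whereas positivity forbids this unless w = 0. *)
have gz : g z = y.
  apply/eqP; rewrite -subr_eq0; apply: contraT => w0.
  pose w := g z - y.
  have dNw : 'L_w N z = 2 * dotp w ('L_w g z).
    have dgy : differentiable (fun z => g z - y) z.
      by apply: differentiableB; [exact: dg|exact: differentiable_cst].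
    rewrite derive_dotp // deriveBf; [|exact: dg|exact: differentiable_cst].
    by rewrite derive_cstf subr0 [X in X + _]dotpC -/w -mulr2n mulr_natl.
  suff : 'L_w N z = 0.
    rewrite dNw => /eqP; rewrite mulf_eq0 pnatr_eq0 /= => /eqP wz.
    by have := zpos w w0; rewrite wz ltxx.
  apply/eqP; rewrite -oppr_eq0 -deriveNf; last exact: dN.
  apply/eqP; apply: derive_at_max; first by apply: differentiableN; exact: dN.
  have : \forall z' \near z, `|z' - y0| < d.
    have cN : {for z, continuous (fun z' : 'cV[R]_p => `|z' - y0|)}.
      apply: continuous_comp; last exact: norm_continuous.
      by apply: continuousB => //; exact: cst_continuous.
    exact: (cvgr_lt _ cN).
  by apply: filterS => z' z'd; rewrite lerN2; apply: zmin; rewrite inE; exact: ltW.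
by split=> //; rewrite -gz.
Unshelve. all: by end_near. Qed.

End LocalSurjectivity.

Section Factor.
Context {R : realType} {p : nat}.

Lemma differentiable_bound (f : 'cV[R]_p -> R) y : differentiable f y ->
  exists2 C : R, 0 < C & forall v, `|'L_v f y| <= C * `|v|.
Proof.
move=> df; have [C C0 CP] := linear_lipschitz (diff_continuous df).
by exists C => // v; rewrite derive_diff.
Qed.

(** [F] is not assumed continuous: an increment of its argument is realised as g z - g y0 with |z -
    y0| at most twice its size, so that the increment of [F] becomes one of [h]. *)
Lemma differentiable_factor (W : set 'cV[R]_p) (g : 'cV[R]_p -> 'cV[R]_p)
    (h F : 'cV[R]_p -> R) y0 :
  open W -> W y0 -> (forall k, smooth_on W (fun z => g z k 0)) ->
  (forall v, 'L_v g y0 = v) -> differentiable h y0 ->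
  (\forall z \near y0, F (g z) = h z) ->
  differentiable F (g y0) /\ forall v, 'L_v F (g y0) = 'L_v h y0.
Proof.
move=> oW Wy0 sg g1 dh Fg.
have dg : differentiable g y0.
  by apply/differentiable_mxP => k k'; rewrite ord1; exact: smooth_on_diff (sg k) Wy0.
have Fg0 : F (g y0) = h y0 by exact: nbhs_singleton Fg.
have [C C0 CP] := differentiable_bound dh.
have key e : 0 < e ->
    \forall k \near (0 : 'cV[R]_p), `|F (k + g y0) - F (g y0) - 'd h y0 k| <= e * `|k|.
  (* Two errors add up: that of [h], at most [e1] |z - y0|, and that of replacing the increment by z
     - y0 inside the derivative of [h], at most [C] times as much. The 2 pays for |z - y0| <= 2
     |k|. *)
  move=> e0; pose e1 := e / (2 * (1 + C)).
  have C10 : 0 < 1 + C by rewrite ltr_wpDr // ltW.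
  have e10 : 0 < e1 by rewrite divr_gt0 // mulr_gt0.
  have Hh : \forall z \near y0, `|h z - h y0 - 'L_(z - y0) h y0| <= e1 * `|z - y0|.
    have := derive_eps dh e10; rewrite (near_shift y0 0).
    by apply: filterS => z /=; rewrite sub0r subrK.
  have Hg : \forall z \near y0, `|g z - g y0 - (z - y0)| <= e1 * `|z - y0|.
    have := derive_eps dg e10; rewrite (near_shift y0 0).
    by apply: filterS => z /=; rewrite sub0r subrK g1.
  have : \forall z \near y0, [/\ F (g z) = h z,
     `|h z - h y0 - 'L_(z - y0) h y0| <= e1 * `|z - y0|
     & `|g z - g y0 - (z - y0)| <= e1 * `|z - y0|].
    by apply: filterS3 Fg Hh Hg.
  move=> /nbhs_ballP[r /= r0 rP].
  have : \forall d \near 0^'+, d < r /\ exists2 e : R, 0 < e &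
    forall y, `|y - g y0| <= e -> exists z,
      [/\ `|z - y0| <= d, g z = y & `|z - y0| <= 2 * `|y - g y0|].
    by apply: filterS2 (nbhs_right_lt r0) (locally_onto oW Wy0 sg g1).
  move=> /(@filter_ex _ _ (@at_right_proper_filter R 0))[d [dr [e2 e20 onto]]].
  have ke2 : \forall k \near (0 : 'cV[R]_p), `|k| < e2.
    apply/nbhs_ballP; exists e2 => // k; rewrite -ball_normE /= sub0r normrN.
    by [].
  apply: filterS ke2 => k ke.
  have [|z [zd gz zk]] := onto (k + g y0); first by rewrite addrK ltW.
  have [|Fz hz gz2] := rP z.
    by rewrite -ball_normE /= distrC (le_lt_trans zd).
  rewrite addrK in zk; move: gz2; rewrite gz addrK => gz2.
  rewrite -gz Fz Fg0 -derive_diff //.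
  have -> : h z - h y0 - 'L_k h y0 =
      (h z - h y0 - 'L_(z - y0) h y0) - 'L_(k - (z - y0)) h y0.
    have E : 'd h y0 k = 'd h y0 (z - y0) + 'd h y0 (k - (z - y0)).
      by rewrite -linearD addrC subrK.
    by rewrite !derive_diff // E opprD addrA.
  apply: (le_trans (ler_normB _ _)).
  have B2 := le_trans (CP (k - (z - y0))) (ler_wpM2l (ltW C0) gz2).
  apply: (le_trans (lerD hz B2)).
  have -> : e * `|k| = (1 + C) * e1 * (2 * `|k|).
    by rewrite /e1; move: `|k| => t; field; rewrite gt_eqF.
  have -> : e1 * `|z - y0| + C * (e1 * `|z - y0|) = (1 + C) * e1 * `|z - y0|.
    by move: `|z - y0| => t; ring.
  by rewrite ler_wpM2l // mulr_ge0 // ltW.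
have [dF DF] := derive_epsP (diff_continuous dh) key.
by split=> // v; rewrite DF derive_diff.
Qed.

End Factor.

(** * Smoothness of the function induced on the sphere *)

Section Descent.
Context {R : realType} {m n : nat} (M : riemannianManifold R m).
Context (phi : M -> 'cV[R]_n.+1) (n0 : (0 < n)%N) (honto : onto_sphere phi)
  (hsub : submersive phi) (hphi : harmonic_morphism phi).
Implicit Types (x : M) (i j : rm_chart M) (F : M -> R).

Let sphi : smooth_to_sphere phi := hphi.1.1.
Let hwc : horizontally_weakly_conformal phi := hphi.2.

(* The function on the sphere induced by [F], extended to be constant on rays. *)
Definition descent F (y : 'cV[R]_n.+1) : R :=
  get [set r | exists2 x, phi x = (enorm y)^-1 *: y & F x = r].

Definition factors F := forall x x', phi x = phi x' -> F x = F x'.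

(** A frame accompanies the function because the derivatives of the induced function are computed in
    one; harmonicity of [phi] supplies a frame around every point. *)
Definition locally_smooth F := forall x, exists i U e,
  orthonormal_frame_at x i U e /\ smooth_on U (F \o rm_param i).

Lemma phi_neq0 x : phi x != 0.
Proof. by rewrite -dotp_gt0 (sphi.2 x). Qed.

Lemma descentE F x (c : R) : factors F -> 0 < c -> descent F (c *: phi x) = F x.
Proof.
move=> pF c0; rewrite /descent enormZ gtr0_norm // /enorm (sphi.2 x) sqrtr1 mulr1.
rewrite scalerA mulVf ?gt_eqF // scale1r.
by apply: get_unique => [|r [x' /pF <- <-//]]; exists x.
Qed.

Lemma descentE1 F x : factors F -> descent F (phi x) = F x.
Proof. by move=> pF; rewrite -[phi x]scale1r descentE. Qed.

Lemma normalize_onto y : y != 0 -> exists x, phi x = (enorm y)^-1 *: y.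
Proof. by move=> y0; apply: honto; exact: dotp_normalize. Qed.

Lemma descent_homogeneous F : homogeneous0 (descent F).
Proof.
move=> c y c0 y0; rewrite /descent enormZ gtr0_norm // invfM scalerA.
by rewrite mulrAC mulVf ?gt_eqF // mul1r.
Qed.

(** Near [phi x] the map [g] below is [phi] after an affine horizontal lift, multiplied by a radial
    factor. Its derivative at [phi x] is the identity and [descent F] composed with it is smooth, so
    [differentiable_factor] applies. *)
Lemma descent_derive F x i U e (l2 : R) : factors F -> orthonormal_frame_at x i U e ->
  0 < l2 ->
  (forall v, \sum_(a < m)
     dotp ('L_(e a (rm_coord i x)) (phi \o rm_param i) (rm_coord i x)) v *:
       'L_(e a (rm_coord i x)) (phi \o rm_param i) (rm_coord i x) =
    l2 *: tangent_proj (phi x) v) ->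
  smooth_on U (F \o rm_param i) ->
  differentiable (descent F) (phi x) /\
  forall v, 'L_v (descent F) (phi x) = l2^-1 * \sum_(a < m)
     dotp ('L_(e a (rm_coord i x)) (phi \o rm_param i) (rm_coord i x)) v *
     'L_(e a (rm_coord i x)) (F \o rm_param i) (rm_coord i x).
Proof.
move=> pF fe l20 E sF; have [dx [oU Ucod] Ux se _] := fe.
set u := rm_coord i x in E Ux *; pose f := phi \o rm_param i.
have px : f u = phi x by rewrite /f /= rm_coordK.
have df z : U z -> differentiable f z.
  by move=> Uz; exact: smooth_on_diff (sphi.1 i) (Ucod _ Uz).
have dF : differentiable (F \o rm_param i) u by exact: smooth_on_diff Ux.
(* [B] is the horizontal lift: it sends [v] to a vector whose image under d phi is the tangential
   part of [v]. *)
pose B : 'M[R]_(m, n.+1) := l2^-1 *: \sum_(a < m) e a u *m ('L_(e a u) f u)^T.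
have BE v : B *m v = l2^-1 *: \sum_(a < m) dotp ('L_(e a u) f u) v *: e a u.
  rewrite /B -scalemxAl mulmx_suml; congr (_ *: _); apply: eq_bigr => a _.
  rewrite -mulmxA [X in e a u *m X]mx11_scalar mul_mx_scalar //.
have fB v : 'L_(B *m v) f u = tangent_proj (phi x) v.
  rewrite BE (derive_scaler _ _ (df u Ux)) (derive_sumr _ _ _ (df u Ux)).
  under eq_bigr do rewrite (derive_scaler _ _ (df u Ux)).
  by rewrite E scalerA mulVf ?gt_eqF // scale1r.
set y0 := phi x in fB E px *.
pose A (z : 'cV[R]_n.+1) := u + B *m (z - y0).
have A0 : A y0 = u by rewrite /A subrr mulmx0 addr0.
have dzy (z : 'cV[R]_n.+1) : differentiable (fun z : 'cV[R]_n.+1 => z - y0) z.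
  by apply: differentiableB => //; exact: differentiable_cst.
have Dzy (z v : 'cV[R]_n.+1) : 'L_v (fun z : 'cV[R]_n.+1 => z - y0) z = v.
  by rewrite deriveBf ?derive_idf ?derive_cstf ?subr0 //; exact: differentiable_cst.
have dBz (z : 'cV[R]_n.+1) : differentiable (fun z : 'cV[R]_n.+1 => B *m (z - y0)) z.
  by apply: differentiable_mulmx; [exact: differentiable_cst|exact: dzy].
have dA z : differentiable A z.
  by apply: differentiableD => //; exact: differentiable_cst.
have DA z v : 'L_v A z = B *m v.
  rewrite (deriveDf v (differentiable_cst u z) (dBz z)) derive_cstf add0r.
  rewrite (derive_mulmx v (differentiable_cst B z) (dzy z)).
  by rewrite derive_cstf mul0mx add0r Dzy.
(* The image of [phi] has no radial direction; the factor [s], with derivative <y0, v>, restores the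
   normal part of [v], and [descent F] is insensitive to it. *)
pose s (z : 'cV[R]_n.+1) : R := 1 + dotp y0 (z - y0).
have ds z : differentiable s z.
  apply: differentiableD; first exact: differentiable_cst.
  by apply: differentiable_dotp; [exact: differentiable_cst|exact: dzy].
have s0 : s y0 = 1 by rewrite /s subrr dotp0r addr0.
have Ds z v : 'L_v s z = dotp y0 v.
  rewrite deriveDf; [|exact: differentiable_cst|by apply: differentiable_dotp;
    [exact: differentiable_cst|exact: dzy]].
  rewrite derive_cstf add0r (derive_dotp v (differentiable_cst y0 z) (dzy z)).
  by rewrite derive_cstf dotp0l add0r Dzy.
have [W [oW Wy0 WU Ws]] : exists W : set 'cV[R]_n.+1, [/\ open W, W y0,
    (forall z, W z -> U (A z)) & forall z, W z -> 0 < s z].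
  have : nbhs y0 ((A @^-1` U) `&` (s @^-1` [set r | 0 < r])).
    apply: filterI.
      apply: (differentiable_continuous (dA y0)); apply: open_nbhs_nbhs.
      by split=> //; rewrite A0.
    apply: (differentiable_continuous (ds y0)); apply: open_nbhs_nbhs.
    by split; [exact: open_gt|rewrite /= s0].
  rewrite nbhsE => -[W [oW Wy] WW]; exists W; split=> // z Wz.
    by have [] := WW z Wz.
  by have [] := WW z Wz.
pose g z := s z *: f (A z).
have smo k : smooth_on W (fun z : 'cV[R]_n.+1 => z k 0) by exact: smooth_on_id_coord.
have sz k : smooth_on W (fun z : 'cV[R]_n.+1 => (z - y0) k 0).
  have -> : (fun z : 'cV[R]_n.+1 => (z - y0) k 0) = (fun z => z k 0 - y0 k 0).
    by apply/funext => z; rewrite !mxE.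
  by apply: smooth_on_sub => //; exact: smooth_on_cst.
have sA k : smooth_on W (fun z => A z k 0).
  have -> : (fun z => A z k 0) =
      (fun z => u k 0 + \sum_(l < n.+1) B k l * (z - y0) l 0).
    by apply/funext => z; rewrite !mxE; congr (_ + _); apply: eq_bigr => l _; rewrite !mxE.
  apply: smooth_on_add => //; first exact: smooth_on_cst.
  by apply: smooth_on_sum => // l; apply: smooth_on_mul => //; exact: smooth_on_cst.
have ss : smooth_on W s.
  apply: smooth_on_add => //; first exact: smooth_on_cst.
  by apply: smooth_on_dotp => // k; exact: smooth_on_cst.
have sg k : smooth_on W (fun z => g z k 0).
  have -> : (fun z => g z k 0) = (fun z => s z * ((fun y => phi y k 0) \o rm_param i) (A z)).
    by apply/funext => z; rewrite mxE.
  apply: smooth_on_mul => //; apply: (smooth_on_comp oW WU sA).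
  by apply: smooth_onW Ucod _; exact: smooth_map_coord sphi.1.
have dfA : differentiable (f \o A) y0.
  by apply: differentiable_comp => //; rewrite A0; exact: df.
have g1 v : 'L_v g y0 = v.
  rewrite derive_scaled // (derive_comp _ (dA y0)); last by rewrite A0; exact: df.
  rewrite DA Ds s0 scale1r /= !A0 fB px /tangent_proj.
  by rewrite addrC subrK.
have gy0 : g y0 = y0 by rewrite /g s0 scale1r A0 px.
pose h := (F \o rm_param i) \o A.
have dh : differentiable h y0 by apply: differentiable_comp => //; rewrite A0.
have Fg : \forall z \near y0, descent F (g z) = h z.
  have : nbhs y0 W by exact: open_nbhs_nbhs.
  apply: filterS => z Wz; rewrite /g /h /= /f /= descentE //; exact: Ws.
have [] := differentiable_factor oW Wy0 sg g1 dh Fg.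
rewrite gy0 => dD DD; split=> // v.
rewrite DD (derive_comp _ (dA y0)) ?A0 // DA BE.
rewrite (derive_scaler _ _ dF) (derive_sumr _ _ _ dF); congr (_ * _).
by apply: eq_bigr => a _; rewrite (derive_scaler _ _ dF).
Qed.

(** Taking traces identifies the squared dilation as |d phi|^2 / n, an expression that is smooth in
    the point, whereas [frame_dilation] only yields a number at each point. *)
Let frame_l2 x i U e : orthonormal_frame_at x i U e ->
  let eta a := 'L_(e a (rm_coord i x)) (phi \o rm_param i) (rm_coord i x) in
  let l2 := n%:R^-1 * \sum_(a < m) dotp (eta a) (eta a) in
  0 < l2 /\ forall v, \sum_(a < m) dotp (eta a) v *: eta a = l2 *: tangent_proj (phi x) v.
Proof.
move=> fe eta l2.
have [l l0 E] := frame_dilation n0 sphi hsub hwc fe.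
suff -> : l2 = l by [].
have Ek k : \sum_(a < m) eta a k 0 * eta a k 0 = l * ((k == k)%:R - phi x k 0 * phi x k 0).
  have /colP/(_ k) := E (delta_mx k 0).
  rewrite summxE /tangent_proj !mxE dotpC dotp_delta !eqxx => <-.
  by apply: eq_bigr => a _; rewrite !mxE dotpC dotp_delta.
rewrite /l2; under eq_bigr do rewrite dotpE.
rewrite exchange_big; under eq_bigr do rewrite Ek.
by rewrite [X in _ * X](dilation_trace l (sphi.2 x)) mulKf // pnatr_eq0 -lt0n.
Qed.

Lemma locally_smooth_derive F v : factors F -> locally_smooth F ->
  locally_smooth (fun x => 'L_v (descent F) (phi x)).
Proof.
move=> pF lF x; have [i [U [e [fe sF]]]] := lF x.
exists i, U, e; split=> //; have [dx [oU Ucod] Ux se _] := fe.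
pose f := phi \o rm_param i.
have sf k : smooth_on U (fun z => f z k 0).
  by apply: smooth_onW Ucod _; exact: smooth_map_coord sphi.1.
have seta a k : smooth_on U (fun z => 'L_(e a z) f z k 0).
  have := smooth_on_derive_field oU (sf k) (se a).
  apply: smooth_on_eq => // z Uz; rewrite derive_mxE //.
  exact: smooth_on_diff (sphi.1 i) (Ucod _ Uz).
pose q z := n%:R^-1 * \sum_(a < m) dotp ('L_(e a z) f z) ('L_(e a z) f z).
have sq : smooth_on U q.
  apply: smooth_on_mul => //; first exact: smooth_on_cst.
  by apply: smooth_on_sum => // a; apply: smooth_on_dotp.
have frame z : U z -> orthonormal_frame_at (rm_param i z) i U e.
  by move=> Uz; exact: orthonormal_frame_move fe Uz.
have q0 z : U z -> 0 < q z.
  move=> Uz; have [] := frame_l2 (frame z Uz).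
  by rewrite rm_paramK //; exact: Ucod.
have sr := smooth_on_rsqrt oU sq q0.
(* The inverse of [q] is written as the square of its inverse square root, whose smoothness is
   known. *)
apply: (@smooth_on_eq _ _ _ U (fun z => ((Num.sqrt (q z))^-1 * (Num.sqrt (q z))^-1)
   * \sum_(a < m) dotp ('L_(e a z) f z) v * 'L_(e a z) (F \o rm_param i) z)) => //.
  move=> z Uz; have [l20 E] := frame_l2 (frame z Uz).
  have [_ /= ->] := descent_derive pF (frame z Uz) l20 E sF.
  rewrite rm_paramK; last exact: Ucod.
  rewrite -/(q z) -invfM -expr2 sqr_sqrtr //; exact/ltW/q0.
apply: smooth_on_mul => //; first exact: smooth_on_mul.
apply: smooth_on_sum => // a; apply: smooth_on_mul => //.
  by apply: smooth_on_dotp => // k; exact: smooth_on_cst.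
exact: smooth_on_derive_field.
Qed.

(** A derivative of an induced function is 1 / |y| times the function induced by another locally
    smooth function that factors through [phi]. The induction on the order therefore quantifies over
    all such functions. *)
Lemma descent_smooth F : factors F -> locally_smooth F ->
  smooth_on punctured (descent F).
Proof.
move=> pF lF; apply/smooth_onP => k; have oP := @open_punctured R n.+1.
have dD G y : factors G -> locally_smooth G -> y != 0 ->
    differentiable (descent G) y /\
    forall v, 'L_v (descent G) y = (enorm y)^-1 *
      descent (fun x => 'L_v (descent G) (phi x)) y.
  move=> pG lG y0; have [x xy] := normalize_onto y0.
  have e0 : 0 < (enorm y)^-1 by rewrite invr_gt0 enorm_gt0.
  have [i [U [e [fe sG]]]] := lG x.
  have [l20 E] := frame_l2 fe.
  have [dG _] := descent_derive pG fe l20 E sG.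
  pose c (z : 'cV[R]_n.+1) := (enorm y)^-1 *: z.
  have dc : differentiable c y by exact: differentiableZ.
  have dGc : differentiable (descent G) (c y) by rewrite /c -xy.
  have Gc z : punctured z -> (descent G \o c) z = descent G z.
    by move=> z0; rewrite /c /= descent_homogeneous.
  split; first by apply: differentiable_eq_on oP y0 Gc _; exact: differentiable_comp.
  move=> v; rewrite -(derive_eq_on v oP y0 Gc) (derive_comp v dc dGc).
  have -> : 'L_v c y = (enorm y)^-1 *: v.
    have /= := @deriveZ _ _ _ id (enorm y)^-1 y v (@derivable_id _ _ _ _).
    by rewrite derive_id dirderE.
  rewrite (derive_scaler _ _ dGc) /c -xy; congr (_ * _).
  rewrite -[in RHS](enormK y0) -xy descentE ?enorm_gt0 // => x1 x2 -> //.
elim: k F pF lF => [|k IH] F pF lF.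
  by split=> // y y0; case: (dD F y pF lF y0).
split=> [y y0|v]; first by case: (dD F y pF lF y0).
apply: (@Ck_eq _ _ _ k punctured (fun y => (enorm y)^-1 *
    descent (fun x => 'L_v (descent F) (phi x)) y)) => //.
  by move=> y y0; have [_ ->] := dD F y pF lF y0.
apply: Ck_mul => //; first by have /smooth_onP := @smooth_on_enormV R n.+1; exact.
apply: IH; last exact: locally_smooth_derive.
by move=> x1 x2 ->.
Qed.

Lemma smooth_map_locally_smooth (V : M -> 'cV[R]_n.+1) k : smooth_map V ->
  locally_smooth (fun x => V x k 0).
Proof.
move=> sV x; have [i [U [e [fe _]]]] := hphi.1.2 x.
exists i, U, e; split=> //; have [_ [_ Ucod] _ _ _] := fe.
by apply: smooth_onW Ucod _; exact: smooth_map_coord.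
Qed.

End Descent.

(** * Geodesics of the sphere *)

Section SphereExponential.
Context {R : realType} {n : nat}.
Implicit Types (p v w : 'cV[R]_n.+1) (c t : R).

Definition arc p w c : R^o -> 'cV[R]_n.+1 :=
  fun t => cos (t * c) *: p + sin (t * c) *: w.

Let dtc c (t : R^o) : differentiable (fun s : R^o => s * c : R) t.
Proof. by apply: differentiableM => //; exact: differentiable_cst. Qed.

Let Dtc c (t h : R^o) : 'L_h (fun s : R^o => s * c : R) t = h * c.
Proof.
rewrite (deriveMf _ _ (differentiable_cst _ _)) //.
by rewrite derive_idf derive_cstf mulr0 addr0.
Qed.

Lemma differentiable_arc p w c t : differentiable (arc p w c) t.
Proof.
apply: differentiableD; apply: differentiable_scaled.
- exact/differentiable_cos_comp/dtc.
- exact: differentiable_cst.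
- exact/differentiable_sin_comp/dtc.
- exact: differentiable_cst.
Qed.

Lemma derive_arc p w c (h : R^o) :
  'L_h (arc p w c) = arc ((h * c) *: w) (- (h * c) *: p) c.
Proof.
apply/funext => t.
have dc := differentiable_cos_comp (dtc c t); have ds := differentiable_sin_comp (dtc c t).
rewrite deriveDf; [|apply: differentiable_scaled => //; exact: differentiable_cst..].
rewrite !derive_scaled //; try exact: differentiable_cst.
rewrite !derive_cstf !scaler0 !addr0 derive_cos_comp // derive_sin_comp // !Dtc.
by rewrite /arc !scalerA addrC mulNr mulrN.
Qed.

Lemma smooth_arc p w c : smooth_on setT (arc p w c).
Proof.
apply/smooth_onP => k; elim: k p w => [|k IH] p w.
  by split=> // t _; exact: differentiable_arc.
split=> [t _|h]; first exact: differentiable_arc.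
rewrite derive_arc; exact: IH.
Qed.

Let derive1L (f : R^o -> 'cV[R]_n.+1) : derive1 f = 'L_(1 : R^o) f.
Proof. by apply/funext => t; rewrite derive1E dirderE. Qed.

Lemma constant_derive0 (f : R^o -> R) : (forall t, differentiable f t) ->
  (forall t, 'L_(1 : R^o) f t = 0) -> forall t, f t = f 0.
Proof.
move=> df f0 t; have [s _|s _] := @MVT_line R R^o f 0 t; first exact: df.
have -> : t = t *: (1 : R^o) by rewrite /GRing.scale /= mulr1.
rewrite add0r derive_scaler // f0 scaler0 => /eqP.
by rewrite subr_eq0 => /eqP.
Qed.

Lemma constant_derive0_col (f : R^o -> 'cV[R]_n.+1) : (forall t, differentiable f t) ->
  (forall t, 'L_(1 : R^o) f t = 0) -> forall t, f t = f 0.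
Proof.
move=> df f0 t; apply/colP => k; apply: (@constant_derive0 (fun s => f s k 0)) => s.
  by move/differentiable_mxP: (df s); apply.
by rewrite -derive_mxE // f0 mxE.
Qed.

(** Vanishing tangential acceleration and <g, g> = 1 give g'' = - |g'|^2 g; the speed is constant
    because g is orthogonal to g'. *)
Lemma sphere_geodesic_ode (g : R^o -> 'cV[R]_n.+1) : sphere_geodesic g ->
  let b := 'L_(1 : R^o) g in
  [/\ forall t, differentiable g t, forall t, differentiable b t
   & forall t, 'L_(1 : R^o) b t = - dotp (b 0) (b 0) *: g t].
Proof.
move=> [sg gs gg] b.
have dg t : differentiable g t by exact: smooth_on_diff sg _.
have sb : smooth_on setT b by exact: smooth_on_derive.
have db t : differentiable b t by exact: smooth_on_diff sb _.
have gb t : dotp (g t) (b t) = 0.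
  have := derive_dotp (1 : R^o) (dg t) (dg t).
  have -> : (fun z => dotp (g z) (g z)) = fun=> 1 by apply/funext => z; exact: gs.
  rewrite derive_cstf [X in _ = X + _]dotpC -mulr2n => /esym/eqP.
  by rewrite mulrn_eq0 /= => /eqP.
have gb' t : dotp (g t) ('L_(1 : R^o) b t) = - dotp (b t) (b t).
  have := derive_dotp (1 : R^o) (dg t) (db t).
  have -> : (fun z => dotp (g z) (b z)) = fun=> 0 by apply/funext => z; exact: gb.
  by rewrite derive_cstf addrC => /esym/eqP; rewrite addr_eq0 => /eqP.
have b' t : 'L_(1 : R^o) b t = - dotp (b t) (b t) *: g t.
  have := gg t; rewrite pullback_connE derive1L -/b => /eqP.
  by rewrite subr_eq0 => /eqP ->; rewrite gb'.
split=> // t; rewrite b'; congr (- _ *: _).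
have dn (s : R^o) : differentiable (fun z => dotp (b z) (b z)) s by exact: differentiable_dotp.
have Dn (s : R^o) : 'L_(1 : R^o) (fun z => dotp (b z) (b z)) s = 0.
  rewrite derive_dotp // b' dotpZr dotpZl [X in _ * X + _]gb.
  by rewrite [X in _ + _ * X]dotpC gb !mulr0 addr0.
exact: constant_derive0 dn Dn t.
Qed.

(** [sphere_exp] is a choice operator, so existence of the great circle is not enough: every
    geodesic with these initial data must have the same endpoint. *)
Lemma sphere_expE p v : sphere p -> dotp p v = 0 ->
  sphere_exp p v = cos (enorm v) *: p + sin (enorm v) *: ((enorm v)^-1 *: v).
Proof.
(* For v = 0 the inverse of [c] is 0, so [w] is 0 and the great circle is constant. *)
move=> pp pv; set c := enorm v; set w := c^-1 *: v.
have cw : c *: w = v.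
  rewrite /w scalerA; have [c0|c0] := eqVneq c 0.
    rewrite c0 mul0r scale0r; apply/esym/eqP; rewrite -dotp_eq0 -sqr_enorm -/c c0.
    by rewrite expr0n.
  by rewrite divff // scale1r.
have pw : dotp p w = 0 by rewrite dotpZr pv mulr0.
have c2 : dotp v v = c ^+ 2 by rewrite sqr_enorm.
have ww : c != 0 -> dotp w w = 1.
  by move=> c0; rewrite dotpZl dotpZr c2 mulrA -invfM -expr2 mulVf // sqrf_eq0.
clearbody w.
have arc1 : arc p w c 1 = cos c *: p + sin c *: w by rewrite /arc mul1r.
have arcS t : sphere (arc p w c t).
  rewrite /sphere /= /arc !(dotpDl, dotpDr, dotpZl, dotpZr).
  rewrite [dotp w p]dotpC pw pp !mulr0 addr0 add0r mulr1.
  have [c0|c0] := eqVneq c 0; first by rewrite c0 mulr0 cos0 sin0 !mul0r mulr1 addr0.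
  by rewrite ww // mulr1 -!expr2 cos2Dsin2.
have D1 : derive1 (arc p w c) = arc v (- c *: p) c.
  by rewrite derive1L derive_arc mul1r cw.
rewrite -arc1; apply: get_unique.
  exists (arc p w c); split=> //.
  - split=> [||t]; [exact: smooth_arc|exact: arcS|].
    rewrite pullback_connE D1 derive_arc mul1r.
    have -> : arc (c *: (- c *: p)) (- c *: v) c t = - c ^+ 2 *: arc p w c t.
      rewrite /arc scalerDr !scalerA -cw !scalerA.
      by congr (_ *: _ + _ *: _); ring.
    by rewrite tangent_projZ tangent_proj_self ?scaler0.
  - by rewrite /arc mul0r cos0 sin0 scale1r scale0r addr0.
  - by rewrite D1 /arc mul0r cos0 sin0 scale1r scale0r addr0.
move=> q [g [gg g0 g'0 <-]].
have [dg db b'] := sphere_geodesic_ode gg.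
set b := 'L_(1 : R^o) g in db b'.
have b0 : b 0 = v by rewrite -g'0 derive1L.
rewrite b0 c2 in b'.
have [c0|c0] := eqVneq c 0.
  have v0 : v = 0 by rewrite -cw c0 scale0r.
  have bz t : b t = 0.
    rewrite (constant_derive0_col db) ?b0 // => s.
    by rewrite b' c0 expr0n /= oppr0 scale0r.
  by rewrite (constant_derive0_col dg bz) g0 arc1 c0 cos0 sin0 scale1r scale0r addr0.
pose cs (t : R^o) : R := cos (t * c); pose sn (t : R^o) : R := sin (t * c).
have dcs t : differentiable cs t by exact/differentiable_cos_comp/dtc.
have dsn t : differentiable sn t by exact/differentiable_sin_comp/dtc.
have Dcs t : 'L_(1 : R^o) cs t = - (c * sn t).
  rewrite derive_cos_comp; last exact: dtc.
  by rewrite Dtc mul1r mulNr mulrC.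
have Dsn t : 'L_(1 : R^o) sn t = c * cs t.
  rewrite derive_sin_comp; last exact: dtc.
  by rewrite Dtc mul1r mulrC.
(* [E] and [F] turn the pair (g, g') back by the angle t c. They are first integrals of g'' = - c^2
   g, equal to [p] and [v] at time 0; at time 1 they are solved for g. *)
pose E t := cs t *: g t - sn t *: (c^-1 *: b t).
pose F t := sn t *: (c *: g t) + cs t *: b t.
have dcb t : differentiable (fun z => c^-1 *: b z) t by exact: differentiableZ.
have dcg t : differentiable (fun z => c *: g z) t by exact: differentiableZ.
have Dcb t : 'L_(1 : R^o) (fun z => c^-1 *: b z) t = - c *: g t.
  rewrite derive_scaled ?derive_cstf ?scale0r ?add0r // ?b' ?scalerA.
  by congr (_ *: _); rewrite mulrN expr2 mulKf.
have Dcg t : 'L_(1 : R^o) (fun z => c *: g z) t = c *: b t.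
  by rewrite derive_scaled ?derive_cstf ?scale0r ?add0r.
have dE t : differentiable E t by apply: differentiableB; exact: differentiable_scaled.
have dF t : differentiable F t by apply: differentiableD; exact: differentiable_scaled.
have DE t : 'L_(1 : R^o) E t = 0.
  rewrite deriveBf; try exact: differentiable_scaled.
  rewrite (derive_scaled _ (dcs t) (dg t)) (derive_scaled _ (dsn t) (dcb t)) Dcs Dsn Dcb -/(b t); apply/colP => k; rewrite !mxE.
  move: (cs t) (sn t) (g t k 0) (b t k 0) => x1 x2 x3 x4.
  by field.
have DF t : 'L_(1 : R^o) F t = 0.
  rewrite deriveDf; try exact: differentiable_scaled.
  rewrite (derive_scaled _ (dsn t) (dcg t)) (derive_scaled _ (dcs t) (db t)) Dcs Dsn Dcg b' -/(b t); apply/colP => k; rewrite !mxE.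
  move: (cs t) (sn t) (g t k 0) (b t k 0) => x1 x2 x3 x4.
  by ring.
have E1 := constant_derive0_col dE DE 1; have F1 := constant_derive0_col dF DF 1.
have cs0 : cs 0 = 1 by rewrite /cs mul0r cos0.
have sn0 : sn 0 = 0 by rewrite /sn mul0r sin0.
rewrite /E cs0 sn0 scale1r scale0r subr0 g0 in E1.
rewrite /F cs0 sn0 scale1r scale0r add0r b0 in F1.
have cs1 : cs 1 = cos c by rewrite /cs mul1r.
have sn1 : sn 1 = sin c by rewrite /sn mul1r.
rewrite cs1 sn1 in E1 F1.
have wE : w = c^-1 *: v by rewrite -cw scalerA mulVf // scale1r.
rewrite arc1 wE -E1 -F1; apply/colP => k; rewrite !mxE.
have cs2 := cos2Dsin2 c.
move: (g 1 k 0) (b 1 k 0) => a b1; rewrite -[LHS]mul1r -cs2.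
by field.
Qed.

End SphereExponential.

(** * Harmonic rotations *)

Section UnitNormal.
Context {R : realType} {n : nat}.
Implicit Types (y p : 'cV[R]_n.+1).

Local Notation P := (@punctured R n.+1).

Definition nhat (k : 'I_n.+1) y : R := (enorm y)^-1 * y k 0.

Lemma sphere_neq0 p : sphere p -> p != 0.
Proof. by move=> pp; rewrite -dotp_gt0 pp. Qed.

Lemma enorm_sphere p : sphere p -> enorm p = 1.
Proof. by move=> pp; rewrite /enorm pp sqrtr1. Qed.

Lemma smooth_nhat k : smooth_on P (nhat k).
Proof.
by apply: smooth_on_mul; [exact: open_punctured|exact: smooth_on_enormV|
  exact: smooth_on_punctured_coord].
Qed.

Lemma pd_sqnorm j y : pd j (fun z : 'cV[R]_n.+1 => dotp z z) y = 2 * y j 0.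
Proof.
by rewrite pdE derive_dotp // derive_idf dotp_delta dotpC dotp_delta; ring.
Qed.

Lemma pd_enormV j y : y != 0 ->
  pd j (fun z => (enorm z)^-1) y = - ((enorm y)^-1 ^+ 3 * y j 0).
Proof.
move=> y0; have dd : differentiable (fun z : 'cV[R]_n.+1 => dotp z z) y.
  exact: differentiable_dotp.
rewrite pdE derive_rsqrt ?dotp_gt0 // -pdE pd_sqnorm -/(enorm y).
by move: (enorm y)^-1 (y j 0) => a b; field.
Qed.

Lemma pd_enorm j y : y != 0 -> pd j (@enorm R n.+1) y = nhat j y.
Proof.
move=> y0; have dd : differentiable (fun z : 'cV[R]_n.+1 => dotp z z) y.
  exact: differentiable_dotp.
rewrite pdE derive_sqrt_comp ?dotp_gt0 // -pdE pd_sqnorm /nhat -/(enorm y).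
by rewrite invfM mulrACA mulVf ?mul1r // pnatr_eq0.
Qed.

Lemma pd_nhat j k p : sphere p -> pd j (nhat k) p = (k == j)%:R - p j 0 * p k 0.
Proof.
move=> pp; have p0 := sphere_neq0 pp.
rewrite (@pdM _ _ P) //; [|exact: smooth_on_enormV|exact: smooth_on_punctured_coord].
rewrite pd_enormV // pd_coord enorm_sphere // invr1 expr1n !mul1r mulNr.
by rewrite addrC.
Qed.

Lemma lap_enorm p : sphere p -> lap (@enorm R n.+1) p = n%:R.
Proof.
move=> pp; have p0 := sphere_neq0 pp; rewrite lapE.
under eq_bigr => j _.
  rewrite (pd_eq_on j (@open_punctured R n.+1) p0 (fun z => @pd_enorm j z)).
  rewrite pd_nhat // eqxx; over.
rewrite sumrB -dotpE pp sumr_const card_ord -mulr_natl mulr1.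
by rewrite -natr1 addrK.
Qed.

Lemma lap_enormV p : sphere p -> lap (fun z : 'cV[R]_n.+1 => (enorm z)^-1) p = 2 - n%:R.
Proof.
move=> pp; have p0 := sphere_neq0 pp; rewrite lapE.
have oP := @open_punctured R n.+1; have sV := @smooth_on_enormV R n.+1.
have E j : pd j (pd j (fun z => (enorm z)^-1)) p = 3 * (p j 0 * p j 0) - 1.
  pose e z := (@enorm R n.+1 z)^-1.
  rewrite (@pd_eq_on _ _ P _ (fun z => - 1 * (e z * (e z * e z) * z j 0)) _ _ oP p0); last first.
    by move=> z z0; rewrite pd_enormV // mulN1r.
  have see : smooth_on P (fun z => e z * e z) by exact: smooth_on_mul.
  have seee : smooth_on P (fun z => e z * (e z * e z)) by exact: smooth_on_mul.
  have sj := @smooth_on_punctured_coord R n.+1 j.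
  rewrite (@pdZ _ _ P) //; last exact: smooth_on_mul.
  rewrite (pdM _ seee sj p0) (pdM _ sV see p0) (pdM _ sV sV p0) pd_coord eqxx.
  rewrite pd_enormV // /e enorm_sphere // invr1 expr1n (_ : true%:R = 1 :> R) //.
  by move: (p j 0) => a; ring.
under eq_bigr do rewrite E.
rewrite sumrB -mulr_sumr -dotpE pp sumr_const card_ord -(natr1 n).
by move: (n%:R : R) => a; ring.
Qed.

(** These are the first spherical harmonics, with eigenvalue n: (2 - n) - 2 = - n. *)
Lemma lap_nhat k p : sphere p -> lap (nhat k) p = - (n%:R * p k 0).
Proof.
move=> pp; have p0 := sphere_neq0 pp.
have oP := @open_punctured R n.+1; have sV := @smooth_on_enormV R n.+1.
have -> : nhat k = fun z => z k 0 * (enorm z)^-1.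
  by apply/funext => z; rewrite /nhat mulrC.
rewrite (@lap_coordM _ _ P) // lap_enormV // pd_enormV // enorm_sphere // invr1 expr1n.
by move: (p k 0) (n%:R : R) => a b; ring.
Qed.

Lemma nhat_sphere p k : sphere p -> nhat k p = p k 0.
Proof. by move=> pp; rewrite /nhat enorm_sphere // invr1 mul1r. Qed.

End UnitNormal.

Section TrigLaplacian.
Context {R : realType} {p : nat}.
Implicit Types (h : 'cV[R]_p -> R) (U : set 'cV[R]_p).

Lemma pd_cos U h j y : smooth_on U h -> U y ->
  pd j (fun z => cos (h z)) y = - sin (h y) * pd j h y.
Proof. by move=> sh Uy; rewrite !pdE derive_cos_comp //; exact: smooth_on_diff Uy. Qed.

Lemma pd_sin U h j y : smooth_on U h -> U y ->
  pd j (fun z => sin (h z)) y = cos (h y) * pd j h y.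
Proof. by move=> sh Uy; rewrite !pdE derive_sin_comp //; exact: smooth_on_diff Uy. Qed.

Lemma lap_cos U h y : open U -> smooth_on U h -> U y ->
  lap (fun z => cos (h z)) y =
  - cos (h y) * (\sum_j pd j h y ^+ 2) - sin (h y) * lap h y.
Proof.
move=> oU sh Uy; rewrite !lapE mulr_sumr mulr_sumr -sumrB; apply: eq_bigr => j _.
have [ss sc] := smooth_on_sin_cos oU sh; have sj := smooth_on_pd j sh.
rewrite (@pd_eq_on _ _ U _ (fun z => - 1 * (sin (h z) * pd j h z)) _ _ oU Uy); last first.
  by move=> z Uz; rewrite (pd_cos _ sh Uz) mulN1r mulNr.
rewrite (@pdZ _ _ U) ?(pdM _ ss sj Uy) ?(pd_sin _ sh Uy) //; last exact: smooth_on_mul.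
by move: (cos _) (sin _) (pd j h y) (pd j (pd j h) y) => a b c d; ring.
Qed.

Lemma lap_sin U h y : open U -> smooth_on U h -> U y ->
  lap (fun z => sin (h z)) y =
  - sin (h y) * (\sum_j pd j h y ^+ 2) + cos (h y) * lap h y.
Proof.
move=> oU sh Uy; rewrite !lapE mulr_sumr mulr_sumr -big_split; apply: eq_bigr => j _ /=.
have [ss sc] := smooth_on_sin_cos oU sh; have sj := smooth_on_pd j sh.
rewrite (@pd_eq_on _ _ U _ (fun z => cos (h z) * pd j h z) _ _ oU Uy); last first.
  by move=> z Uz; rewrite (pd_sin _ sh Uz).
rewrite (pdM _ sc sj Uy) (pd_cos _ sh Uy).
by move: (cos _) (sin _) (pd j h y) (pd j (pd j h) y) => a b c d; ring.
Qed.

End TrigLaplacian.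

(** Here [gr] is the gradient of the speed, [l] its Laplacian, [La] the Laplacian of xi and [T] the
    derivative of xi along [gr]. At angle pi the xi-component gives l = 0 and the rest makes T a
    multiple of p. At pi/2 and 3 pi/2 the equation is the same up to sign except for the value of t,
    so the difference isolates [gr] as a multiple of xi, and then [La] is one. At pi/4 the
    components along p and xi carry the same multiplier, which fixes the coefficient of [La]. *)
Lemma rotation_relations {R : realType} {n : nat} (p xi gr T La : 'cV[R]_n.+1)
    (r l N : R) :
  let w := dotp gr gr in let a := dotp gr xi in
  0 < r -> dotp p p = 1 -> dotp xi xi = 1 -> dotp p xi = 0 ->
  dotp gr p = 0 -> dotp T xi = 0 -> dotp T p = - a ->
  (forall t, 0 < t -> tangent_proj (cos (t * r) *: p + sin (t * r) *: xi)
    ((- t ^+ 2 * cos (t * r) * w - t * sin (t * r) * l - N * cos (t * r)) *: p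
     - (2 * t * sin (t * r)) *: gr
     + (- t ^+ 2 * sin (t * r) * w + t * cos (t * r) * l) *: xi
     + (2 * t * cos (t * r)) *: T + sin (t * r) *: La) = 0) ->
  [/\ l = 0, La = - N *: xi & gr = a *: xi].
Proof.
move=> w a r0 pp xx px gp Txi Tp H.
have par t c s : 0 < t -> cos (t * r) = c -> sin (t * r) = s -> exists mu,
  (- t ^+ 2 * c * w - t * s * l - N * c) *: p - (2 * t * s) *: gr
  + (- t ^+ 2 * s * w + t * c * l) *: xi + (2 * t * c) *: T + s *: La =
  mu *: (c *: p + s *: xi).
  move=> t0 ct st; have /eqP := H t t0; rewrite subr_eq0 ct st => /eqP E.
  by eexists; exact: E.
have divK (x y : R) : x != 0 -> x * (y / x) = y by move=> x0; rewrite mulrC divfK.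
have ipi : 0 < pi / r by rewrite divr_gt0 ?pi_gt0.
have rK c : c * (pi / r) * r = c * pi.
  by rewrite -mulrA -mulrA mulVf ?mulr1 // gt_eqF.
set t0 := pi / r in ipi rK.
have l0 : l = 0.
  have [||mu E] := par t0 (-1) 0 ipi.
  - by rewrite -[t0]mul1r rK mul1r cospi.
  - by rewrite -[t0]mul1r rK mul1r sinpi.
  have /(congr1 (dotp xi)) := E.
  rewrite !(dotpDr, dotpZr, dotpNr, dotpBr) (dotpC xi p) px (dotpC xi T) Txi xx.
  move=> E1; have : t0 * l = 0.
    by move: E1; move: (dotp xi gr) (dotp xi La) => u v; lra.
  by move/eqP; rewrite mulf_eq0 gt_eqF //= => /eqP.
have Tap : T = - a *: p.
  have [||mu E] := par t0 (-1) 0 ipi.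
  - by rewrite -[t0]mul1r rK mul1r cospi.
  - by rewrite -[t0]mul1r rK mul1r sinpi.
  suff [k Tk] : exists k, T = k *: p.
    by have := Tp; rewrite -/a Tk dotpZl pp mulr1 => ->.
  exists ((- t0 ^+ 2 * -1 * w - t0 * 0 * l - N * -1 + mu) / (2 * t0)).
  have t20 : 2 * t0 != 0 by rewrite mulf_neq0 ?pnatr_eq0 ?gt_eqF.
  apply: (scalerI t20); rewrite scalerA divK //.
  apply/colP => k; have /colP/(_ k) := E; rewrite l0 !mxE.
  by move: (T k 0) (gr k 0) (xi k 0) (La k 0) (p k 0) => u1 u2 u3 u4 u5; lra.
have h0 : 0 < 2^-1 * t0 by rewrite mulr_gt0 // invr_gt0.
have h1 : 0 < 2^-1 * t0 + t0 by exact: addr_gt0.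
have h2 : 0 < 4^-1 * t0 by rewrite mulr_gt0 // invr_gt0.
have [||mu1 E1] := par (2^-1 * t0) 0 1 h0.
- by rewrite rK mulrC cos_pihalf.
- by rewrite rK mulrC sin_pihalf.
have [||mu2 E2] := par (2^-1 * t0 + t0) 0 (-1) h1.
- by rewrite mulrDl rK -[t0]mul1r rK mul1r mulrC cosDpi cos_pihalf oppr0.
- by rewrite mulrDl rK -[t0]mul1r rK mul1r mulrC sinDpi sin_pihalf.
have gE : gr = a *: xi.
  suff [k gk] : exists k, gr = k *: xi.
    by rewrite /a gk dotpZl xx mulr1.
  exists ((mu1 - mu2 + (2^-1 * t0) ^+ 2 * w - (2^-1 * t0 + t0) ^+ 2 * w) / (2 * t0)).
  have t20 : 2 * t0 != 0 by rewrite mulf_neq0 ?pnatr_eq0 ?gt_eqF.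
  apply: (scalerI t20); rewrite scalerA divK //.
  apply/colP => k; have /colP/(_ k) := E1; have /colP/(_ k) := E2; rewrite l0 !mxE.
  move: (T k 0) (gr k 0) (xi k 0) (La k 0) (p k 0) => u1 u2 u3 u4 u5.
  by move=> e2 e1; clear -e1 e2; nra.
have LE : La = dotp La xi *: xi.
  suff [k Lk] : exists k, La = k *: xi by rewrite [in RHS]Lk dotpZl xx mulr1.
  exists (mu1 + (2^-1 * t0) ^+ 2 * w + 2 * (2^-1 * t0) * a).
  apply/colP => k; have /colP/(_ k) := E1; rewrite l0 gE !mxE.
  move: (T k 0) (xi k 0) (La k 0) (p k 0) => u1 u3 u4 u5 E.
  by clear -E; nra.
have c0 : 0 < cos (4^-1 * pi : R).
  apply: cos_gt0_pihalf; have := pi_gt0 R; lra.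
have sc : sin (4^-1 * pi : R) = cos (4^-1 * pi).
  apply: (mulIf (invr_neq0 (lt0r_neq0 c0))); rewrite divff ?gt_eqF //.
  by rewrite -[LHS]/(tan _) mulrC tan_piquarter.
have [mu E] := par (4^-1 * t0) _ _ h2 (erefl _) (erefl _).
move: E; rewrite rK sc l0 Tap gE LE.
move: (cos _) c0 => c c0 E.
have b : dotp La xi = - N.
  have /(congr1 (dotp p)) := E; have /(congr1 (dotp xi)) := E.
  rewrite !(dotpDr, dotpZr, dotpNr, dotpBr) (dotpC xi p) px xx pp.
  move=> E3 E4; apply: (mulfI (lt0r_neq0 c0)); 
  by clear -E3 E4; nra.
by split=> //; rewrite -b.
Qed.

(* [yhat |-> cos (t r) yhat + sin (t r) Xi] is the exponential of [t r Xi]; at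
   [p] its Laplacian has to be proportional to its value for every [t]. *)
Section HarmonicRotation.
Context {R : realType} {n : nat}.
Context (O : set 'cV[R]_n.+1) (p : 'cV[R]_n.+1) (r : 'cV[R]_n.+1 -> R)
  (Xi : 'I_n.+1 -> 'cV[R]_n.+1 -> R).
Context (oO : open O) (OP : O `<=` punctured) (Op : O p) (pp : sphere p)
  (sr : smooth_on O r) (sXi : forall k, smooth_on O (Xi k))
  (er : \sum_j p j 0 * pd j r p = 0)
  (eXi : forall k, \sum_j p j 0 * pd j (Xi k) p = 0)
  (Xi1 : forall y, O y -> \sum_k Xi k y ^+ 2 = 1)
  (Xiy : forall y, O y -> \sum_k nhat k y * Xi k y = 0)
  (r0 : 0 < r p).

Let G t k y : R := cos (t * r y) * nhat k y + sin (t * r y) * Xi k y.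

Let gr : 'cV[R]_n.+1 := \col_j pd j r p.
Let xi : 'cV[R]_n.+1 := \col_k Xi k p.
Let La : 'cV[R]_n.+1 := \col_k lap (Xi k) p.
Let T : 'cV[R]_n.+1 := \col_k \sum_j pd j r p * pd j (Xi k) p.

Lemma rotation_lap t : \col_k lap (G t k) p =
  (- t ^+ 2 * cos (t * r p) * dotp gr gr - t * sin (t * r p) * lap r p
     - n%:R * cos (t * r p)) *: p
  - (2 * t * sin (t * r p)) *: gr
  + (- t ^+ 2 * sin (t * r p) * dotp gr gr + t * cos (t * r p) * lap r p) *: xi
  + (2 * t * cos (t * r p)) *: T + sin (t * r p) *: La.
Proof.
have sh : smooth_on O (fun z => t * r z) by apply: smooth_on_mul => //; exact: smooth_on_cst.
have [ss sc] := smooth_on_sin_cos oO sh.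
have sn k : smooth_on O (nhat k) by exact: smooth_onW OP (smooth_nhat k).
have ph j : pd j (fun z => t * r z) p = t * pd j r p by exact: (pdZ _ _ sr).
have w : \sum_j pd j (fun z => t * r z) p ^+ 2 = t ^+ 2 * dotp gr gr.
  rewrite dotpE mulr_sumr; apply: eq_bigr => j _.
  by rewrite ph exprMn !mxE -expr2.
apply/colP => k; rewrite [LHS]mxE (@lapD _ _ O) //; try exact: smooth_on_mul.
rewrite (lapM oO sc (sn k) Op) (lapM oO ss (sXi k) Op).
rewrite (lap_cos oO sh Op) (lap_sin oO sh Op) w (lapZ _ oO sr Op).
(* The gradient of the k-th coordinate of y / |y| at [p] is e_k - p_k p; its second part drops out
   because the radial derivative of [r] is zero. *)
have -> : \sum_j pd j (fun z => cos (t * r z)) p * pd j (nhat k) p =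
    - (t * sin (t * r p)) * pd k r p.
  under eq_bigr => j _ do rewrite (pd_cos _ sh Op) ph pd_nhat // mulrBr.
  rewrite sumrB (bigD1 k) //= eqxx big1 => [|j jk]; last first.
    by rewrite eq_sym (negbTE jk) mulr0.
  have -> : \sum_i - sin (t * r p) * (t * pd i r p) * (p i 0 * p k 0) =
      - sin (t * r p) * t * p k 0 * \sum_i p i 0 * pd i r p.
    rewrite mulr_sumr; apply: eq_bigr => i _.
    by move: (sin _) (pd i r p) (p i 0) (p k 0) => a b c d; ring.
  by rewrite er mulr0 subr0 addr0 mulr1; move: (sin _) (pd k r p) => a b; ring.
have -> : \sum_j pd j (fun z => sin (t * r z)) p * pd j (Xi k) p =
    t * cos (t * r p) * T k 0.
  rewrite mxE mulr_sumr; apply: eq_bigr => j _; rewrite (pd_sin _ sh Op) ph.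
  by move: (cos _) (pd j r p) (pd j (Xi k) p) => a b c; ring.
rewrite lap_nhat // nhat_sphere //.
have -> : pd k r p = gr k 0 by rewrite mxE.
have -> : Xi k p = xi k 0 by rewrite mxE.
have -> : lap (Xi k) p = La k 0 by rewrite mxE.
move: gr xi La T (lap r p) (cos _) (sin _) => g1 x1 l1 T1 lr c s.
rewrite !mxE; move: (g1 k 0) (x1 k 0) (l1 k 0) (T1 k 0) (p k 0) (dotp g1 g1) => a b d e f h.
by ring.
Qed.

Let xx : dotp xi xi = 1.
Proof. by rewrite dotpE -(Xi1 Op); apply: eq_bigr => k _; rewrite mxE expr2. Qed.

Let px : dotp p xi = 0.
Proof.
rewrite dotpE -[RHS](Xiy Op); apply: eq_bigr => k _.
by rewrite mxE nhat_sphere.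
Qed.

Let Txi : dotp T xi = 0.
Proof.
have H j : \sum_k pd j (Xi k) p * Xi k p = 0.
  have sk k : smooth_on O (fun y => Xi k y * Xi k y) by exact: smooth_on_mul.
  have : pd j (fun y => \sum_k Xi k y * Xi k y) p = 0.
    rewrite (@pd_eq_on _ _ O _ (fun=> 1) _ _ oO Op); first by rewrite pd_cst.
    move=> y Oy; by rewrite -[RHS](Xi1 Oy).
  rewrite (pd_sum _ sk Op).
  under eq_bigr => k _ do rewrite (pdM _ (sXi k) (sXi k) Op).
  move=> E; apply: (@mulfI _ (2 : R)); first by rewrite pnatr_eq0.
  rewrite mulr0 -[RHS]E mulr_sumr; apply: eq_bigr => k _.
  by move: (pd j (Xi k) p) (Xi k p) => a b; ring.
rewrite dotpE; transitivity (\sum_j pd j r p * \sum_k pd j (Xi k) p * Xi k p).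
  under eq_bigr => k _ do rewrite !mxE mulr_suml.
  rewrite exchange_big; apply: eq_bigr => j _; rewrite mulr_sumr.
  by apply: eq_bigr => k _; rewrite mulrA.
by rewrite big1 // => j _; rewrite H mulr0.
Qed.

(** Differentiating <y / |y|, Xi> = 0 in direction j gives <p, d_j Xi> = - Xi_j; this is then
    weighted with the gradient of [r]. *)
Let Tp : dotp T p = - dotp gr xi.
Proof.
have H j : \sum_k p k 0 * pd j (Xi k) p = - Xi j p.
  have sn k : smooth_on O (nhat k) by exact: smooth_onW OP (smooth_nhat k).
  have sk k : smooth_on O (fun y => nhat k y * Xi k y) by exact: smooth_on_mul.
  have : pd j (fun y => \sum_k nhat k y * Xi k y) p = 0.
    by rewrite (@pd_eq_on _ _ O _ (fun=> 0) _ _ oO Op) ?pd_cst.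
  rewrite (pd_sum _ sk Op).
  under eq_bigr => k _ do rewrite (pdM _ (sn k) (sXi k) Op) pd_nhat // nhat_sphere // mulrBl.
  rewrite big_split sumrB /= (bigD1 j) //= eqxx big1 => [|k /negbTE->]; last by rewrite mul0r.
  under [X in _ - X]eq_bigr => k _ do rewrite -mulrA.
  rewrite -mulr_sumr; have -> : \sum_i p i 0 * Xi i p = 0.
    by rewrite -[RHS]px dotpE; apply: eq_bigr => k _; rewrite mxE.
  rewrite (_ : true%:R = 1 :> R) // mul1r addr0 mulr0 subr0.
  by move=> /eqP; rewrite addrC addr_eq0 => /eqP.
rewrite !dotpE; transitivity (\sum_j pd j r p * \sum_k p k 0 * pd j (Xi k) p).
  under eq_bigr => k _ do rewrite !mxE mulr_suml.
  rewrite exchange_big; apply: eq_bigr => j _; rewrite mulr_sumr.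
  by apply: eq_bigr => k _; rewrite mulrAC mulrA.
by rewrite -sumrN; apply: eq_bigr => j _; rewrite H !mxE mulrN.
Qed.

Let gp : dotp gr p = 0.
Proof. by rewrite dotpC -er dotpE; apply: eq_bigr => k _; rewrite mxE. Qed.

(** The divergence comes from the Laplacian of <y / |y|, Xi> = 0: the cross terms give 2 div Xi, and
    the two remaining terms are multiples of <p, xi> = 0. *)
Lemma rotation_rigid :
  (forall t, 0 < t -> tangent_proj (cos (t * r p) *: p + sin (t * r p) *: xi)
     (\col_k lap (G t k) p) = 0) ->
  [/\ lap r p = 0, La = - n%:R *: xi, gr = dotp gr xi *: xi
    & \sum_k pd k (Xi k) p = 0].
Proof.
move=> H.
have [||||||||l0 LE gE] := @rotation_relations _ _ p xi gr T La (r p) (lap r p) n%:R => //.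
  by move=> t t0; rewrite -rotation_lap; exact: H.
split=> //.
have sn k : smooth_on O (nhat k) by exact: smooth_onW OP (smooth_nhat k).
have : lap (fun y => \sum_k nhat k y * Xi k y) p = 0.
  by rewrite (@lap_eq_on _ _ O _ (fun=> 0) _ oO Op) ?lap_cst.
have sk k : smooth_on O (fun y => nhat k y * Xi k y) by exact: smooth_on_mul.
rewrite (lap_sum oO sk Op).
have E k : lap (fun y => nhat k y * Xi k y) p = 2 * pd k (Xi k) p
    - n%:R * (p k 0 * xi k 0) + - n%:R * (p k 0 * xi k 0).
  rewrite (lapM oO (sn k) (sXi k) Op) lap_nhat // nhat_sphere //.
  have -> : lap (Xi k) p = - n%:R * xi k 0.
    by have /colP/(_ k) := LE; rewrite [LHS]mxE [RHS]mxE.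
  have -> : \sum_j pd j (nhat k) p * pd j (Xi k) p = pd k (Xi k) p.
    under eq_bigr => j _ do rewrite pd_nhat // mulrBl.
    rewrite sumrB (bigD1 k) //= eqxx big1 => [|j jk]; last first.
      by rewrite eq_sym (negbTE jk) mul0r.
    under [X in _ - X]eq_bigr => j _ do rewrite mulrAC mulrC.
    by rewrite -mulr_sumr eXi mulr0 subr0 addr0 mul1r.
  have -> : Xi k p = xi k 0 by rewrite mxE.
  by move: (p k 0) (xi k 0) (pd k (Xi k) p) (n%:R : R) => u1 u2 u3 u4; ring.
under eq_bigr do rewrite E.
rewrite big_split sumrB /= -!mulr_sumr -dotpE px !mulr0 subr0 addr0 => /eqP.
by rewrite mulf_eq0 pnatr_eq0 => /eqP.
Qed.

End HarmonicRotation.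

(** * Infinitesimal rigidity *)

Section Extension.
Context {R : realType} {m n : nat} (M : riemannianManifold R m).
Context (phi V : M -> 'cV[R]_n.+1) (n0 : (0 < n)%N) (honto : onto_sphere phi)
  (hsub : submersive phi) (hphi : harmonic_morphism phi)
  (sV : smooth_map V) (tV : forall x, dotp (phi x) (V x) = 0)
  (pV : projectable phi V).
Implicit Types (x : M) (i j : rm_chart M).

Let sphi : smooth_to_sphere phi := hphi.1.1.
Let oP := @open_punctured R n.+1.

Lemma factors_coord k : factors phi (fun x => V x k 0).
Proof. by move=> x x' /pV ->. Qed.

Definition ext k (y : 'cV[R]_n.+1) : R := enorm y * descent phi (fun x => V x k 0) y.

Lemma smooth_ext k : smooth_on punctured (ext k).
Proof.
apply: smooth_on_mul => //; first exact: smooth_on_enorm.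
apply: (descent_smooth n0 honto hsub hphi (factors_coord k)).
exact: (smooth_map_locally_smooth hphi).
Qed.

Lemma extE k x : ext k (phi x) = V x k 0.
Proof.
rewrite /ext (descentE1 hphi x (factors_coord k)).
by rewrite /enorm (sphi.2 x) sqrtr1 mul1r.
Qed.

Lemma ext_homogeneous k (c : R) y : 0 < c -> y != 0 -> ext k (c *: y) = c * ext k y.
Proof. by move=> c0 y0; rewrite /ext enormZ gtr0_norm // descent_homogeneous // mulrA. Qed.

Lemma ext_euler k : euler 1 (ext k).
Proof.
move=> y y0; rewrite mul1r; apply: derive_radial1 => //; first exact: smooth_ext.
exact: ext_homogeneous.
Qed.

Lemma punctured_phi y : y != 0 -> exists x, y = enorm y *: phi x.
Proof.
by move=> y0; have [x xy] := normalize_onto honto y0; exists x; rewrite xy enormK.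
Qed.

Lemma ext_tangent (y : 'cV[R]_n.+1) : y != 0 -> \sum_k y k 0 * ext k y = 0.
Proof.
move=> y0; have [x ->] := punctured_phi y0.
under eq_bigr => k _.
  rewrite ext_homogeneous ?enorm_gt0 //; last exact: (phi_neq0 hphi).
  rewrite extE mxE mulrACA; over.
by rewrite -mulr_sumr -dotpE tV mulr0.
Qed.

Lemma lap_ext_homogeneous k (c : R) y : 0 < c -> y != 0 ->
  lap (ext k) (c *: y) = c^-1 * lap (ext k) y.
Proof.
move=> c0 y0; rewrite !lapE mulr_sumr; apply: eq_bigr => j _.
have sk := smooth_ext k.
apply: homogeneous0_pd => //; first exact: smooth_on_pd.
move=> d z d0 z0; apply: (mulfI (lt0r_neq0 d0)).
by apply: pd_homogeneous => // z' z'0; exact: ext_homogeneous.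
Qed.

(** The end of the argument for both parts of the theorem. Harmonicity is asked on the sphere only,
    since the Laplacian of a function of degree 1 has degree -1. *)
Lemma harmonic_ext_rigid : (forall k x, lap (ext k) (phi x) = 0) ->
  exists X : 'M[R]_n.+1, X^T = - X /\ forall x, V x = X *m phi x.
Proof.
move=> H.
have /fin_all_exists [a aE] k : exists a : 'cV[R]_n.+1, forall y, y != 0 -> ext k y = dotp a y.
  apply: harmonic1_linear => //; first exact: smooth_ext.
    exact: ext_homogeneous.
  move=> y y0; have [x ->] := punctured_phi y0.
  rewrite lap_ext_homogeneous ?enorm_gt0 ?H ?mulr0 //; exact: (phi_neq0 hphi).
pose X : 'M[R]_n.+1 := \matrix_(k, j) a k j 0.
have XE y k : (X *m y) k 0 = dotp (a k) y.
  by rewrite mxE dotpE; apply: eq_bigr => j _; rewrite mxE.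
have X0 y : dotp y (X *m y) = 0.
  have [->|y0] := eqVneq y 0; first by rewrite dotp0l.
  rewrite -(ext_tangent y0) dotpE; apply: eq_bigr => k _.
  by rewrite XE aE.
exists X; split; last by move=> x; apply/colP => k; rewrite XE -aE ?extE //; exact: (phi_neq0 hphi).
apply/matrixP => k l; apply/eqP; rewrite !mxE -addr_eq0.
have E (i j : 'I_n.+1) : dotp (delta_mx i 0) (X *m delta_mx j 0) = a i j 0.
  by rewrite dotp_delta XE dotpC dotp_delta.
(* Polarisation of <y, X y> = 0. *)
have := X0 (delta_mx k 0 + delta_mx l 0).
rewrite mulmxDr !dotpDl !dotpDr !X0 !E add0r addr0 => h.
by rewrite addrC h.
Qed.

(** * The Jacobi operator and the trace in a frame *)

Section AtPoint.
Context x i U e (fe : orthonormal_frame_at x i U e).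

Let u := rm_coord i x.
Let f := phi \o rm_param i.
Let W := V \o rm_param i.
Let eta a := 'L_(e a u) f u.

Let Ux : U u. Proof. by case: fe. Qed.
Let oU : open U. Proof. by case: fe => _ []. Qed.
Let Ucod : U `<=` rm_cod i. Proof. by case: fe => _ []. Qed.
Let cu : rm_cod i u. Proof. exact: Ucod. Qed.
Let fu : f u = phi x. Proof. by rewrite /f /= rm_coordK //; case: fe. Qed.
Let Wu : W u = V x. Proof. by rewrite /W /= rm_coordK //; case: fe. Qed.
Let df z : U z -> differentiable f z.
Proof. by move=> Uz; exact: smooth_on_diff (sphi.1 i) (Ucod Uz). Qed.
Let dW z : U z -> differentiable W z.
Proof. by move=> Uz; exact: smooth_on_diff (@sV i) (Ucod Uz). Qed.
Let dWe a : differentiable (fun z => 'L_(e a z) W z) u.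
Proof.
have [_ _ _ se _] := fe.
apply/differentiable_mxP => k k'; rewrite ord1.
have sk := smooth_onW Ucod (smooth_map_coord k sV (i := i)).
have E z : U z -> 'L_(e a z) ((fun y => V y k 0) \o rm_param i) z = 'L_(e a z) W z k 0.
  by move=> Uz; rewrite derive_mxE //; exact: dW.
apply: (differentiable_eq_on oU Ux E).
exact: smooth_on_diff (smooth_on_derive_field oU sk (se a)) Ux.
Qed.

Let dfe a : differentiable (fun z => 'L_(e a z) f z) u.
Proof.
have [_ _ _ se _] := fe.
apply/differentiable_mxP => k k'; rewrite ord1.
have sk := smooth_onW Ucod (smooth_map_coord k sphi.1 (i := i)).
have E z : U z -> 'L_(e a z) ((fun y => phi y k 0) \o rm_param i) z = 'L_(e a z) f z k 0.
  by move=> Uz; rewrite derive_mxE //; exact: df.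
apply: (differentiable_eq_on oU Ux E).
exact: smooth_on_diff (smooth_on_derive_field oU sk (se a)) Ux.
Qed.

Let peta a : dotp (phi x) (eta a) = 0.
Proof. by rewrite -fu derive_sphere_tangent. Qed.

Let fW v z : U z -> dotp (f z) ('L_v W z) = - dotp ('L_v f z) (W z).
Proof.
move=> Uz; apply/eqP; rewrite -addr_eq0 addrC -derive_dotp; [|exact: df|exact: dW].
rewrite (derive_eq_on v oU Uz (g := fun=> 0)) ?derive_cstf // => z' _.
exact: tV.
Qed.

(** Since <phi, V> = 0, the covariant derivative is the flat one plus <d phi (e_a), V> phi.
    Differentiating the last factor produces the extra tangential term; differentiating its
    coefficient only contributes normally. *)
Lemma frame_second_derivative a :
  pullback_conn f (e a) (pullback_conn f (e a) W) u =
  tangent_proj (phi x) ('L_(e a u) (fun z => 'L_(e a z) W z) u) +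
  dotp (eta a) (V x) *: eta a.
Proof.
rewrite pullback_connE fu.
pose w z := 'L_(e a z) W z.
pose q z := dotp ('L_(e a z) f z) (W z).
have pcE z : U z -> pullback_conn f (e a) W z = w z + q z *: f z.
  by move=> Uz; rewrite pullback_connE /tangent_proj fW // scaleNr opprK.
have dq : differentiable q u by apply: differentiable_dotp; [exact: dfe|exact: dW].
rewrite (derive_eq_on _ oU Ux pcE) (deriveDf _ (dWe a)) ?(derive_scaled _ dq) //; last first.
  by apply: differentiable_scaled => //; exact: df.
  exact: df.
rewrite !tangent_projD !tangent_projZ fu tangent_proj_self ?scaler0 ?add0r; last exact: sphi.2.
by rewrite (tangent_proj_id (peta a)) /q Wu.
Qed.

Lemma jacobi_lap_along : 
  \sum_(a < m) (pullback_conn f (e a) (pullback_conn f (e a) W) u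
     - pullback_conn f (levi_civita i (e a) (e a)) W u) =
  tangent_proj (phi x) (lap_along i e V x) + \sum_(a < m) dotp (eta a) (V x) *: eta a.
Proof.
rewrite (lap_alongE sV fe) tangent_proj_sum -big_split; apply: eq_bigr => a _ /=.
by rewrite frame_second_derivative pullback_connE fu tangent_projD tangent_projN addrAC.
Qed.

Context (l2 : R)
  (L : forall v, \sum_(a < m) dotp (eta a) v *: eta a = l2 *: tangent_proj (phi x) v).

Lemma lap_along_ext :
  lap_along i e V x = l2 *: ((\col_k lap (ext k) (phi x)) - n%:R *: V x).
Proof.
apply/colP => k; rewrite !mxE.
have -> : (fun y => V y k 0) \o rm_param i = fun z => ext k (phi (rm_param i z)).
  by apply/funext => z; rewrite extE.
rewrite (harmonic_morphism_lap sphi (hphi.1.2 x) fe (dilation_coord L) (smooth_ext k) (ext_euler k)).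
by rewrite extE mul1r addrK.
Qed.

Lemma sum_dotp_eta : \sum_(a < m) dotp (eta a) (eta a) = n%:R * l2.
Proof.
under eq_bigr do rewrite dotpE.
rewrite exchange_big; under eq_bigr do rewrite (dilation_coord L).
exact: dilation_trace (sphi.2 x).
Qed.

(** Everything of order zero cancels: the - n [l2] V from degree 1 against the |d phi|^2 V of the
    curvature, and the two terms [l2] V against each other. *)
Lemma jacobi_operator_ext :
  - (\sum_(a < m) (pullback_conn f (e a) (pullback_conn f (e a) W) u
     - pullback_conn f (levi_civita i (e a) (e a)) W u))
  - \sum_(a < m) sphere_curvature (f u) (eta a) (W u) (eta a) =
  - l2 *: tangent_proj (phi x) (\col_k lap (ext k) (phi x)).
Proof.
rewrite jacobi_lap_along L lap_along_ext fu Wu (tangent_proj_id (tV x)).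
have C a : sphere_curvature (phi x) (eta a) (V x) (eta a) =
    dotp (eta a) (eta a) *: V x - dotp (eta a) (V x) *: eta a.
  by rewrite sphere_curvatureE ?peta ?tV // 1?[dotp (V x) _]dotpC //; exact: sphi.2.
under eq_bigr do rewrite C.
rewrite sumrB -scaler_suml L (tangent_proj_id (tV x)) sum_dotp_eta.
rewrite tangent_projZ tangent_projD tangent_projN tangent_projZ (tangent_proj_id (tV x)).
apply/colP => k; move: (tangent_proj _ _) => Q; rewrite !mxE.
by move: (Q k 0) (V x k 0) (n%:R : R) => q v N; ring.
Qed.

(** The trace sees the divergence along the sphere. The missing radial part is <p, V> by Euler's
    identity, which is zero. *)
Lemma trace_ext :
  \sum_(a < m) dotp (eta a) (pullback_conn f (e a) W u) =
  l2 * \sum_k pd k (ext k) (phi x).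
Proof.
have E a : dotp (eta a) (pullback_conn f (e a) W u) =
    \sum_k \sum_l eta a k 0 * eta a l 0 * pd l (ext k) (phi x).
  rewrite pullback_connE fu /tangent_proj dotpBr dotpZr (dotpC _ (phi x)) peta mulr0 subr0.
  rewrite dotpE; apply: eq_bigr => k _; rewrite (@derive_mxE _ _ _ _ W); last exact: dW.
  have -> : (fun z => W z k 0) = fun z => ext k (f z).
    by apply/funext => z; rewrite extE.
  rewrite derive_comp_pd; [|exact: df|].
    rewrite mulr_sumr fu; apply: eq_bigr => l _; rewrite mulrA -derive_mxE //; exact: df.
  rewrite fu; apply: smooth_on_diff (smooth_ext k) _; exact: (phi_neq0 hphi).
under eq_bigr do rewrite E.
rewrite exchange_big mulr_sumr /=.
under eq_bigr => k _.
  rewrite exchange_big /=.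
  under eq_bigr => l _ do rewrite -mulr_suml (dilation_coord L) mulrBr mulrBl.
  rewrite sumrB (bigD1 k) //= eqxx big1 => [|l lk]; last first.
    by rewrite eq_sym (negbTE lk) mulr0 mul0r.
  have -> : \sum_i0 l2 * (phi x k 0 * phi x i0 0) * pd i0 (ext k) (phi x) =
      l2 * (phi x k 0 * V x k 0).
    rewrite -[V x k 0]extE -[ext k (phi x)]mul1r -(ext_euler k (phi_neq0 hphi x)).
    by rewrite !mulr_sumr; apply: eq_bigr => l _; rewrite !mulrA.
  rewrite addr0 mulr1; over.
by rewrite sumrB -[X in _ - X]mulr_sumr -dotpE tV mulr0 subr0.
Qed.

End AtPoint.

Lemma jacobi_lap_ext x : jacobi_operator_is phi V x 0 ->
  tangent_proj (phi x) (\col_k lap (ext k) (phi x)) = 0.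
Proof.
move=> [i [U [e [fe /= J]]]].
have [l2 l20 L] := frame_dilation n0 sphi hsub hphi.2 fe.
have := jacobi_operator_ext fe L; rewrite dirderE -J => /esym/eqP.
by rewrite scaler_eq0 oppr_eq0 gt_eqF //= => /eqP.
Qed.

Lemma trace_div_ext x : trace_is phi V x 0 -> \sum_k pd k (ext k) (phi x) = 0.
Proof.
move=> [i [U [e [fe /= J]]]].
have [l2 l20 L] := frame_dilation n0 sphi hsub hphi.2 fe.
have := trace_ext fe L; rewrite dirderE -J => /esym/eqP.
by rewrite mulf_eq0 gt_eqF //= => /eqP.
Qed.

(** Apply the Laplacian to the identity [ext_tangent]. *)
Lemma lap_ext_normal x :
  dotp (phi x) (\col_k lap (ext k) (phi x)) = - 2 * \sum_k pd k (ext k) (phi x).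
Proof.
have x0 := phi_neq0 hphi x.
have : lap (fun y : 'cV[R]_n.+1 => \sum_k y k 0 * ext k y) (phi x) = 0.
  by rewrite (@lap_eq_on _ _ punctured _ (fun=> 0) _ oP x0 ext_tangent) lap_cst.
rewrite (@lap_sum _ _ _ punctured (fun k y => y k 0 * ext k y)) //; last first.
  by move=> k; apply: smooth_on_mul; [|exact: smooth_on_punctured_coord|exact: smooth_ext].
under eq_bigr => k _ do rewrite (lap_coordM k oP (smooth_ext k) x0).
rewrite big_split -mulr_sumr /= => /eqP; rewrite addr_eq0 => /eqP.
by rewrite mulNr => <-; rewrite dotpE; apply: eq_bigr => k _; rewrite mxE.
Qed.

End Extension.

Lemma infinitesimal_rigidity {R : realType} {m n : nat} (M : riemannianManifold R m)
    (phi : M -> 'cV[R]_n.+1) : (0 < n)%N -> onto_sphere phi -> submersive phi ->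
  harmonic_morphism phi -> infinitesimally_rigid phi.
Proof.
move=> n0 honto hsub hphi V [[[sV tV] J] tr] pV.
apply: (harmonic_ext_rigid n0 honto hsub hphi sV tV pV) => k x.
have N := lap_ext_normal n0 honto hsub hphi sV tV pV x.
have T := jacobi_lap_ext n0 honto hsub hphi sV tV pV (J x).
rewrite (trace_div_ext n0 honto hsub hphi sV tV pV (tr x)) mulr0 in N.
by move: T => /colP/(_ k); rewrite tangent_proj_id // !mxE.
Qed.

(** * Local rigidity *)

Section HarmonicFlow.
Context {R : realType} {n : nat} (Y : 'I_n.+1 -> 'cV[R]_n.+1 -> R) (n0 : (0 < n)%N)
  (sY : forall k, smooth_on punctured (Y k)) (hY : forall k, homogeneous0 (Y k))
  (tY : forall y : 'cV[R]_n.+1, y != 0 -> \sum_k y k 0 * Y k y = 0).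

Local Notation P := (@punctured R n.+1).
Let oP := @open_punctured R n.+1.

(** The squared speed is smooth also where the field vanishes; [r] and [Xi] are used on [O] only,
    and global arguments are phrased with [Q] and the divergence [b]. *)
Let Q y := \sum_k Y k y ^+ 2.
Let O := P `&` [set y | 0 < Q y].
Let r y := Num.sqrt (Q y).
Let Xi k y := (r y)^-1 * Y k y.
Let b y := \sum_k pd k (Y k) y.

Context (rot : forall p t, sphere p -> 0 < Q p -> 0 < t ->
  tangent_proj (cos (t * r p) *: p + sin (t * r p) *: \col_k Xi k p)
    (\col_k lap (fun y => cos (t * r y) * nhat k y + sin (t * r y) * Xi k y) p) = 0).

Let sQ : smooth_on P Q.
Proof. by apply: smooth_on_sum => // k; exact: smooth_on_sqr. Qed.

Let hQ : homogeneous0 Q.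
Proof. by move=> c y c0 y0; apply: eq_bigr => k _; rewrite hY. Qed.

Let sb : smooth_on P b.
Proof. by apply: smooth_on_sum => // k; exact: smooth_on_pd. Qed.

Let hb (c : R) y : 0 < c -> y != 0 -> b (c *: y) = c^-1 * b y.
Proof.
move=> c0 y0; rewrite /b mulr_sumr; apply: eq_bigr => k _; exact: homogeneous0_pd.
Qed.

Let OP : O `<=` P. Proof. by move=> y []. Qed.

Let oO : open O.
Proof.
rewrite openE => y [y0 Qy]; apply: filterI; first exact: open_nbhs_nbhs.
have H : nbhs y (Q @^-1` [set s : R | 0 < s]).
  apply: (differentiable_continuous (smooth_on_diff sQ y0)).
  by apply: open_nbhs_nbhs; split => //; exact: open_gt.
exact: H.
Qed.

Let sYO k : smooth_on O (Y k). Proof. exact: smooth_onW OP (sY k). Qed.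
Let sQO : smooth_on O Q. Proof. exact: smooth_onW OP sQ. Qed.
Let sr : smooth_on O r. Proof. by apply: smooth_on_sqrt => // y []. Qed.
Let sXi k : smooth_on O (Xi k).
Proof. by apply: smooth_on_mul => //; apply: smooth_on_rsqrt => // y []. Qed.

Let r_gt0 y : O y -> 0 < r y. Proof. by case=> _ Qy; rewrite sqrtr_gt0. Qed.
Let r2 y : O y -> r y ^+ 2 = Q y. Proof. by case=> _ Qy; rewrite sqr_sqrtr // ltW. Qed.
Let YE k y : O y -> Y k y = r y * Xi k y.
Proof. by move=> Oy; rewrite /Xi mulrA divff ?mul1r // gt_eqF // r_gt0. Qed.

(** [rotation_rigid] needs vanishing radial derivatives, which [r] and [Xi] inherit from the degree
    0 of [Q] and [Y]. Its coefficient <grad r, xi> is [b], because b = div (r Xi) = <grad r, Xi> + r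
    div Xi and div Xi = 0. *)
Let flow_relations p : sphere p -> 0 < Q p ->
  [/\ lap r p = 0, forall k, lap (Xi k) p = - n%:R * Xi k p
    & forall k, pd k r p = b p * Xi k p].
Proof.
move=> pp Qp; have p0 := sphere_neq0 pp; have Op : O p by [].
have er : \sum_j p j 0 * pd j r p = 0.
  have : \sum_j p j 0 * pd j (fun y => r y * r y) p = 0.
    rewrite -[RHS](derive_radial0 sQ hQ p0); apply: eq_bigr => j _; congr (_ * _).
    by apply: (pd_eq_on _ oO Op) => y Oy; rewrite -expr2 r2.
  under eq_bigr => j _.
    rewrite (pdM _ sr sr Op).
    rewrite (_ : _ * _ = 2 * r p * (p j 0 * pd j r p)); last first.
      by move: (p j 0) (pd j r p) (r p) => u v w; ring.
    over.
  rewrite -mulr_sumr => /eqP; rewrite !mulf_eq0 pnatr_eq0 (gt_eqF (r_gt0 Op)) /=.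
  by move/eqP.
have eXi k : \sum_j p j 0 * pd j (Xi k) p = 0.
  have : \sum_j p j 0 * pd j (fun y => r y * Xi k y) p = 0.
    rewrite -[RHS](derive_radial0 (sY k) (@hY k) p0); apply: eq_bigr => j _; congr (_ * _).
    by apply: (pd_eq_on _ oO Op) => y Oy; rewrite YE.
  under eq_bigr => j _.
    rewrite (pdM _ sr (sXi k) Op).
    rewrite (_ : _ * _ = Xi k p * (p j 0 * pd j r p) + r p * (p j 0 * pd j (Xi k) p)); last first.
      by move: (p j 0) (pd j r p) (r p) => u v w; ring.
    over.
  rewrite big_split -!mulr_sumr /= er mulr0 add0r => /eqP.
  by rewrite mulf_eq0 gt_eqF ?r_gt0 //= => /eqP.
have Xi1 y : O y -> \sum_k Xi k y ^+ 2 = 1.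
  move=> Oy; under eq_bigr do rewrite exprMn.
  by rewrite -mulr_sumr -/(Q y) exprVn r2 // mulVf // gt_eqF //; case: Oy.
have Xiy y : O y -> \sum_k nhat k y * Xi k y = 0.
  move=> Oy; under eq_bigr do rewrite mulrACA.
  by rewrite -mulr_sumr tY ?mulr0 //; case: Oy.
have [l0 La gr dXi] := rotation_rigid oO OP Op pp sr sXi er eXi Xi1 Xiy (r_gt0 Op)
  (fun t t0 => rot pp Qp t0).
have bE : b p = dotp (\col_j pd j r p) (\col_k Xi k p).
  have -> : b p = \sum_k (pd k r p * Xi k p + r p * pd k (Xi k) p).
    apply: eq_bigr => k _; rewrite -(pdM _ sr (sXi k) Op).
    by apply: (pd_eq_on _ oO Op) => y Oy; rewrite YE.
  rewrite big_split -mulr_sumr /= dXi mulr0 addr0 dotpE.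
  by apply: eq_bigr => k _; rewrite !mxE.
split=> // k.
  by move/colP/(_ k) : La; rewrite !mxE.
by move/colP/(_ k) : gr; rewrite -bE !mxE.
Qed.

Let pd_Q_sphere p k : sphere p -> 0 < Q p -> pd k Q p = 2 * b p * Y k p.
Proof.
move=> pp Qp; have p0 := sphere_neq0 pp; have Op : O p by [].
have [_ _ gr] := flow_relations pp Qp.
rewrite (@pd_eq_on _ _ O _ (fun y => r y * r y) k p oO Op); last first.
  by move=> y Oy; rewrite -expr2 r2.
rewrite (pdM _ sr sr Op) gr (YE _ Op).
by move: (r p) (b p) (Xi k p) => u v w; ring.
Qed.

(** Both sides have degree -1, so the identity leaves the sphere; it has to hold on an open set to
    be differentiated again. *)
Let pd_Q y k : O y -> pd k Q y = 2 * b y * Y k y.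
Proof.
move=> [y0 Qy]; have c0 : 0 < (enorm y)^-1 by rewrite invr_gt0 enorm_gt0.
have pp := dotp_normalize y0.
have := @pd_Q_sphere _ k pp; rewrite hQ // => /(_ Qy).
rewrite homogeneous0_pd // hb // hY // invrK mulrCA -mulrA.
rewrite -mulrA => E; apply: (@mulfI _ (enorm y)); first by rewrite gt_eqF ?enorm_gt0.
by rewrite E !mulrA.
Qed.

(** The Laplacian of [Q] computed twice: from Q = r^2 it is 2 |grad r|^2 = 2 b^2, from grad Q = 2 b
    Y it is 2 Y . grad b + 2 b^2. *)
Let lap_Q p : sphere p -> 0 < Q p -> \sum_k Y k p * pd k b p = 0.
Proof.
move=> pp Qp; have p0 := sphere_neq0 pp; have Op : O p by [].
have [lr _ gr] := flow_relations pp Qp.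
have sbO := smooth_onW OP sb.
have E1 : lap Q p = 2 * b p ^+ 2.
  rewrite (@lap_eq_on _ _ O _ (fun y => r y ^+ 2) p oO Op); last by move=> y /r2 ->.
  rewrite (lap_sqr oO sr Op) lr mulr0 add0r; congr (_ * _).
  under eq_bigr do rewrite gr exprMn.
  rewrite -mulr_sumr; under eq_bigr do rewrite exprMn.
  by rewrite -mulr_sumr -/(Q p) exprVn r2 // mulVf ?mulr1 // gt_eqF.
have E2 : lap Q p = 2 * (\sum_k Y k p * pd k b p) + 2 * b p ^+ 2.
  rewrite lapE expr2 {3}/b mulr_sumr !mulr_sumr -big_split; apply: eq_bigr => k _ /=.
  rewrite (@pd_eq_on _ _ O _ (fun y => 2 * (b y * Y k y)) k p oO Op); last first.
    by move=> y Oy; rewrite pd_Q // mulrA.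
  rewrite (@pdZ _ _ O) //; last exact: smooth_on_mul.
  rewrite (pdM _ sbO (sYO k) Op).
  by move: (pd k b p) (Y k p) (b p) (pd k (Y k) p) => u v w z; ring.
apply: (@mulfI _ (2 : R)); first by rewrite pnatr_eq0.
by apply: (@addIr _ (2 * b p ^+ 2)); rewrite -E2 E1 mulr0 add0r.
Qed.

(** The factor |y|^2 compensates the degree -2 of b^2, so that [F] has degree 0 and attains its
    maximum. *)
Let F y := dotp y y * (b y ^+ 2 * Q y).

(** Differentiate along [Y] at the maximum: the derivative of |y|^2 is killed by tangency, that of b
    by [lap_Q], and what is left is 2 b^3 Q. *)
Let F_max p : sphere p -> (forall z, z != 0 -> F z <= F p) -> F p = 0.
Proof.
move=> pp Fmax; have p0 := sphere_neq0 pp.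
have : 0 <= Q p by apply: sumr_ge0 => k _; exact: sqr_ge0.
rewrite le_eqVlt => /predU1P[Q0|Qp]; first by rewrite /F -Q0 !mulr0.
have Op : O p by [].
have sn := @smooth_on_sqnorm R n.+1.
have sbb := smooth_on_mul oP sb sb.
have sbq := smooth_on_mul oP sbb sQ.
have FE : F = fun y => dotp y y * ((b y * b y) * Q y).
  by apply/funext => y; rewrite /F expr2.
have sF : smooth_on P F by rewrite FE; exact: smooth_on_mul.
have E k : pd k F p = 2 * (b p ^+ 2 * Q p) * p k 0 + 2 * b p * Q p * pd k b p
    + 2 * b p ^+ 3 * Y k p.
  rewrite FE (pdM _ sn sbq p0) (pdM _ sbb sQ p0) (pdM _ sb sb p0) pd_sqnorm pd_Q // pp.
  by move: (pd k b p) (Y k p) (b p) (Q p) (p k 0) => u v w z s; ring.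
have : \sum_k Y k p * pd k F p = 0.
  by apply: big1 => k _; rewrite (pd_at_max k oP sF p0 Fmax) mulr0.
have -> : \sum_k Y k p * pd k F p = 2 * (b p ^+ 2 * Q p) * (\sum_k p k 0 * Y k p)
   + 2 * b p * Q p * (\sum_k Y k p * pd k b p) + 2 * b p ^+ 3 * Q p.
  have -> : 2 * b p ^+ 3 * Q p = \sum_k 2 * b p ^+ 3 * Y k p ^+ 2 by rewrite -mulr_sumr.
  move: (2 * (b p ^+ 2 * Q p)) (2 * b p * Q p) (2 * b p ^+ 3) E => c1 c2 c3 E.
  rewrite !mulr_sumr -!big_split; apply: eq_bigr => k _ /=.
  by rewrite E; move: (pd k b p) (Y k p) (p k 0) => u v s; ring.
rewrite tY // lap_Q // !mulr0 !add0r => /eqP.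
rewrite !mulf_eq0 pnatr_eq0 (gt_eqF Qp) orbF /= !orbb => /eqP b0.
by rewrite /F b0 expr0n mul0r mulr0.
Qed.

(** The maximum of the nonnegative function [F] is 0. Where [Q] is positive this gives b = 0, hence
    grad Q = 2 b Y = 0; where [Q] is zero it is at its minimum. *)
Lemma flow_speed_constant : forall y z, y != 0 -> z != 0 -> Q y = Q z.
Proof.
have hF : homogeneous0 F.
  move=> c y c0 y0; rewrite /F hQ // hb // dotpZl dotpZr.
  have : c != 0 by rewrite gt_eqF.
  by move: (dotp y y) (b y) (Q y) => u v w c1; field.
have sF : smooth_on P F.
  apply: smooth_on_mul => //; first exact: smooth_on_sqnorm.
  by apply: smooth_on_mul => //; exact: smooth_on_sqr.
have F0 z : z != 0 -> F z <= 0.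
  have [y y0 ymax] := homogeneous0_max sF hF.
  have e0 : 0 < (enorm y)^-1 by rewrite invr_gt0 enorm_gt0.
  have <- : F ((enorm y)^-1 *: y) = 0.
    by apply: F_max; [exact: dotp_normalize|move=> w w0; rewrite hF //; exact: ymax].
  by rewrite hF //; exact: ymax.
apply: punctured_constant => // [y y0|y k y0]; first exact: smooth_on_diff sQ _.
have Q_ge0 z : 0 <= Q z by apply: sumr_ge0 => l _; exact: sqr_ge0.
have := Q_ge0 y; rewrite le_eqVlt => /predU1P[Qy|Qy].
  have sNQ : smooth_on P (fun z => - 1 * Q z) by apply: smooth_on_mul => //; exact: smooth_on_cst.
  have /eqP : pd k (fun z => - 1 * Q z) y = 0.
    by apply: pd_at_max oP sNQ y0 _ => z _; rewrite -Qy mulr0 mulN1r oppr_le0.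
  by rewrite (pdZ _ _ sQ y0) mulf_eq0 oppr_eq0 oner_eq0 => /eqP.
have Oy : O y by [].
have : F y == 0.
  rewrite eq_le F0 //= /F; apply: mulr_ge0; first by rewrite ltW // dotp_gt0.
  by rewrite mulr_ge0 ?sqr_ge0.
rewrite /F mulf_eq0 mulf_eq0 sqrf_eq0 (gt_eqF Qy) orbF gt_eqF ?dotp_gt0 //= => /eqP b0.
by rewrite pd_Q // b0 mulr0 mul0r.
Qed.

Lemma flow_eigen k p : sphere p -> 0 < Q p -> lap (Y k) p = - n%:R * Y k p.
Proof.
move=> pp Qp; have p0 := sphere_neq0 pp; have Op : O p by [].
have [_ La _] := flow_relations pp Qp.
have rE y : y != 0 -> r y = r p by move=> y0; rewrite /r (flow_speed_constant y0 p0).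
rewrite (@lap_eq_on _ _ O _ (fun y => r p * Xi k y) p oO Op); last first.
  by move=> y Oy; rewrite YE // rE //; case: Oy.
rewrite (lapZ _ oO (sXi k) Op) La (YE k Op).
by move: (r p) (Xi k p) (n%:R : R) => u v w; ring.
Qed.

End HarmonicFlow.

(** * One-parameter groups of rotations *)

Section Rotations.
Context {R : realType} {n : nat} (X : 'M[R]_n.+1) (c : R).
Context (Xskew : X^T = - X) (X2 : X *m X = - (c ^+ 2)%:M) (Xc0 : c = 0 -> X = 0).

(** The exponential of t X when X^2 = - c^2; for c = 0 the inverse is 0 and the group is trivial. *)
Definition rotation (t : R) : 'M[R]_n.+1 := (cos (t * c))%:M + (sin (t * c) * c^-1) *: X.

Lemma rotation_mul s t : rotation s *m rotation t = rotation (s + t).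
Proof.
have [c0|c0] := eqVneq c 0.
  have R0 u : rotation u = 1%:M.
    by rewrite /rotation c0 mulr0 cos0 Xc0 // scaler0 addr0.
  by rewrite !R0 mulmx1.
rewrite /rotation mulmxDl !mulmxDr !mul_scalar_mx -!scalemxAl -!scalemxAr mul_mx_scalar X2.
rewrite mulrDl cosD sinD; apply/matrixP => i j; rewrite !mxE.
rewrite -[_ *+ (i == j)]mulr_natr -[(_ - _) *+ (i == j)]mulr_natr -[(c ^+ 2) *+ (i == j)]mulr_natr.
move: ((i == j)%:R : R) (cos _) (cos _) (sin _) (sin _) (X i j) => d a1 a2 a3 a4 x.
by field.
Qed.

Lemma rotation0 : rotation 0 = 1%:M.
Proof. by rewrite /rotation !mul0r cos0 sin0 mul0r scale0r addr0. Qed.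

Lemma rotation_tr t : (rotation t)^T = rotation (- t).
Proof.
rewrite /rotation linearD linearZ /= tr_scalar_mx Xskew mulNr cosN sinN.
by rewrite mulNr scalerN scaleNr.
Qed.

Lemma rotation_subgroup : one_parameter_subgroup_O rotation.
Proof.
split=> [t|s t|].
- by rewrite rotation_tr rotation_mul addNr rotation0.
- by rewrite rotation_mul.
have dc (a : R) : differentiable (fun s : R => s * c) a by exact: differentiableM.
move=> t; apply: differentiable_continuous; apply/differentiable_mxP => i j.
under eq_fun do rewrite !mxE -[_ *+ (i == j)]mulr_natr.
apply: differentiableD; apply: differentiableM => //.
  exact: differentiable_cos_comp.
apply: differentiableM => //; exact: differentiable_sin_comp.
Qed.

End Rotations.

(** Polarising |X y|^2 = c^2 |y|^2 yields X^T X = c^2, and X^T = - X. *)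
Lemma skew_square {R : realType} {n : nat} (X : 'M[R]_n.+1) (c : R) :
  X^T = - X -> (forall y, sphere y -> dotp (X *m y) (X *m y) = c ^+ 2) ->
  X *m X = - (c ^+ 2)%:M.
Proof.
move=> XT H.
have H' y : dotp (X *m y) (X *m y) = c ^+ 2 * dotp y y.
  have [->|y0] := eqVneq y 0; first by rewrite mulmx0 !dotp0l mulr0.
  have := H _ (dotp_normalize y0); rewrite -scalemxAr dotpZl dotpZr -sqr_enorm.
  rewrite -sqr_enorm => <-.
  have e0 : enorm y != 0 by rewrite gt_eqF ?enorm_gt0.
  by move: (enorm y) (enorm _) e0 => u v u0; field.
apply/matrixP => k l.
have E (i j : 'I_n.+1) : dotp (delta_mx i 0) ((X *m X) *m delta_mx j 0) = (X *m X) i j.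
  by rewrite dotp_delta -colE mxE.
have D (i j : 'I_n.+1) : dotp (X *m delta_mx i 0) (X *m delta_mx j 0) = - (X *m X) j i.
  by rewrite dotp_mulmx XT mulNmx dotpNl mulmxA dotpC E.
have S : (X *m X) l k = (X *m X) k l.
  have T : (X *m X)^T = X *m X by rewrite trmx_mul XT mulNmx mulmxN opprK.
  by rewrite -[in LHS]T mxE.
have := H' (delta_mx k 0 + delta_mx l 0).
rewrite mulmxDr !dotpDl !dotpDr !H' !D !dotp_delta S.
have de (i j : 'I_n.+1) : (delta_mx j 0 : 'cV[R]_n.+1) i 0 = (i == j)%:R.
  by rewrite mxE eqxx andbT.
have -> : (- (c ^+ 2)%:M) k l = - (c ^+ 2 * (k == l)%:R) by rewrite !mxE mulr_natr.
rewrite !de !eqxx (eq_sym l k) (_ : true%:R = 1 :> R) //.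
by move: ((X *m X) k l) ((k == l)%:R : R) (c ^+ 2) => a d e; nra.
Qed.

Lemma local_rigidity {R : realType} {m n : nat} (M : riemannianManifold R m)
    (phi : M -> 'cV[R]_n.+1) : (0 < n)%N -> onto_sphere phi -> submersive phi ->
  harmonic_morphism phi -> locally_rigid phi.
Proof.
move=> n0 honto hsub hphi V [[sV tV] hV] pV.
have sphi : smooth_to_sphere phi := hphi.1.1.
have oP := @open_punctured R n.+1.
pose Y k := descent phi (fun x => V x k 0).
have YE k x : Y k (phi x) = V x k 0 by apply: (descentE1 hphi); exact: factors_coord.
have hY k : homogeneous0 (Y k) by exact: descent_homogeneous.
have sY k : smooth_on punctured (Y k).
  apply: (descent_smooth n0 honto hsub hphi); first exact: factors_coord.
  exact: (smooth_map_locally_smooth hphi).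
have Q2 x : \sum_k Y k (phi x) ^+ 2 = dotp (V x) (V x).
  by rewrite dotpE; apply: eq_bigr => k _; rewrite YE expr2.
have tY (y : 'cV[R]_n.+1) : y != 0 -> \sum_k y k 0 * Y k y = 0.
  move=> y0; have [x xy] := punctured_phi honto y0.
  rewrite xy; have e0 := y0; rewrite -enorm_gt0 in e0.
  under eq_bigr do rewrite hY ?(phi_neq0 hphi) // YE mxE -mulrA.
  by rewrite -mulr_sumr -dotpE tV mulr0.
(* The exponential involves the norm |t| |V x|; the sign of t disappears because cosine is even and
   sine is odd. *)
have variationE t x : Defs.variation phi V t x = cos (t * enorm (V x)) *: phi x +
    (sin (t * enorm (V x)) * (enorm (V x))^-1) *: V x.
  rewrite /Defs.variation sphere_expE ?(sphi.2 x) ?dotpZr ?tV ?mulr0 //; last exact: sphi.2.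
  rewrite enormZ !scalerA; have [->|t0] := eqVneq t 0.
    by rewrite normr0 !mul0r sin0 !mul0r.
  congr (_ *: _ + _ *: _).
    by have [_|_] := ger0P t; rewrite ?mulNr ?cosN.
  have [_|_] := ger0P t; rewrite ?mulNr ?sinN ?invrN invfM;
    by move: (enorm _)^-1 (sin _) => a b; field.
(* The components of exp(t V) factor through [phi] and induce functions of degree 0. Without a
   zero-order term, the Laplacian on M is [l2] times the Euclidean one, and vanishing tension
   becomes the stated equation at [p]. *)
have rot p t : sphere p -> 0 < \sum_k Y k p ^+ 2 -> 0 < t ->
  let r (y : 'cV[R]_n.+1) := Num.sqrt (\sum_k Y k y ^+ 2) in
  tangent_proj (cos (t * r p) *: p + sin (t * r p) *: \col_k ((r p)^-1 * Y k p))
    (\col_k lap (fun y => cos (t * r y) * nhat k y + sin (t * r y) * ((r y)^-1 * Y k y)) p) = 0.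
  move=> pp Qp t0 r; have [x xp] := honto _ pp.
  pose psi := Defs.variation phi V t.
  have [[spsi psis] tens] := hV t.
  have fpsi k : factors phi (fun x => psi x k 0).
    by move=> x1 x2 x12; rewrite /psi /Defs.variation x12 (pV _ _ x12).
  have [i [U [e [fe _]]]] := tens x.
  have := tension_lap_along (conj spsi psis) (tens x) fe.
  have [l2 l20 /dilation_coord L] := frame_dilation n0 sphi hsub hphi.2 fe.
  rewrite -/psi.
  have -> : lap_along i e psi x = l2 *: \col_k lap
      (fun y => cos (t * r y) * nhat k y + sin (t * r y) * ((r y)^-1 * Y k y)) p.
    apply/colP => k; rewrite !mxE.
    pose g := descent phi (fun x => psi x k 0).
    have sg : smooth_on punctured g.
      by apply: (descent_smooth n0 honto hsub hphi) => //; exact: (smooth_map_locally_smooth hphi).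
    have eg : euler 0 g.
      move=> y y0; rewrite mul0r; apply: derive_radial0 => //.
      exact: descent_homogeneous.
    have -> : (fun y => psi y k 0) \o rm_param i = fun z => g (phi (rm_param i z)).
      by apply/funext => z; rewrite /g (descentE1 hphi).
    rewrite (harmonic_morphism_lap sphi (hphi.1.2 x) fe L sg eg) !mul0r subr0 xp; congr (_ * _).
    apply: (lap_eq_on oP (sphere_neq0 pp)) => y y0.
    have [x' xy] := punctured_phi honto y0; have e0 : 0 < enorm y by rewrite enorm_gt0.
    have Ye l : Y l y = V x' l 0 by rewrite xy hY ?(phi_neq0 hphi).
    have -> : r y = enorm (V x').
      rewrite /r /enorm dotpE; congr Num.sqrt.
      by apply: eq_bigr => l _; rewrite Ye expr2.
    have -> : nhat k y = phi x' k 0 by rewrite /nhat {2}xy mxE mulKf ?gt_eqF.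
    rewrite /g xy descent_homogeneous ?(phi_neq0 hphi) // (descentE1 hphi) // -xy Ye.
    by rewrite /psi variationE !mxE mulrA.
  rewrite tangent_projZ => /eqP; rewrite scaler_eq0 gt_eqF //= => /eqP.
  have -> : psi x = cos (t * r p) *: p + sin (t * r p) *: \col_k ((r p)^-1 * Y k p); last by [].
  rewrite /psi variationE -xp.
  have -> : r (phi x) = enorm (V x) by rewrite /r /enorm Q2.
  congr (_ + _); rewrite -scalerA; congr (_ *: _); apply/colP => k.
  by rewrite !mxE YE.
have Qc := flow_speed_constant n0 sY hY tY rot.
have Yl := flow_eigen n0 sY hY tY rot.
pose p0 : 'cV[R]_n.+1 := delta_mx 0 0.
have p00 : p0 != 0.
  by apply/eqP => /colP/(_ 0)/eqP; rewrite !mxE eqxx oner_eq0.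
pose c := Num.sqrt (\sum_k Y k p0 ^+ 2).
have Vc x : enorm (V x) = c.
  by rewrite /enorm -Q2 /c (Qc _ _ (phi_neq0 hphi x) p00).
have [X [XT XE Xc]] : exists X : 'M[R]_n.+1,
    [/\ X^T = - X, forall x, V x = X *m phi x & c = 0 -> X = 0].
  (* Speed zero is treated apart: the eigenvalue equation is available only at positive speed, and
     [rotation] requires [X = 0] in that case. *)
  have [c0|c0] := eqVneq c 0.
    exists 0; split=> [|x|//]; first by rewrite trmx0 oppr0.
    apply/eqP; rewrite mul0mx; apply: contraTT isT => Vx.
    by have := Vc x; rewrite c0 => /eqP; rewrite gt_eqF // enorm_gt0.
  suff [X [XT XE]] : exists X : 'M[R]_n.+1, X^T = - X /\ forall x, V x = X *m phi x.
    by exists X; split=> // /eqP; rewrite (negbTE c0).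
  apply: (harmonic_ext_rigid n0 honto hsub hphi sV tV pV) => k x.
  have x0 := phi_neq0 hphi x; have xx := sphi.2 x.
  have Qx : 0 < \sum_k Y k (phi x) ^+ 2.
    by rewrite Q2 dotp_gt0 -enorm_gt0 Vc lt0r c0 sqrtr_ge0.
  (* The extension of degree 1 is |y| Y. Its Laplacian on the sphere is n Y from |y|, plus twice the
     radial derivative of Y, which is 0, plus - n Y from the eigenvalue equation. *)
  rewrite (@lapM _ _ punctured _ (Y k)) //; last exact: smooth_on_enorm.
  rewrite lap_enorm // (Yl k _ xx Qx) enorm_sphere //.
  under eq_bigr do rewrite pd_enorm // nhat_sphere //.
  by rewrite (derive_radial0 (sY k) (hY k) x0); ring.
exists (rotation X c); last first.
  by move=> t x; rewrite variationE Vc XE /rotation mulmxDl mul_scalar_mx -scalemxAl.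
apply: rotation_subgroup => //.
apply: skew_square => // y yy; have [x <-] := honto _ yy.
by rewrite -XE -sqr_enorm Vc.
Qed.

Theorem theorem3p4 (R : realType) (m n : nat) (M : riemannianManifold R m)
    (hn : (1 <= n)%N) :
  (forall phi : M -> 'cV[R]_n.+1,
     onto_sphere phi -> submersive phi -> harmonic_morphism phi ->
     infinitesimally_rigid phi) /\
  (odd n -> compact [set: M] ->
   forall phi : M -> 'cV[R]_n.+1,
     onto_sphere phi -> submersive phi -> harmonic_morphism phi ->
     locally_rigid phi).
Proof.
split=> [phi honto hsub hphi|_ _ phi honto hsub hphi].
  exact: infinitesimal_rigidity.
exact: local_rigidity.
Qed.
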